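(* For each $\hbar\in\mathbb{R}\setminus\{0\}$ let $\Pi_\hbar$ be an arbitrary representation of the Banach-$*$-algebra $(\mathcal{M}(E),\star_\hbar)$, and put $Q^\Pi_\hbar(\widehat\mu):=\Pi_\hbar(\mu)$ for $\mu\in\mathcal{M}(E)$. Let $\varsigma$ be a semi-norm on $E$ with $|\sigma(f,g)|\le c\,\varsigma(f)\varsigma(g)$ for all $f,g\in E$ and some constant $c>0$. Then: (a) (Dirac) $\displaystyle\lim_{\hbar\to0}\bigl\|\{Q^\Pi_\hbar(\widehat\mu),Q^\Pi_\hbar(\widehat\nu)\}_\hbar-Q^\Pi_\hbar(\{\widehat\mu,\widehat\nu\})\bigr\|=0$ for all $\mu,\nu\in\mathcal{M}^1_\varsigma(E)$; (b) (von Neumann) $\displaystyle\lim_{\hbar\to0}\bigl\|Q^\Pi_\hbar(\widehat\mu)Q^\Pi_\hbar(\widehat\nu)-Q^\Pi_\hbar(\widehat\mu\cdot_0\widehat\nu)\bigr\|=0$ for all $\mu,\nu\in\mathcal{M}(E)$. (The limits are over $\hbar\neq0$, and the norms are operator norms.)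
   Context: Setting. $E$ is an infinite dimensional real vector space and $\sigma$ is a pre-symplectic form on $E$ (an $\mathbb{R}$-bilinear antisymmetric form, possibly degenerate, $\sigma\neq0$). $\{E_\alpha\mid\alpha\in I\}$ is the family of all finite dimensional subspaces of $E$ with their vector space topologies; $\mathcal{M}(E_\alpha)$ denotes the finite complex (regular) Borel measures on $E_\alpha$. $\tau_{\mathrm{il}}$ is the finest locally convex topology on $E$, $\mathsf{B}^{\mathrm{il}}(E)$ its Borel $\sigma$-algebra. $\mathcal{M}(E)$ is the closure of $\bigcup_\alpha\mathcal{M}(E_\alpha)$ (measures concentrated on finite dimensional subspaces) in the total variation norm $\|\mu\|_1=|\mu|(E)$, within the finite complex measures on $\mathsf{B}^{\mathrm{il}}(E)$. $(\mathcal{M}(E),\star_\hbar)$, $\hbar\in\mathbb{R}$, is the Banach-$*$-algebra with $\mu^*(\Lambda)=\overline{\mu(-\Lambda)}$ and $\mu\star_\hbar\nu(\Lambda)=\int_E d\mu(f)\int_E d\nu(g)\,e^{-\frac i2\hbar\sigma(f,g)}\mathbf 1_\Lambda(f+g)$. $\mathcal{M}^1_\varsigma(E)$ is the set of $\mu\in\mathcal{M}(E)$ with $\int_E\varsigma\,d|\mu|<\infty$. For $\mu,\nu\in\mathcal{M}^1_\varsigma(E)$ the measure $\{\mu,\nu\}_0\in\mathcal{M}(E)$ is $\{\mu,\nu\}_0(\Lambda)=\int_E d\mu(f)\int_E d\nu(g)\,\sigma(f,g)\mathbf 1_\Lambda(f+g)$. Fourier transforms are $\widehat\mu[F]=\int_E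 d\mu(f)\,e^{iF(f)}$ for $F$ in the topological dual $E'_\tau$ of $E$ with respect to a (Hausdorff) locally convex topology $\tau$; $\mu\mapsto\widehat\mu$ is injective on $\mathcal{M}(E)$. The Poisson bracket of Fourier transforms is $\{\widehat\mu,\widehat\nu\}:=\widehat{\{\mu,\nu\}_0}$, and $\cdot_0$ is the pointwise product of functions, so $\widehat\mu\cdot_0\widehat\nu=\widehat{\mu\star_0\nu}$. A representation of a Banach-$*$-algebra is a $*$-homomorphism into the bounded operators of a complex Hilbert space. The $\hbar$-scaled commutator of bounded operators is $\{A,B\}_\hbar:=\frac i\hbar(AB-BA)$, $\hbar\neq0$. *)

(* Defs.v *)
From HB Require Import structures.
From mathcomp Require Import all_boot all_order all_algebra sesquilinear.
From mathcomp Require Import all_classical all_reals all_analysis.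
From mathcomp Require Import complex.

Set Implicit Arguments.
Unset Strict Implicit.
Unset Printing Implicit Defensive.

Import Order.TTheory GRing.Theory Num.Theory.
Import numFieldNormedType.Exports.

Local Open Scope classical_set_scope.
Local Open Scope ring_scope.

Section finest_topology.
Context {R : realType} {E : lmodType R}.
Implicit Types (U V : set E) (x y : E).

Definition is_convex V :=
  forall x y (t : R), V x -> V y -> 0 <= t <= 1 -> V (t *: x + (1 - t) *: y).

Definition is_absorbing V :=
  forall x, exists2 e : R, 0 < e & forall t : R, `|t| <= e -> V (t *: x).

(* The convex absorbing sets are a fundamental system of neighbourhoods of the
   origin for the finest locally convex topology. *)
Definition finest_open U :=
  forall x, U x -> exists V,
    [/\ is_convex V, is_absorbing V & forall v, V v -> U (x + v)].

Lemma is_absorbing0 V : is_absorbing V -> V 0.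
Proof. by move=> /(_ 0)[e e0 /(_ 0)]; rewrite scaler0 normr0; apply; exact: ltW. Qed.

Lemma is_convexI V W : is_convex V -> is_convex W -> is_convex (V `&` W).
Proof. by move=> cV cW x y t [Vx Wx] [Vy Wy] t01; split; [exact: cV|exact: cW]. Qed.

Lemma is_absorbingI V W : is_absorbing V -> is_absorbing W -> is_absorbing (V `&` W).
Proof.
move=> aV aW x; have [e e0 eV] := aV x; have [f f0 fW] := aW x.
exists (Num.min e f); first by rewrite lt_min e0 f0.
by move=> t; rewrite le_min => /andP[te tf]; split; [exact: eV|exact: fW].
Qed.

Lemma is_convexZ (a : R) V : is_convex V -> is_convex [set v | V (a *: v)].
Proof.
move=> cV x y t /= Vx Vy t01.
by rewrite scalerDr !scalerA mulrC (mulrC a) -!scalerA; exact: cV.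
Qed.

Lemma is_absorbingZ (a : R) V : is_absorbing V -> is_absorbing [set v | V (a *: v)].
Proof.
move=> aV x; have [e e0 eV] := aV (a *: x); exists e => // t te /=.
by rewrite scalerA mulrC -scalerA; exact: eV.
Qed.

Lemma finest_openT : finest_open setT.
Proof.
move=> x _; exists setT; split => //.
by move=> y; exists 1.
Qed.

Lemma finest_openI : setI_closed finest_open.
Proof.
move=> U W oU oW x [/oU[V [cV aV VU]] /oW[V' [cV' aV' VW]]].
exists (V `&` V'); split; [exact: is_convexI|exact: is_absorbingI|].
by move=> v [/VU ? /VW ?]; split.
Qed.

Lemma finest_open_bigU (I : Type) (f : I -> set E) :
  (forall i, finest_open (f i)) -> finest_open (\bigcup_i f i).
Proof.
move=> of_ x [i _ /of_[V [cV aV Vf]]]; exists V; split => // v /Vf ?.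
by exists i.
Qed.

End finest_topology.

(* [finest E] is [E] with its finest locally convex topology; if [E] carries
   another topology, the two coexist. *)
Definition finest {R : realType} (E : lmodType R) : Type := E.

Section finest_tvs.
Context {R : realType} (E : lmodType R).

HB.instance Definition _ := GRing.Lmodule.on (finest E).
HB.instance Definition _ := isPointed.Build (finest E) 0.
HB.instance Definition _ := @isOpenTopological.Build (finest E)
  (@finest_open R E) finest_openT finest_openI (@finest_open_bigU R E).

Lemma openfE (U : set (finest E)) : open U = @finest_open R E U.
Proof. by []. Qed.

Let core (V : set E) := [set v | V v /\ is_absorbing [set w | V (v + w)]].

Let half_comb (V : set E) (u v : E) :
  is_convex V -> V u -> V v -> V ((2^-1 : R) *: (u + v)).
Proof.
move=> cV Vu Vv; have := cV u v 2^-1 Vu Vv.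
rewrite invr_ge0 ler0n invf_le1 ?ltr0n// ler1n => /(_ isT).
suff -> : (1 - 2^-1 : R) = 2^-1 by rewrite -scalerDr.
by apply/eqP; rewrite subr_eq [eqbLHS]splitr div1r.
Qed.

Let half2 (u : E) : (2^-1 : R) *: (2 *: u) = u.
Proof. by rewrite scalerA mulVf ?scale1r. Qed.

Let core_convex (V : set E) : is_convex V -> is_convex (core V).
Proof.
move=> cV x y t [Vx aVx] [Vy aVy] t01; split; first exact: cV.
move=> d; have [e e0 eV] := aVx d; have [f f0 fV] := aVy d.
exists (Num.min e f); first by rewrite lt_min e0 f0.
move=> s; rewrite le_min => /andP[se sf] /=.
have -> : t *: x + (1 - t) *: y + s *: d =
    t *: (x + s *: d) + (1 - t) *: (y + s *: d).
  rewrite !scalerDr addrACA; congr (_ + _).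
  by rewrite -scalerDl addrC subrK scale1r.
by apply: cV => //; [exact: eV|exact: fV].
Qed.

Let core_open (x : E) (V : set E) : is_convex V ->
  open ([set z | core V (z - x)] : set (finest E)).
Proof.
move=> cV; rewrite openfE => z /=; move vE : (z - x) => v [Vv aVv].
exists [set w | V (v + 2 *: w)]; split.
- move=> a b t /= Va Vb t01.
  suff -> : v + 2 *: (t *: a + (1 - t) *: b) =
      t *: (v + 2 *: a) + (1 - t) *: (v + 2 *: b) by exact: cV.
  rewrite !scalerDr [RHS]addrACA -scalerDl [t + _]addrC subrK scale1r.
  by rewrite !scalerA mulrC (mulrC (1 - t)).
- exact: (@is_absorbingZ R E 2 [set w | V (v + w)]).
- move=> w /= Vw.
  rewrite (_ : z + w - x = (2^-1 : R) *: ((v + 2 *: w) + v)); last first.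
    rewrite addrAC vE -[in LHS](half2 w) -[in LHS](half2 v) -scalerDr.
    by rewrite scaler_nat mulr2n addrAC.
  split; first exact: half_comb.
  move=> d; have [e e0 eV] := aVv (2 *: d); exists e => // t te /=.
  rewrite -(half2 (t *: d)) -scalerDr -addrA; apply: half_comb => //.
  by rewrite scalerA mulrC -scalerA; exact: eV.
Qed.

Lemma nbhs_finestP (x : finest E) (U : set (finest E)) : nbhs x U <->
  exists V : set E, [/\ is_convex V, is_absorbing V & forall v : E, V v -> U (x + v)].
Proof.
split.
  rewrite nbhsE => -[B [oB Bx] BU].
  have [V [cV aV VB]] := oB x Bx.
  by exists V; split => // v /VB /BU.
move=> [V [cV aV VU]]; rewrite nbhsE.
exists [set z | core V (z - x)].
  split; first exact: core_open.
  rewrite /= subrr; split; first exact: is_absorbing0.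
  by move=> d; have [e e0 eV] := aV d; exists e => // t te /=; rewrite add0r; exact: eV.
by move=> z [/VU + _]; rewrite addrC subrK.
Qed.

Let finest_add_continuous : continuous (fun x : finest E * finest E => x.1 + x.2).
Proof.
move=> [x y] U /= /nbhs_finestP[V [cV aV VU]].
exists ([set z | V (2 *: (z - x))], [set z | V (2 *: (z - y))]).
  by split; apply/nbhs_finestP; exists [set v | V (2 *: v)]; split => //;
    [exact: is_convexZ|exact: is_absorbingZ| |
     exact: is_convexZ|exact: is_absorbingZ|];
    move=> v /=; rewrite addrAC subrr add0r.
move=> [a b] [/= Va Vb].
have -> : a + b = x + y + (2^-1 : R) *: (2 *: (a - x) + 2 *: (b - y)) :> E.
  by rewrite -scalerDr half2 addrACA (addrC x) (addrC y) !subrK.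
by apply/VU; apply: half_comb; [exact: cV|exact: Va|exact: Vb].
Qed.

Let finest_scale_continuous :
  continuous (fun z : R^o * finest E => z.1 *: z.2).
Proof.
move=> [a x] U /= /nbhs_finestP[V [cV aV VU]].
pose W := V `&` [set v | V (- 1 *: v)].
have cW : is_convex W by apply: is_convexI => //; exact: is_convexZ.
have aW : is_absorbing W by apply: is_absorbingI => //; exact: is_absorbingZ.
have W0 := is_absorbing0 aW.
have bW (t : R) w : `|t| <= 1 -> W w -> V (t *: w).
  move=> t1 [Vw VNw]; have [t0|t0] := leP 0 t.
    have := cV w 0 t Vw W0.1; rewrite scaler0 addr0; apply.
    by rewrite t0/= -(ger0_norm t0).
  have := cV _ 0 (- t) VNw W0.1; rewrite scaler0 addr0 scalerA mulrNN mulr1.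
  by apply; rewrite oppr_ge0 ltW//= -(ltr0_norm t0).
pose M : R := `|a| + 1.
have M0 : 0 < M by rewrite ltr_wpDl.
have [e e0 eV] := aV (2 *: x).
exists (ball (a : R^o) (Num.min e 1), [set z | W ((2 * M) *: (z - x))]).
  split; first by apply: nbhsx_ballx; rewrite lt_min e0 ltr01.
  apply/nbhs_finestP; exists [set v | W ((2 * M) *: v)].
  split; [exact: is_convexZ|exact: is_absorbingZ|].
  by move=> v /=; rewrite addrAC subrr add0r.
move=> [b y] [/=]; rewrite -ball_normE /= lt_min => /andP[abe ab1] Wy.
have bM : `|b| <= M.
  rewrite -(subrK a b) (le_trans (ler_normD _ _))// addrC lerD2l.
  by rewrite distrC ltW.
have -> : b *: y = a *: x +
    (2^-1 : R) *: ((b - a) *: (2 *: x) + (b / M) *: ((2 * M) *: (y - x))) :> E.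
  rewrite !scalerA (_ : b / M * (2 * M) = b * 2); last first.
    by rewrite mulrCA divfK ?gt_eqF// mulrC.
  rewrite -[(b - a) * 2]mulrC -[b * 2]mulrC -!scalerA -scalerDr half2.
  by rewrite scalerBl scalerBr addrA (addrC (a *: x)) subrK [RHS]addrC subrK.
apply: VU; apply: half_comb => //.
  by apply: eV; rewrite distrC ltW.
by apply: bW => //; rewrite normrM normfV (gtr0_norm M0) ler_pdivrMr// mul1r.
Qed.

Let finest_locally_convex : exists2 B : set_system (finest E),
  (forall b, b \in B -> convex_set b) & basis B.
Proof.
exists [set B : set (finest E) | open B /\ @is_convex R E B].
  move=> B /[!inE] -[_ cB] x y t /[!inE] Bx By.
  by have := cB x y t%:num Bx By; apply; apply/andP; split.
split; first by move=> B [].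
move=> x U /nbhs_finestP[V [cV aV VU]].
exists [set z | core V (z - x)]; last first.
  by move=> z [/VU + _] /=; rewrite addrC subrK.
split; last first.
  rewrite /= subrr; split; first exact: is_absorbing0.
  by move=> d; have [e e0 eV] := aV d; exists e => // t te /=; rewrite add0r; exact: eV.
split; first exact: core_open.
move=> a b t Ca Cb t01 /=.
rewrite (_ : _ - x = t *: (a - x) + (1 - t) *: (b - x)); last first.
  rewrite !scalerBr addrACA -opprD -scalerDl [t + _]addrC subrK.
  by rewrite scale1r.
exact: (core_convex cV).
Qed.

HB.instance Definition _ := @PreTopologicalLmod_isTvs.Build R (finest E)
  finest_add_continuous finest_scale_continuous finest_locally_convex.

End finest_tvs.

Lemma finest_universal (R : realType) (E : lmodType R) (T : tvsType R)
  (f : {linear E -> T}) : continuous (f : finest E -> T).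
Proof.
move=> x U /= fxU; apply/nbhs_finestP.
have [B Bcvx [Bopen Bbase]] := @locally_convex R T.
have [C [BC Cfx] CU] := Bbase _ _ fxU.
have cC := Bcvx C (mem_set BC).
exists [set v | C (f x + f v)]; split.
- move=> u v t /= Cu Cv /andP[t0 t1].
  have t01 : Itv.spec (@Itv.num_sem R) (Itv.Real `[0%Z, 1%Z]) t.
    by rewrite /= /Itv.num_sem/= num_real/= in_itv/= t0 t1.
  have := cC _ _ (Itv.mk t01) (mem_set Cu) (mem_set Cv); rewrite inE.
  suff -> : f x + f (t *: u + (1 - t) *: v) =
    t *: (f x + f u) + (1 - t) *: (f x + f v) by [].
  rewrite linearD !linearZ/= !scalerDr [RHS]addrACA.
  by rewrite -scalerDl [t + _]addrC subrK scale1r.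
- move=> v.
  have : (fun t : R^o => f x + t *: f v) @ (0 : R^o) --> f x + (0 : R) *: f v.
    apply: (@continuous_comp _ _ _ (fun t : R^o => (f x, t *: f v))
      (fun z : T * T => z.1 + z.2)); last exact: add_continuous.
    apply: cvg_pair; first exact: cvg_cst.
    apply: (@continuous_comp _ _ _ (fun t : R^o => (t, f v))
      (fun z : R^o * T => z.1 *: z.2)); last exact: scale_continuous.
    by apply: (@cvg_pair _ _ _ _ (nbhs (0 : R^o))); [exact: cvg_id|exact: cvg_cst].
  rewrite scale0r addr0 => /(_ C); rewrite /= => h.
  have /h : nbhs (f x) C by apply: open_nbhs_nbhs; split => //; exact: Bopen.
  move=> /nbhs_ballP[e /= e0 eC]; exists (e / 2); first by rewrite divr_gt0.
  move=> t te; rewrite linearZ; apply: eC; rewrite -ball_normE /= sub0r normrN.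
  by rewrite (le_lt_trans te)// ltr_pdivrMr// ltr_pMr// ltr1n.
- by move=> v /CU; rewrite /= -linearD.
Qed.

(* [E] with the Borel sigma-algebra of its finest locally convex topology *)
Definition borel {R : realType} (E : lmodType R) :=
  g_sigma_algebraType (@open (finest E)).

Section complex_measures.
Context {d} {T : measurableType d} {R : realType}.
Implicit Types (mu : set T -> R[i]) (nu : set T -> \bar R).

(* A complex measure is a function on all sets, with value 0 outside of the
   sigma-algebra, so that equality of measures is equality of functions.  The
   last two conditions amount to sigma-additivity in R[i] and entail
   [mu set0 = 0]. *)
Definition complex_measure mu :=
  [/\ forall A, ~ measurable A -> mu A = 0,
      semi_sigma_additive (fun A => (complex.Re (mu A))%:E) &
      semi_sigma_additive (fun A => (complex.Im (mu A))%:E)].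

Definition on_measurable mu A : R[i] := if `[< measurable A >] then mu A else 0.

(* [`|z|] is a real number seen in [R[i]]. *)
Definition cabs (z : R[i]) : R := complex.Re `|z|.

Definition total_variation mu (A : set T) : \bar R :=
  ereal_sup [set (\sum_(0 <= i <oo) (cabs (mu (F i)))%:E)%E | F in
    [set F : nat -> set T | [/\ forall i, measurable (F i), trivIset setT F &
                                \bigcup_i F i = A]]].

(* The Jordan decomposition of a finite signed measure [nu], see
   [positive_variationE] and [negative_variationE] below. *)
Definition positive_variation nu (A : set T) : \bar R :=
  ereal_sup [set nu B | B in [set B | measurable B /\ B `<=` A]].

Definition negative_variation nu : set T -> \bar R :=
  positive_variation (fun A => - nu A)%E.

Definition signed_integral nu (f : T -> R) : R :=
  fine (\int[positive_variation nu]_x (f x)%:E) -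
  fine (\int[negative_variation nu]_x (f x)%:E).

Definition cintegral mu (f : T -> R[i]) : R[i] :=
  let re_mu A := (complex.Re (mu A))%:E in
  let im_mu A := (complex.Im (mu A))%:E in
  let re_f x := complex.Re (f x) in
  let im_f x := complex.Im (f x) in
  Complex (signed_integral re_mu re_f - signed_integral im_mu im_f)
          (signed_integral re_mu im_f + signed_integral im_mu re_f).

Lemma positive_variationE (nu : {charge set T -> \bar R}) P N
    (nuPN : hahn_decomposition nu P N) A : measurable A ->
  positive_variation nu A = jordan_pos nuPN A.
Proof.
move=> mA; have [[mP nuP] [mN nuN] PNT PN0] := nuPN.
have posE B : measurable B -> jordan_pos nuPN B = nu (B `&` P).
  by move=> mB; rewrite jordan_posE cjordan_posE /crestr0 mem_set.
apply/eqP; rewrite eq_le; apply/andP; split.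
  apply: ge_ereal_sup => _ [B [mB BA] <-].
  suff /le_trans : (nu B <= jordan_pos nuPN B)%E.
    by apply; apply: le_measure => //; rewrite inE.
  rewrite posE// (charge_partition nu mB mP mN)// geeDl//.
  by apply: nuN; [exact: measurableI|exact: subIsetr].
rewrite posE//; apply: ereal_sup_ubound; exists (A `&` P) => //.
by split; [exact: measurableI|exact: subIsetl].
Qed.

Lemma negative_variationE (nu : {charge set T -> \bar R}) P N
    (nuPN : hahn_decomposition nu P N) A : measurable A ->
  negative_variation nu A = jordan_neg nuPN A.
Proof.
move=> mA; have [[mP nuP] [mN nuN] PNT PN0] := nuPN.
have negE B : measurable B -> jordan_neg nuPN B = (- nu (B `&` N))%E.
  by move=> mB; rewrite jordan_negE cjordan_negE /crestr0 mem_set.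
apply/eqP; rewrite eq_le; apply/andP; split.
  apply: ge_ereal_sup => _ [B [mB BA] <-].
  suff /le_trans : (- nu B <= jordan_neg nuPN B)%E.
    by apply; apply: le_measure => //; rewrite inE.
  rewrite negE// leeN2 (charge_partition nu mB mP mN)// leeDr//.
  by apply: nuP; [exact: measurableI|exact: subIsetr].
rewrite negE//; apply: ereal_sup_ubound; exists (A `&` N) => //.
by split; [exact: measurableI|exact: subIsetl].
Qed.

End complex_measures.

(* [expi t] is [e^{i t}]. *)
Definition expi {R : realType} (t : R) : R[i] := Complex (cos t) (sin t).

Section measure_algebra.
Context {R : realType} {E : lmodType R}.
Implicit Types (mu nu : set (borel E) -> R[i]) (f g : E).

Definition lin_span {n} (e : 'I_n -> E) : set E :=
  [set x | exists a : 'I_n -> R, x = \sum_(i < n) a i *: e i].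

Definition infinite_dimensional := forall n (e : 'I_n -> E), lin_span e <> setT.

(* The measures on a finite dimensional subspace, seen as measures on [E].
   Regularity need not be required: finite Borel measures on a finite
   dimensional space are regular. *)
Definition finite_dim_measure mu :=
  complex_measure mu /\
  exists n (e : 'I_n -> E), forall A : set (borel E), measurable A ->
    A `&` lin_span e = set0 -> mu A = 0.

Definition ME : set (set (borel E) -> R[i]) :=
  [set mu | complex_measure mu /\
    forall eps : R, 0 < eps -> exists2 nu, finite_dim_measure nu &
      (total_variation (fun A => mu A - nu A)%R setT < eps%:E)%E].

Definition is_seminorm (p : E -> R) :=
  (forall f g, p (f + g) <= p f + p g) /\
  (forall (a : R) f, p (a *: f) = `|a| * p f).

Definition ME1 (vs : E -> R) : set (set (borel E) -> R[i]) :=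
  [set mu | ME mu /\ (\int[total_variation mu]_f (vs f)%:E < +oo)%E].

Definition star mu : set (borel E) -> R[i] :=
  fun A => Num.conj (mu [set x : borel E | A (- (x : E))]).

Definition twisted_conv (sigma : E -> E -> R) (hbar : R) mu nu :
    set (borel E) -> R[i] :=
  on_measurable (fun A : set (borel E) => cintegral mu (fun f => cintegral nu (fun g =>
    expi (- (hbar * sigma f g / 2)) * (\1_(A : set E) (f + g))%:C%C))).

Definition bracket0 (sigma : E -> E -> R) mu nu : set (borel E) -> R[i] :=
  on_measurable (fun A : set (borel E) => cintegral mu (fun f => cintegral nu (fun g =>
    (sigma f g * \1_(A : set E) (f + g))%:C%C))).

End measure_algebra.

Arguments infinite_dimensional {R} E.
Arguments ME {R} E.

Definition dual {R : realType} (E : tvsType R) :=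
  {F : {linear E -> R^o} | continuous F}.

Definition fourier {R : realType} {E : tvsType R}
    (mu : set (borel E) -> R[i]) (F : dual E) : R[i] :=
  cintegral mu (fun f => expi (sval F f : R)).

(* complex Hilbert spaces: complete normed spaces whose norm comes from an
   inner product *)
Record hilbertType (R : realType) := HilbertType {
  hilbert_carrier :> completeNormedModType R[i];
  inner : {dot hilbert_carrier for Num.conj};
  hilbert_normE : forall x : hilbert_carrier, `|x| ^+ 2 = inner x x }.

Section operators.
Context {R : realType} {H : hilbertType R}.
Implicit Types A B : H -> H.

Definition bounded_operator A :=
  linear A /\ exists M : R[i], forall x, `|A x| <= M * `|x|.

(* Extended-real valued, hence also meaningful for unbounded maps. *)
Definition opnorm A : \bar R :=
  ereal_sup [set (complex.Re `|A x|)%:E | x in [set x : H | `|x| <= 1]].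

Definition scaled_commutator (hbar : R) A B : H -> H :=
  ('i / hbar%:C)%C \*: ((A \o B) \- (B \o A)).

(* The conditions are imposed on [ME E] only; [Pi] is arbitrary elsewhere.  No
   continuity or unitality is required. *)
Definition representation {E : lmodType R} (sigma : E -> E -> R) (hbar : R)
    (Pi : (set (borel E) -> R[i]) -> H -> H) :=
  [/\ forall mu, ME E mu -> bounded_operator (Pi mu),
      forall (a : R[i]) mu nu, ME E mu -> ME E nu ->
        Pi (fun S => a * mu S + nu S) = (a \*: Pi mu) \+ Pi nu,
      forall mu nu, ME E mu -> ME E nu ->
        Pi (twisted_conv sigma hbar mu nu) = Pi mu \o Pi nu &
      forall mu, ME E mu -> forall x y,
        inner H (Pi mu x) y = inner H x (Pi (star mu) y)].

End operators.

(* Main.v *)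
(* Every representation [Pi] of the twisted convolution algebra is bounded: if [b] is
   self-adjoint and small, the iteration [c := (b + c ** c) / 2] yields a self-adjoint
   [c] with [1 - b = (1 - c)^2], so [<x, Pi b x> <= <x, x>]; applied to
   [b = mu^* ** mu], this bounds the operator norm of [Pi mu] by a constant times the
   total mass of [mu], uniformly in [hbar].

   An element of [M(E)] is concentrated on the span of a sequence, on which addition
   and [sigma] are measurable. It is therefore a push-forward of a density with
   respect to a finite measure, and by Fubini products and brackets become
   push-forwards of explicit densities on a product space. The density of the
   error measure is [h h' (e^{-i hbar sigma / 2} - 1)] in (b) and
   [h h' ((2 / hbar) sin (hbar sigma / 2) - sigma)] in (a); both tend to [0]
   pointwise under an integrable bound ([2 |h h'| |sigma|] in (a), integrable by the
   moment condition), so dominated convergence concludes. *)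

Require Import Defs.
From HB Require Import structures.
From mathcomp Require Import all_boot all_order all_algebra sesquilinear.
From mathcomp Require Import all_classical all_reals all_analysis.
From mathcomp Require Import complex measurable_realfun.
From mathcomp Require Import ring lra.
Import Order.TTheory GRing.Theory Num.Theory.
Import numFieldNormedType.Exports.
Set Implicit Arguments.
Unset Strict Implicit.
Unset Printing Implicit Defensive.
Local Open Scope classical_set_scope.
Local Open Scope ring_scope.

(** * Complex-valued integrals *)

(** The size of a measure is measured by the supremum of [cnorm1 (mu A)] over measurable sets
    ([measure_bound]), a norm equivalent to the total variation that can be tested one set at a
    time. It explains the numbers below: passing to a density costs 4 (sign sets of the real and
    imaginary parts), a phase costs 2, so a twisted product costs 4 times 2 times 4, that is 32, for
    every [hbar]. On the ball of radius 1/64 the square root iteration then contracts by 1/2, and 64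
    becomes the constant of the operator norm bound. Integrals are suprema over simple functions,
    hence defined for arbitrary integrands. This matters because the inner integral of a twisted
    product is controlled only for [f] in the countable span; integrands are therefore exchanged on
    conull sets, and densities are arranged to vanish identically off the span. In (a) a first
    moment suffices because two bounds share the work: the one linear in [sigma] dominates, while
    the one quadratic in [sigma] gives pointwise convergence and is never integrated. *)

Section cnorm1.
Context {R : rcfType}.
Implicit Types z w : R[i].

(** The l1 norm of the two components replaces the modulus, so that the integrated norm of a density
    splits into real integrals. It is submultiplicative and lies within a factor 2 of the
    modulus. *)
Definition cnorm1 z : R := `|complex.Re z| + `|complex.Im z|.

Lemma ReD z w : complex.Re (z + w) = complex.Re z + complex.Re w.
Proof. by case: z; case: w. Qed.

Lemma ImD z w : complex.Im (z + w) = complex.Im z + complex.Im w.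
Proof. by case: z; case: w. Qed.

Lemma ReN z : complex.Re (- z) = - complex.Re z.
Proof. by case: z. Qed.

Lemma ImN z : complex.Im (- z) = - complex.Im z.
Proof. by case: z. Qed.

Lemma ReM z w : complex.Re (z * w) =
  complex.Re z * complex.Re w - complex.Im z * complex.Im w.
Proof. by case: z; case: w. Qed.

Lemma ImM z w : complex.Im (z * w) =
  complex.Re z * complex.Im w + complex.Im z * complex.Re w.
Proof. by case: z; case: w. Qed.

Lemma complex_eqP z w :
  complex.Re z = complex.Re w -> complex.Im z = complex.Im w -> z = w.
Proof. by case: z => a b; case: w => c d /= -> ->. Qed.

Lemma Re_conj z : complex.Re (Num.conj z) = complex.Re z.
Proof. by case: z. Qed.

Lemma Im_conj z : complex.Im (Num.conj z) = - complex.Im z.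
Proof. by case: z. Qed.

Lemma cnorm1_ge0 z : 0 <= cnorm1 z.
Proof. by rewrite addr_ge0. Qed.

Lemma cnorm10 : cnorm1 0 = 0.
Proof. by rewrite /cnorm1 /= normr0 addr0. Qed.

Lemma cnorm1N z : cnorm1 (- z) = cnorm1 z.
Proof. by rewrite /cnorm1 ReN ImN !normrN. Qed.

Lemma cnorm1D z w : cnorm1 (z + w) <= cnorm1 z + cnorm1 w.
Proof. by rewrite /cnorm1 ReD ImD addrACA lerD// ler_normD. Qed.

Lemma cnorm1M z w : cnorm1 (z * w) <= cnorm1 z * cnorm1 w.
Proof.
rewrite /cnorm1 ReM ImM (le_trans (lerD (ler_normB _ _) (ler_normD _ _)))//.
rewrite !normrM; lra.
Qed.

Lemma cnorm1_conj z : cnorm1 (Num.conj z) = cnorm1 z.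
Proof. by rewrite /cnorm1 Re_conj Im_conj normrN. Qed.

Lemma cnorm1_real (a : R) : cnorm1 a%:C%C = `|a|.
Proof. by rewrite /cnorm1 /= normr0 addr0. Qed.

Lemma cnorm1_eq0 z : cnorm1 z <= 0 -> z = 0.
Proof.
rewrite /cnorm1 => h; apply: complex_eqP => /=; apply/eqP; rewrite -normr_le0.
  by rewrite (le_trans _ h)// lerDl.
by rewrite (le_trans _ h)// lerDr.
Qed.

End cnorm1.

Lemma cabs_le_cnorm1 {R : realType} (z : R[i]) : cabs z <= cnorm1 z.
Proof.
rewrite /cabs normc_def /= /cnorm1.
have h0 : 0 <= `|complex.Re z| + `|complex.Im z| by rewrite addr_ge0.
rewrite -(ler_pXn2r (ltn0Sn 1)) ?nnegrE ?sqrtr_ge0// sqr_sqrtr ?addr_ge0 ?sqr_ge0//.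
by rewrite sqrrD !real_normK ?num_real// lerD2r lerDl mulrn_wge0// mulr_ge0.
Qed.

Lemma cnorm1_le_cabs {R : realType} (z : R[i]) : cnorm1 z <= 2 * cabs z.
Proof.
rewrite /cabs normc_def /= /cnorm1 mulr_natl mulr2n lerD//.
  by rewrite -(sqrtr_sqr (complex.Re z)) ler_wsqrtr// lerDl sqr_ge0.
by rewrite -(sqrtr_sqr (complex.Im z)) ler_wsqrtr// lerDr sqr_ge0.
Qed.

Section complex_measurable.
Context {d} {T : measurableType d} {R : realType}.
Implicit Types (H K : T -> R[i]).

Definition cmeasurable H :=
  measurable_fun setT (fun x => complex.Re (H x)) /\
  measurable_fun setT (fun x => complex.Im (H x)).

Lemma cmeasurable_cst (a : R[i]) : cmeasurable (fun=> a).
Proof. by split; exact: measurable_cst. Qed.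

Lemma cmeasurable_real (f : T -> R) :
  measurable_fun setT f -> cmeasurable (fun x => (f x)%:C%C).
Proof. by move=> mf; split => //=; exact: measurable_cst. Qed.

Lemma cmeasurableD H K : cmeasurable H -> cmeasurable K ->
  cmeasurable (fun x => H x + K x).
Proof.
move=> [mr mi] [mr' mi']; split.
  by under eq_fun do rewrite ReD; exact: measurable_funD.
by under eq_fun do rewrite ImD; exact: measurable_funD.
Qed.

Lemma cmeasurableM H K : cmeasurable H -> cmeasurable K ->
  cmeasurable (fun x => H x * K x).
Proof.
move=> [mr mi] [mr' mi']; split.
  by under eq_fun do rewrite ReM; apply: measurable_funB; exact: measurable_funM.
by under eq_fun do rewrite ImM; apply: measurable_funD; exact: measurable_funM.
Qed.

Lemma cmeasurable_conj H : cmeasurable H -> cmeasurable (fun x => Num.conj (H x)).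
Proof.
move=> [mr mi]; split; first by under eq_fun do rewrite Re_conj.
by under eq_fun do rewrite Im_conj; exact: measurableT_comp.
Qed.

Lemma measurable_cnorm1 H : cmeasurable H ->
  measurable_fun setT (fun x => cnorm1 (H x)).
Proof. by move=> [mr mi]; apply: measurable_funD; exact: measurableT_comp. Qed.

Lemma cmeasurable_indic (A : set T) : measurable A ->
  cmeasurable (fun x => (\1_A x)%:C%C : R[i]).
Proof. by move=> mA; apply: cmeasurable_real; exact: measurable_indic. Qed.

Lemma cmeasurable_expi (f : T -> R) : measurable_fun setT f ->
  cmeasurable (fun x => expi (f x)).
Proof.
move=> mf; split => /=; apply: measurableT_comp => //.
  by apply: continuous_measurable_fun; exact: continuous_cos.
by apply: continuous_measurable_fun; exact: continuous_sin.
Qed.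

End complex_measurable.

Lemma cmeasurable_comp d d' (T : measurableType d) (T' : measurableType d')
    (R : realType) (psi : T' -> T) (H : T -> R[i]) :
  measurable_fun setT psi -> cmeasurable H -> cmeasurable (fun x => H (psi x)).
Proof.
by move=> mpsi [mr mi]; split;
  [exact: (measurableT_comp mr)|exact: (measurableT_comp mi)].
Qed.

Section complex_integral.
Context {d} {T : measurableType d} {R : realType}.
Variable P : {measure set T -> \bar R}.
Implicit Types (H K : T -> R[i]).

Definition cint H : R[i] :=
  Complex (\int[P]_x complex.Re (H x)) (\int[P]_x complex.Im (H x)).

Definition cintegrable H :=
  P.-integrable setT (fun x => (complex.Re (H x))%:E) /\
  P.-integrable setT (fun x => (complex.Im (H x))%:E).

Lemma cintegrable_measurable H : cintegrable H -> cmeasurable H.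
Proof.
by move=> [/measurable_int/measurable_EFinP ? /measurable_int/measurable_EFinP ?].
Qed.

Lemma integrable_cnorm1 H : cintegrable H ->
  P.-integrable setT (fun x => (cnorm1 (H x))%:E).
Proof.
move=> [ir ii]; have := integrableD measurableT (integrable_norm ir) (integrable_norm ii).
by apply: eq_integrable.
Qed.

Lemma cintegrable_le H (g : T -> R) : cmeasurable H ->
  P.-integrable setT (fun x => (g x)%:E) ->
  (forall x, cnorm1 (H x) <= g x) -> cintegrable H.
Proof.
move=> [mr mi] ig Hg; split.
  apply: (le_integrable measurableT _ _ ig); first exact/measurable_EFinP.
  move=> x _; rewrite /= lee_fin (le_trans _ (ler_norm _))//.
  by rewrite (le_trans _ (Hg x))// lerDl.
apply: (le_integrable measurableT _ _ ig); first exact/measurable_EFinP.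
move=> x _; rewrite /= lee_fin (le_trans _ (ler_norm _))//.
by rewrite (le_trans _ (Hg x))// lerDr.
Qed.

Lemma eq_cint H K : H =1 K -> cint H = cint K.
Proof. by move=> /funext ->. Qed.

Lemma cintegrableD H K : cintegrable H -> cintegrable K ->
  cintegrable (fun x => H x + K x).
Proof.
move=> iH iK; apply: (@cintegrable_le _ (fun x => cnorm1 (H x) + cnorm1 (K x))).
- by apply: cmeasurableD; exact: cintegrable_measurable.
- have := integrableD measurableT (integrable_cnorm1 iH) (integrable_cnorm1 iK).
  by apply: eq_integrable.
- by move=> x; exact: cnorm1D.
Qed.

Lemma cintegrableZ (a : R[i]) H : cintegrable H ->
  cintegrable (fun x => a * H x).
Proof.
move=> iH; apply: (@cintegrable_le _ (fun x => cnorm1 a * cnorm1 (H x))).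
- apply: cmeasurableM; first exact: cmeasurable_cst.
  exact: cintegrable_measurable.
- have := integrableZl measurableT (cnorm1 a) (integrable_cnorm1 iH).
  by apply: eq_integrable.
- by move=> x; exact: cnorm1M.
Qed.

Lemma cintegrable_conj H : cintegrable H ->
  cintegrable (fun x => Num.conj (H x)).
Proof.
move=> iH; apply: (cintegrable_le _ (integrable_cnorm1 iH)).
  exact/cmeasurable_conj/cintegrable_measurable.
by move=> x; rewrite cnorm1_conj.
Qed.

Lemma cintD H K : cintegrable H -> cintegrable K ->
  cint (fun x => H x + K x) = cint H + cint K.
Proof.
move=> [ir ii] [ir' ii']; apply: complex_eqP; rewrite ?(ReD, ImD)/=.
  by under eq_Rintegral do rewrite ReD; rewrite RintegralD.
by under eq_Rintegral do rewrite ImD; rewrite RintegralD.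
Qed.

Lemma cintZ (a : R[i]) H : cintegrable H ->
  cint (fun x => a * H x) = a * cint H.
Proof.
move=> [ir ii]; apply: complex_eqP; rewrite ?(ReM, ImM)/=.
  under eq_Rintegral do rewrite ReM.
  by rewrite RintegralB ?RintegralZl//;
   [exact: (integrableZl measurableT _ ir)|exact: (integrableZl measurableT _ ii)].
under eq_Rintegral do rewrite ImM.
by rewrite RintegralD ?RintegralZl//;
 [exact: (integrableZl measurableT _ ii)|exact: (integrableZl measurableT _ ir)].
Qed.

Lemma cint_conj H : cintegrable H ->
  cint (fun x => Num.conj (H x)) = Num.conj (cint H).
Proof.
move=> [ir ii]; apply: complex_eqP; rewrite ?(Re_conj, Im_conj)/=.
  by under eq_Rintegral do rewrite Re_conj.
under eq_Rintegral do rewrite Im_conj -mulN1r.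
by rewrite RintegralZl// mulN1r.
Qed.

Lemma cnorm1_cint H : cintegrable H ->
  cnorm1 (cint H) <= \int[P]_x cnorm1 (H x).
Proof.
move=> [ir ii]; rewrite /cnorm1 RintegralD//.
- by rewrite lerD//; apply: (le_normr_Rintegral measurableT).
- exact: integrable_norm ir.
- exact: integrable_norm ii.
Qed.

Lemma Re_cint_indic H (A : set T) :
  complex.Re (cint (fun x => H x * (\1_A x)%:C%C)) =
  \int[P]_(x in A) complex.Re (H x).
Proof.
rewrite [RHS]Rintegral_mkcond; apply: eq_Rintegral => x _.
rewrite ReM /= mulr0 subr0 patchE indicE.
by case: (_ \in _); rewrite ?mulr1 ?mulr0.
Qed.

Lemma Im_cint_indic H (A : set T) :
  complex.Im (cint (fun x => H x * (\1_A x)%:C%C)) =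
  \int[P]_(x in A) complex.Im (H x).
Proof.
rewrite [RHS]Rintegral_mkcond; apply: eq_Rintegral => x _.
rewrite ImM /= mulr0 add0r patchE indicE.
by case: (_ \in _); rewrite ?mulr1 ?mulr0.
Qed.

End complex_integral.

Section complex_Fubini.
Context d d' {T : measurableType d} {T' : measurableType d'} {R : realType}.
Variables (P : {finite_measure set T -> \bar R}).
Variables (P' : {finite_measure set T' -> \bar R}).
Implicit Type H : T * T' -> R[i].

(** Every section, not almost every one, is required to be integrable: the inner real integral then
    equals the extended one at each point, so [fine] can be pulled out. *)
Lemma Rintegral_prod1 (f : T * T' -> R) :
  (P \x P')%E.-integrable setT (EFin \o f) ->
  (forall x, P'.-integrable setT (fun y => (f (x, y))%:E)) ->
  (\int[(P \x P')%E]_z f z)%R = \int[P]_x \int[P']_y f (x, y).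
Proof.
move=> fi fxi; rewrite /Rintegral -(integral12_prod_meas1 fi).
congr fine; apply: eq_integral => x _; rewrite fineK//.
by apply: integrable_fin_num.
Qed.

Lemma Rintegral_prod2 (f : T * T' -> R) :
  (P \x P')%E.-integrable setT (EFin \o f) ->
  (forall y, P.-integrable setT (fun x => (f (x, y))%:E)) ->
  (\int[(P \x P')%E]_z f z)%R = \int[P']_y \int[P]_x f (x, y).
Proof.
move=> fi fxi; rewrite /Rintegral -(integral21_prod_meas1 fi).
congr fine; apply: eq_integral => x _; rewrite fineK//.
by apply: integrable_fin_num.
Qed.

Lemma cint_prod1 H : cintegrable (P \x P')%E H ->
  (forall x, cintegrable P' (fun y => H (x, y))) ->
  cint (P \x P')%E H = cint P (fun x => cint P' (fun y => H (x, y))).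
Proof.
move=> [ir ii] iH; apply: complex_eqP; apply: Rintegral_prod1 => // x;
  by case: (iH x).
Qed.

Lemma cint_prod2 H : cintegrable (P \x P')%E H ->
  (forall y, cintegrable P (fun x => H (x, y))) ->
  cint (P \x P')%E H = cint P' (fun y => cint P (fun x => H (x, y))).
Proof.
move=> [ir ii] iH; apply: complex_eqP; apply: Rintegral_prod2 => // x;
  by case: (iH x).
Qed.

Lemma integrable_prod (f : T -> R) (g : T' -> R) :
  P.-integrable setT (EFin \o f) -> P'.-integrable setT (EFin \o g) ->
  (P \x P')%E.-integrable setT (fun z => (f z.1 * g z.2)%:E).
Proof.
move=> fi gi; apply/integrable12ltyP.
  apply/measurable_EFinP; apply: measurable_funM.
    by apply: measurableT_comp => //; exact/measurable_EFinP/(measurable_int _ fi).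
  by apply: measurableT_comp => //; exact/measurable_EFinP/(measurable_int _ gi).
have /integrableP[mg gf] := gi; have /integrableP[mf ff] := fi.
have E x : (\int[P']_y `|(f x * g y)%:E| =
    `|f x|%:E * \int[P']_y `|(g y)%:E|)%E.
  rewrite -ge0_integralZl//; last exact: (measurableT_comp _ mg).
  by apply: eq_integral => y _; rewrite /= normrM EFinM.
under eq_integral do rewrite E.
rewrite ge0_integralZr//.
- apply: lte_mul_pinfty => //; first exact: integral_ge0.
  by rewrite ge0_fin_numE//; exact: integral_ge0.
- apply/measurable_EFinP; apply: measurableT_comp => //.
  exact/measurable_EFinP.
- exact: integral_ge0.
Qed.

Lemma Rintegral_prodM (f : T -> R) (g : T' -> R) :
  P.-integrable setT (EFin \o f) -> P'.-integrable setT (EFin \o g) ->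
  (\int[(P \x P')%E]_z (f z.1 * g z.2))%R = (\int[P]_x f x) * (\int[P']_y g y).
Proof.
move=> fi gi; rewrite Rintegral_prod1//=; last 2 first.
- exact: integrable_prod.
- by move=> x; exact: (integrableZl measurableT _ gi).
under eq_Rintegral do rewrite RintegralZl//.
by rewrite RintegralZr.
Qed.

End complex_Fubini.

(** * Countable spans and the finest locally convex topology *)

Section algebraic_separation.
Context {R : realType} {E : lmodType R}.
Implicit Types (L : set E) (x y : E).

Definition is_subspace L :=
  L 0 /\ forall (a : R) x y, L x -> L y -> L (a *: x + y).

Lemma is_subspaceZ L (a : R) x : is_subspace L -> L x -> L (a *: x).
Proof. by move=> [L0 LD] Lx; rewrite -[_ *: _]addr0; exact: LD. Qed.

Lemma is_subspaceD L x y : is_subspace L -> L x -> L y -> L (x + y).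
Proof. by move=> [L0 LD] Lx Ly; rewrite -[x]scale1r; exact: LD. Qed.

Lemma is_subspaceB L x y : is_subspace L -> L x -> L y -> L (x - y).
Proof.
move=> sL Lx Ly; apply: is_subspaceD => //.
by rewrite -scaleN1r; exact: is_subspaceZ.
Qed.

(** By Zorn's lemma. A subspace that is maximal among those avoiding [x] is a hyperplane: adjoining
    any [y] outside it must capture [x], and the relation so obtained can be solved for [y]. *)
Lemma maximal_subspace_avoiding L x : is_subspace L -> ~ L x ->
  exists M, [/\ is_subspace M, L `<=` M, ~ M x &
    forall y, exists a : R, M (y - a *: x)].
Proof.
move=> sL Lx.
(* the empty set is added so that the union of the empty chain is allowed *)
pose P : set (set E) := [set M | M = set0 \/
  [/\ is_subspace M, L `<=` M & ~ M x]].
have [|M [PM Mmax]] := @Zorn_bigcup E P.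
  move=> F FP totF.
  have [[M0 [FM0 M0x]]|F0] := pselect (exists M0, F M0 /\ M0 !=set0); last first.
    left; apply/seteqP; split => // y [M FM My].
    by apply: F0; exists M; split => //; exists y.
  have FP' M : F M -> M !=set0 -> [/\ is_subspace M, L `<=` M & ~ M x].
    by move=> FM [y My]; have [M0'|//] := FP _ FM; rewrite M0' in My.
  have [sM0 LM0 M0nx] := FP' _ FM0 M0x.
  right; split.
  - split; first by exists M0 => //; case: sM0.
    move=> a u v [M1 FM1 M1u] [M2 FM2 M2v].
    have [M12|M21] := totF _ _ FM1 FM2.
      exists M2 => //; have [[_ sM2] _ _] := FP' _ FM2 (ex_intro _ _ M2v).
      by apply: sM2 => //; exact: M12.
    exists M1 => //; have [[_ sM1] _ _] := FP' _ FM1 (ex_intro _ _ M1u).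
    by apply: sM1 => //; exact: M21.
  - by move=> y /LM0 M0y; exists M0.
  - by move=> [M FM Mx]; have [] := FP' _ FM (ex_intro _ _ Mx).
have PL : P L by right; split.
have [sM LM Mx] : [/\ is_subspace M, L `<=` M & ~ M x].
  case: PM => // M0; exfalso; apply: (Mmax L) => //.
  rewrite M0; split => // /(_ 0) L0; apply: L0.
  by case: sL.
exists M; split => // y.
have [My|My] := pselect (M y); first by exists 0; rewrite scale0r subr0.
pose M' : set E := [set z | exists b : R, M (z - b *: y)].
have sM' : is_subspace M'.
  split; first by exists 0; rewrite scale0r subr0; case: sM.
  move=> a u v [b Mu] [c Mv]; exists (a * b + c).
  rewrite (_ : _ - _ = a *: (u - b *: y) + (v - c *: y)); last first.
    by rewrite scalerBr scalerA scalerDl opprD addrACA.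
  by case: sM => _; exact.
have MM' : M `<=` M' by move=> z Mz; exists 0; rewrite scale0r subr0.
have [[b Mb]|M'x] := pselect (M' x); last first.
  exfalso; apply: (Mmax M').
    split => // /(_ y) h; apply: My; apply: h.
    by exists 1; rewrite scale1r subrr; case: sM.
  by right; split => //; exact: subset_trans LM MM'.
have b0 : b != 0.
  by apply: contra_notN Mx => /eqP b0; move: Mb; rewrite b0 scale0r subr0.
exists b^-1; rewrite (_ : _ - _ = (- b^-1) *: (x - b *: y)).
  exact: is_subspaceZ.
by rewrite scalerBr scalerA mulNr mulVf// !scaleNr scale1r opprK addrC.
Qed.

(** The value [f y] is the unique coefficient [a] with [y - a *: x] in a maximal subspace that
    contains [L] and avoids [x]. Such forms are continuous for the finest topology, so they yield
    closed spans and measurable coordinates. *)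
Lemma separating_scalar L x : is_subspace L -> ~ L x ->
  exists f : E -> R, [/\ scalar f, forall y, L y -> f y = 0 & f x = 1].
Proof.
move=> sL Lx; have [M [sM LM Mx /choice[f Mf]]] := maximal_subspace_avoiding sL Lx.
have fE y a : M (y - a *: x) -> f y = a.
  move=> Mya; apply/eqP; rewrite -subr_eq0; apply/negP => /negP fa.
  apply: Mx; rewrite -[x]scale1r -(mulVf fa) -scalerA; apply: is_subspaceZ => //.
  rewrite (_ : _ *: x = (y - a *: x) - (y - f y *: x)); first exact: is_subspaceB.
  by rewrite scalerBl opprB [RHS]addrC addrA subrK.
exists f; split.
- move=> a u v; apply: fE.
  rewrite (_ : _ - _ = a *: (u - f u *: x) + (v - f v *: x)).
    by case: (sM) => _; apply.
  by rewrite scalerBr scalerA scalerDl opprD addrACA.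
- by move=> y Ly; apply: fE; rewrite scale0r subr0; exact: LM.
- by apply: fE; rewrite scale1r subrr; case: sM.
Qed.

End algebraic_separation.

Section sequential_span.
Context {R : realType} {E : lmodType R}.
Implicit Types (e : nat -> E) (x y : E).

(** Taking the first [n] terms of a single sequence gives an increasing chain of subspaces inside
    one countable span, whereas [lin_span] has an index type that changes with the dimension. *)
Definition seq_span e n : set E :=
  [set x | exists a : nat -> R, x = \sum_(i < n) a i *: e i].

Definition countable_span e : set E := \bigcup_n seq_span e n.

Lemma seq_span_lin_span e n : seq_span e n = lin_span (fun i : 'I_n => e i).
Proof.
apply/seteqP; split => x [a ->]; first by exists (fun i => a i).
exists (fun k => if insub k is Some i then a i else 0).
by apply: eq_bigr => i _; rewrite valK.
Qed.

Lemma seq_span_subspace e n : is_subspace (seq_span e n).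
Proof.
split; first by exists (fun=> 0); rewrite big1// => i _; rewrite scale0r.
move=> a _ _ [u ->] [v ->]; exists (fun i => a * u i + v i).
rewrite scaler_sumr -big_split/=; apply: eq_bigr => i _.
by rewrite scalerDl scalerA.
Qed.

Lemma seq_spanS e n : seq_span e n `<=` seq_span e n.+1.
Proof.
move=> _ [a ->]; exists (fun i => if (i < n)%N then a i else 0).
rewrite big_ord_recr/= ltnn scale0r addr0.
by apply: eq_bigr => i _; rewrite ltn_ord.
Qed.

Lemma seq_span_le e m n : (m <= n)%N -> seq_span e m `<=` seq_span e n.
Proof.
move=> /subnK <-; elim: (n - m)%N => // k ih.
by apply: (subset_trans ih); rewrite addSn; exact: seq_spanS.
Qed.

Lemma mem_seq_span e n i : (i < n)%N -> seq_span e n (e i).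
Proof.
move=> ni; apply: (seq_span_le ni).
exists (fun k => (k == i)%:R); rewrite big_ord_recr/= eqxx scale1r big1 ?add0r//.
by move=> j _; rewrite ltn_eqF// scale0r.
Qed.

Lemma countable_span_pair e x y : countable_span e x -> countable_span e y ->
  exists n, seq_span e n x /\ seq_span e n y.
Proof.
move=> [m _ mx] [n _ ny]; exists (maxn m n).
by split; [apply: seq_span_le mx|apply: seq_span_le ny];
  rewrite ?leq_maxl ?leq_maxr.
Qed.

Lemma countable_span_subspace e : is_subspace (countable_span e).
Proof.
split; first by exists 0%N => //; case: (seq_span_subspace e 0).
move=> a u v ux vx; have [n [nu nv]] := countable_span_pair ux vx.
by exists n => //; case: (seq_span_subspace e n) => _; exact.
Qed.

Lemma mem_countable_span e i : countable_span e (e i).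
Proof. by exists i.+1 => //; exact: mem_seq_span. Qed.

Lemma countable_span_sub e e' : (forall i, countable_span e' (e i)) ->
  countable_span e `<=` countable_span e'.
Proof.
move=> ee' _ [n _ [a ->]].
elim: n => [|n ih]; first by rewrite big_ord0; case: (countable_span_subspace e').
rewrite big_ord_recr/=; apply: is_subspaceD => //.
  exact: countable_span_subspace.
by apply: is_subspaceZ => //; exact: countable_span_subspace.
Qed.

Lemma countable_span_bigcup (e_ : nat -> nat -> E) :
  exists e, forall k, countable_span (e_ k) `<=` countable_span e.
Proof.
(* The double family is listed along the codes of pairs of indices; a number that codes no pair
   contributes the vector 0, which does not enlarge the span. *)
exists (fun n => if unpickle n is Some (k, i) then e_ k i else 0).
move=> k; apply: countable_span_sub => i.
have := mem_countable_span (fun n => if unpickle n is Some (k, i) then e_ k i else 0)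
  (pickle (k, i)).
by rewrite pickleK.
Qed.

(** The vectors need not be independent. In the induction the new coordinate is a form that vanishes
    on the previous span and equals 1 at [e n], or the zero form if [e n] already lies in that span.
    The coordinates are defined on all of [E], hence Borel measurable. *)
Lemma seq_span_coord e n : exists l : nat -> E -> R, (forall i, scalar (l i)) /\
  forall x, seq_span e n x -> x = \sum_(i < n) l i x *: e i.
Proof.
elim: n => [|n [l [ls lE]]].
  exists (fun _ _ => 0); split.
    by move=> i a u v; rewrite mulr0 addr0.
  by move=> x [a ->]; rewrite !big_ord0.
have [f [fs f0 fe]] : exists f : E -> R, [/\ scalar f,
    forall x, seq_span e n x -> f x = 0 &
    forall x, seq_span e n.+1 x -> seq_span e n (x - f x *: e n)].
  have [en|en] := pselect (seq_span e n (e n)).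
    exists (fun=> 0); split => //.
      by move=> a u v; rewrite mulr0 addr0.
    move=> _ [a ->]; rewrite scale0r subr0 big_ord_recr/=.
    apply: is_subspaceD; first exact: seq_span_subspace.
      by exists a.
    by apply: is_subspaceZ => //; exact: seq_span_subspace.
  have [f [fs f0 f1]] := separating_scalar (seq_span_subspace e n) en.
  exists f; split => // _ [a ->]; rewrite big_ord_recr/= addrC fs f1 mulr1.
  rewrite f0 ?addr0; last by exists a.
  by rewrite addrAC subrr add0r; exists a.
exists (fun i x => if (i < n)%N then l i (x - f x *: e n) else f x); split.
  move=> i a u v; case: ifP => _; last exact: fs.
  rewrite fs.
  rewrite (_ : _ - _ = a *: (u - f u *: e n) + (v - f v *: e n)) ?ls//.
  by rewrite scalerBr scalerA scalerDl opprD addrACA.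
move=> x /fe xn; rewrite big_ord_recr/= ltnn.
rewrite -[LHS](subrK (f x *: e n)).
congr (_ + _); rewrite [LHS]lE//; apply: eq_bigr => i _.
by rewrite ltn_ord.
Qed.

Lemma absorbing_box e n (V : set E) : is_convex V -> is_absorbing V ->
  exists2 r : R, 0 < r & forall a : nat -> R, (forall i, (i < n)%N -> `|a i| <= r) ->
    V (\sum_(i < n) a i *: e i).
Proof.
move=> cV aV; elim: n => [|n [r r0 rV]].
  by exists 1 => // a _; rewrite big_ord0; exact: is_absorbing0.
have [s s0 sV] := aV (e n).
(* The new sum is the midpoint of the doubled old sum and the doubled new term, both of which lie in
   [V]; this is the origin of the division by 2. *)
exists (Num.min r s / 2); first by rewrite divr_gt0// lt_min r0 s0.
move=> a ra; rewrite big_ord_recr/=.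
have ars i : (i < n.+1)%N -> `|2 * a i| <= r /\ `|2 * a i| <= s.
  move=> /ra; rewrite normrM ger0_norm// ler_pdivlMr// mulrC.
  by rewrite le_min => /andP[].
have := cV (\sum_(i < n) (2 * a i) *: e i) ((2 * a n) *: e n) 2^-1.
rewrite (_ : _ + _ = \sum_(i < n) a i *: e i + a n *: e n); last first.
  congr (_ + _).
    by rewrite scaler_sumr; apply: eq_bigr => i _; rewrite scalerA mulKf.
  by rewrite scalerA; congr (_ *: _); lra.
apply.
- by apply: (rV (fun i => 2 * a i)) => i /ltnW/ars[].
- by apply: sV; have [] := ars n (ltnSn n).
- by lra.
Qed.

End sequential_span.

Section borel_measurability.
Context {R : realType} {E : lmodType R}.
Implicit Types (e : nat -> E) (x y : E).

Lemma finest_open_measurable (U : set E) :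
  finest_open U -> measurable (U : set (borel E)).
Proof. by move=> oU; exact: sub_sigma_algebra. Qed.

Lemma scalar_eq0 (f : E -> R) : scalar f -> f 0 = 0.
Proof.
move=> /(_ 1 0 0); rewrite scale1r addr0 mul1r => /eqP.
by rewrite -subr_eq subrr => /eqP.
Qed.

Lemma scalar_seminorm (f : E -> R) : scalar f -> is_seminorm (fun x => `|f x|).
Proof.
move=> fs; have f0 := scalar_eq0 fs.
split.
  by move=> x y; rewrite -[x in f (x + y)]scale1r fs mul1r ler_normD.
by move=> a x; rewrite -[a *: x]addr0 fs f0 addr0 normrM.
Qed.

Lemma seminorm0 (p : E -> R) : is_seminorm p -> p 0 = 0.
Proof. by move=> [_ pZ]; rewrite -(scale0r 0) pZ normr0 mul0r. Qed.

Lemma seminormN (p : E -> R) x : is_seminorm p -> p (- x) = p x.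
Proof. by move=> [_ pZ]; rewrite -scaleN1r pZ normrN1 mul1r. Qed.

Lemma seminorm_ge0 (p : E -> R) x : is_seminorm p -> 0 <= p x.
Proof.
move=> sp; have [pD _] := sp; have := pD x (- x).
by rewrite subrr seminorm0// seminormN// -mulr2n pmulrn_lge0.
Qed.

Lemma seminorm_ball (p : E -> R) (r : R) : is_seminorm p -> 0 < r ->
  is_convex [set x | p x < r] /\ is_absorbing [set x | p x < r].
Proof.
move=> sp r0; have [pD pZ] := sp; split.
  move=> x y t /= px py /andP[t0 t1].
  rewrite (le_lt_trans (pD _ _))// !pZ !ger0_norm ?subr_ge0//.
  have [->|t_neq0] := eqVneq t 0; first by rewrite mul0r add0r subr0 mul1r.
  have t_gt0 : 0 < t by rewrite lt_neqAle eq_sym t_neq0.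
  have h1 : 0 < t * (r - p x) by rewrite mulr_gt0// subr_gt0.
  have h2 : 0 <= (1 - t) * (r - p y) by rewrite mulr_ge0// subr_ge0// ltW.
  by rewrite !mulrBr in h1 h2; lra.
move=> x; have px := seminorm_ge0 x sp.
exists (r / (p x + 1) / 2); first by rewrite !divr_gt0// ltr_wpDl.
move=> t tr /=; rewrite pZ.
have p1 : 0 < p x + 1 by rewrite ltr_wpDl.
rewrite (le_lt_trans (ler_wpM2r px tr))//.
rewrite mulrAC ltr_pdivrMr// mulrAC ltr_pdivrMr//.
by nra.
Qed.

(** The one-sided inequality makes every superlevel set open, because the open balls of a semi-norm
    are convex and absorbing, hence neighbourhoods of the origin in the finest topology. *)
Lemma borel_measurable_lipschitz (p f : E -> R) : is_seminorm p ->
  (forall x v, f x <= f (x + v) + p v) ->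
  measurable_fun setT (f : borel E -> R).
Proof.
move=> sp fp _; apply: (measurability _ (RGenOInfty.measurableE R)) => //.
move=> _ [_ [r ->] <-]; rewrite setTI; apply: finest_open_measurable.
move=> x; rewrite /= in_itv/= andbT => rf.
have rf0 : 0 < f x - r by rewrite subr_gt0.
have [cV aV] := seminorm_ball sp rf0.
exists [set v | p v < f x - r]; split => // v /= pv.
rewrite in_itv/= andbT; have := fp x v; lra.
Qed.

Lemma measurable_scalar (f : E -> R) : scalar f ->
  measurable_fun setT (f : borel E -> R).
Proof.
move=> fs; apply: (borel_measurable_lipschitz (scalar_seminorm fs)) => x v.
rewrite [x + v]addrC -[v in f (v + x)]scale1r fs mul1r.
by have := ler_norm (- f v); rewrite normrN; lra.
Qed.

Lemma measurable_seminorm (p : E -> R) : is_seminorm p ->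
  measurable_fun setT (p : borel E -> R).
Proof.
move=> sp; apply: (borel_measurable_lipschitz sp) => x v.
by have [pD _] := sp; have := pD (x + v) (- v); rewrite addrK seminormN.
Qed.

Lemma measurable_oppE : measurable_fun setT ((fun x => - (x : E)) : borel E -> borel E).
Proof.
move=> _; apply: measurability => //.
move=> _ [U oU <-]; rewrite setTI; apply: finest_open_measurable => x /= Ux.
have [V [cV aV VU]] := oU _ Ux.
exists [set v | V (-1 *: v)]; split.
- exact: is_convexZ.
- exact: is_absorbingZ.
- by move=> v /= Vv; rewrite opprD -[- v]scaleN1r; exact: VU.
Qed.

(** The complement is open: a form that vanishes on the span and equals 1 at [x] is nonzero at
    [x + v] as soon as its absolute value at [v] is less than 1. *)
Lemma measurable_seq_span e n : measurable (seq_span e n : set (borel E)).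
Proof.
rewrite -[seq_span e n]setCK; apply: measurableC; apply: finest_open_measurable.
move=> x ex; have [f [fs f0 f1]] := separating_scalar (seq_span_subspace e n) ex.
have [cV aV] := seminorm_ball (scalar_seminorm fs) ltr01.
exists [set v | `|f v| < 1]; split => // v /= fv /f0.
rewrite -[x]scale1r fs mul1r f1 => /eqP; rewrite addrC addr_eq0 => /eqP fvN.
by move: fv; rewrite fvN normrN1 ltxx.
Qed.

Lemma measurable_countable_span e : measurable (countable_span e : set (borel E)).
Proof. by apply: bigcupT_measurable => n; exact: measurable_seq_span. Qed.

(** A measurable retraction onto the countable span, not a linear projection: everything outside is
    sent to 0. *)
Definition span_proj e : borel E -> borel E :=
  fun x => if x \in countable_span e then x else 0 : E.

Lemma span_projP e (x : borel E) : countable_span e (span_proj e x).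
Proof.
rewrite /span_proj; case: ifPn => [/set_mem//|_].
by case: (countable_span_subspace e).
Qed.

Lemma span_projE e (x : borel E) : countable_span e x -> span_proj e x = x.
Proof. by move=> ex; rewrite /span_proj mem_set. Qed.

Lemma measurable_span_proj e : measurable_fun setT (span_proj e).
Proof.
apply: measurable_fun_ifT => //.
apply: (measurable_fun_bool true); rewrite setTI.
rewrite (_ : _ @^-1` _ = countable_span e); first exact: measurable_countable_span.
by apply/seteqP; split => x /=; [move/set_mem|move/mem_set].
Qed.

End borel_measurability.

Lemma measurable_countable_bigcup d (T : measurableType d) (I : countType)
    (P : set I) (F : I -> set T) :
  (forall i, measurable (F i)) -> measurable (\bigcup_(i in P) F i).
Proof.
move=> mF; rewrite (_ : \bigcup_(i in P) F i =
    \bigcup_n [set x | exists i, [/\ unpickle n = Some i, P i & F i x]]).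
  apply: bigcupT_measurable => n.
  have [[i ni]|nn] := pselect (exists i : I, unpickle n = Some i).
    have [Pi|Pi] := pselect (P i).
      rewrite (_ : [set _ | _] = F i)//; apply/seteqP; split => [x [j []]|x Fx].
        by rewrite ni => -[->].
      by exists i.
    rewrite (_ : [set _ | _] = set0)//; apply/seteqP; split => // x [j []].
    by rewrite ni => -[<-].
  rewrite (_ : [set _ | _] = set0)//; apply/seteqP; split => // x [j [nj _ _]].
  by apply: nn; exists j.
apply/seteqP; split => x.
  by move=> [i Pi Fx]; exists (pickle i) => //; exists i; rewrite pickleK.
by move=> [n _ [i [_ Pi Fx]]]; exists i.
Qed.

(** * Joint measurability of addition and of bilinear forms on a countable span *)

Section addition_on_countable_span.
Context {R : realType} {E : lmodType R} (e : nat -> E).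
Context d d' {X : measurableType d} {Y : measurableType d'}.
Variables (phi : X -> borel E) (psi : Y -> borel E).
Hypotheses (mphi : measurable_fun setT phi) (mpsi : measurable_fun setT psi).
Hypotheses (phie : forall x, countable_span e (phi x)).
Hypotheses (psie : forall y, countable_span e (psi y)).

Let pairs n : set (X * Y) :=
  [set z | seq_span e n (phi z.1) /\ seq_span e n (psi z.2)].

Let measurable_pairs n : measurable (pairs n).
Proof.
rewrite (_ : pairs n = (phi @^-1` seq_span e n) `*` (psi @^-1` seq_span e n))//.
by apply: measurableX; rewrite -[X in measurable X]setTI;
  [apply: mphi|apply: mpsi] => //; exact: measurable_seq_span.
Qed.

Let bigcup_pairs : \bigcup_n pairs n = setT.
Proof.
apply/seteqP; split => // z _.
have [n [zn zn']] := countable_span_pair (phie z.1) (psie z.2).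
by exists n.
Qed.

(* The traces on [seq_span e n] of the rational boxes are a countable base, so
   the preimage of an open set is a countable union of measurable rectangles. *)
Lemma measurable_add_span :
  measurable_fun setT (fun z : X * Y => (phi z.1 + psi z.2 : E) : borel E).
Proof.
have /choice[l lP] := @seq_span_coord R E e.
pose W n (q : seq rat) k : set E := seq_span e n `&`
  [set x | forall i, (i < n)%N -> `|l n i x - ratr (nth 0 q i)| < k.+1%:R^-1].
have mW n q k : measurable (W n q k : set (borel E)).
  apply: measurableI; first exact: measurable_seq_span.
  rewrite (_ : [set x | _] = \bigcap_(i in [set i | (i < n)%N])
    ((fun x => `|l n i x - ratr (nth 0 q i)|) @^-1` `]-oo, k.+1%:R^-1[%classic)).
    apply: bigcap_measurableType => i _.
    rewrite -[X in measurable X]setTI.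
    have : measurable_fun setT ((fun x => `|l n i x - ratr (nth 0 q i)|) : borel E -> R).
      apply: measurableT_comp => //; apply: measurable_funB => //.
      by apply: measurable_scalar; case: (lP n).
    by apply => //; exact: measurable_itv.
  by apply/seteqP; split => x xi i /xi /=; rewrite in_itv.
move=> _; apply: measurability => // _ [U oU <-]; rewrite setTI.
pose I := (nat * (seq rat * seq rat) * nat)%type.
pose good : set I := [set i | forall x y, W i.1.1 i.1.2.1 i.2 x ->
  W i.1.1 i.1.2.2 i.2 y -> U (x + y)].
rewrite (_ : _ @^-1` U = \bigcup_(i in good)
  ((phi @^-1` W i.1.1 i.1.2.1 i.2) `*` (psi @^-1` W i.1.1 i.1.2.2 i.2))).
  apply: measurable_countable_bigcup => i.
  by apply: measurableX; rewrite -[X in measurable X]setTI;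
    [apply: mphi|apply: mpsi] => //; exact: mW.
apply/seteqP; split => [z /= Uz|z [[[n [q q']] k] /= gi [/= zi zi']]]; last exact: gi.
have [n [zn zn']] := countable_span_pair (phie z.1) (psie z.2).
have [V [cV aV VU]] := oU _ Uz.
have [r r0 rV] := absorbing_box e n cV aV.
(* Four errors of size [k.+1%:R^-1] add up below [r]: [x] and [phi z.1] are each compared with one
   rational point, [y] and [psi z.2] with another. *)
have [k kr] : exists k : nat, k.+1%:R^-1 < r / 4.
  have r4 : 0 < r / 4 by rewrite divr_gt0.
  exists (Num.truncn (r / 4)^-1); rewrite invf_plt ?posrE//.
  by rewrite truncnS_gt.
have /choice[c cP] (t : R) : exists c : rat, `|t - ratr c| < k.+1%:R^-1.
  have k0 : 0 < k.+1%:R^-1 :> R by rewrite invr_gt0.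
  move: (k.+1%:R^-1) k0 => h h0.
  have [|c] := @rat_in_itvoo R (t - h) (t + h).
    by lra.
  rewrite in_itv/= => /andP[c1 c2]; exists c; rewrite ltr_norml; apply/andP; split; lra.
pose q x := [seq c (l n i x) | i <- iota 0 n].
have qP x i : (i < n)%N -> `|l n i x - ratr (nth 0 (q x) i)| < k.+1%:R^-1.
  by move=> ni; rewrite (nth_map 0%N) ?size_iota// nth_iota// add0n.
exists (n, (q (phi z.1), q (psi z.2)), k); last first.
  by split => /=; split => // i; exact: qP.
move=> x y /= [xn xq] [yn yq].
have lB i u v : l n i (u - v) = l n i u - l n i v.
  have [ls _] := lP n.
  by rewrite addrC -scaleN1r ls mulN1r addrC.
have {}VU := VU (x - phi z.1 + (y - psi z.2)).
suff Vxy : V (x - phi z.1 + (y - psi z.2)).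
  by have := VU Vxy; rewrite [X in U X](_ : _ = x + y)// addrACA !subrKC.
have [ls lE] := lP n.
have sn := seq_span_subspace e n.
rewrite (lE (x - _ + _)); last first.
  by apply: is_subspaceD => //; exact: is_subspaceB.
apply: (rV (fun i => l n i (x - phi z.1 + (y - psi z.2)))) => i ni.
rewrite -[x - _]scale1r ls mul1r !lB.
have := qP (phi z.1) i ni; have := qP (psi z.2) i ni; have := xq i ni; have := yq i ni.
move: (k.+1%:R^-1) kr => h hr.
rewrite !ltr_norml ler_norml => /andP[? ?] /andP[? ?] /andP[? ?] /andP[? ?].
by apply/andP; split; lra.
Qed.

(** Expanding only the first argument in coordinates gives, on each [pairs n], a finite sum of
    products of linear forms in one variable, and those are measurable. *)
Lemma measurable_bilinear_span (s : E -> E -> R) :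
  (forall y, scalar (s^~ y)) -> (forall x, scalar (s x)) ->
  measurable_fun setT (fun z : X * Y => s (phi z.1) (psi z.2)).
Proof.
move=> sl sr; rewrite -bigcup_pairs; apply/measurable_fun_bigcup => // n _.
have [l [ls lE]] := seq_span_coord e n.
apply: (eq_measurable_fun
  (fun z => \sum_(i < n) l i (phi z.1) * s (e i) (psi z.2))); last first; first exact: measurable_pairs.
  apply: measurable_funTS; apply: measurable_sum => i; apply: measurable_funM.
    by apply: measurableT_comp (measurable_scalar (ls i)) _; exact: measurableT_comp.
  by apply: measurableT_comp (measurable_scalar (sr (e i))) _; exact: measurableT_comp.
move=> z /set_mem[/lE zE _].
have s0 y : s 0 y = 0 := scalar_eq0 (sl y).
have sS m (a : nat -> R) y :
    s (\sum_(i < m) a i *: e i) y = \sum_(i < m) a i * s (e i) y.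
  elim: m => [|m ih]; first by rewrite !big_ord0.
  by rewrite !big_ord_recr/= [X in s X _]addrC sl ih addrC.
by rewrite [in RHS]zE (sS n (fun i => l i (phi z.1))).
Qed.

End addition_on_countable_span.

(** * Densities of complex measures *)

Section pushed_density.
Context d d' {Z : measurableType d} {T : measurableType d'} {R : realType}.
Variable P : {finite_measure set Z -> \bar R}.

(** The image under [psi] of the measure with density [G], with its formulas for sets, for
    non-negative functions and for integrable functions. *)
Lemma pushed_density (G : Z -> R) (psi : Z -> T) :
  P.-integrable setT (EFin \o G) -> (forall z, 0 <= G z) ->
  measurable_fun setT psi ->
  exists m : {finite_measure set T -> \bar R},
    [/\ forall A, measurable A -> m A = (\int[P]_(z in psi @^-1` A) (G z)%:E)%E,
      forall F : T -> \bar R, measurable_fun setT F -> (forall x, 0 <= F x)%E ->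
        (\int[m]_x F x = \int[P]_z (F (psi z) * (G z)%:E))%E &
      forall F : T -> R, measurable_fun setT F ->
        P.-integrable setT (fun z => (F (psi z) * G z)%:E) ->
        m.-integrable setT (EFin \o F) /\
        (\int[m]_x (F x))%R = (\int[P]_z (F (psi z) * G z))%R].
Proof.
move=> iG G0 mpsi.
have nu0 A : (0 <= induced_charge iG A)%E.
  by apply: integral_ge0 => z _; rewrite lee_fin.
pose p : {measure set Z -> \bar R} := measure_of_charge (induced_charge iG) nu0.
have pfin : fin_num_fun p by move=> A mA; exact: fin_num_measure.
pose q : {finite_measure set Z -> \bar R} :=
  HB.pack (Measure.sort p) (Measure_isFinite.Build _ _ _ (p : set Z -> \bar R) pfin).
pose m0' := (pushforward q psi : {measure set T -> \bar R}).
pose m0 := m0' mpsi.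
have m0fin : fin_num_fun m0.
  move=> A mA; apply: (fin_num_measure q (psi @^-1` A)); rewrite -[X in measurable X]setTI.
  exact: (mpsi measurableT _ mA).
pose m : {finite_measure set T -> \bar R} :=
  HB.pack (Measure.sort m0) (Measure_isFinite.Build _ _ _ (m0 : set T -> \bar R) m0fin).
have mE A : m A = q (psi @^-1` A) by [].
have qE A : q A = (\int[P]_(z in A) (G z)%:E)%E by [].
have qP : q `<< P.
  apply/null_content_dominatesP => A mA PA0; rewrite qE.
  apply: null_set_integral => //; apply: measurable_funTS.
  exact: measurable_int iG.
have ge0_density (f : Z -> \bar R) : measurable_fun setT f ->
    (forall z, 0 <= f z)%E ->
    (\int[q]_z f z = \int[P]_z (f z * (G z)%:E))%E.
  move=> mf f0.
  have mRN := measurable_int _ (Radon_Nikodym_SigmaFinite.f_integrable qP).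
  rewrite -(Radon_Nikodym_SigmaFinite.change_of_variables qP f0)//.
  apply: ae_eq_integral => //.
  - exact: emeasurable_funM.
  - by apply: emeasurable_funM => //; exact: measurable_int iG.
  (* Uniqueness of densities: the Radon-Nikodym derivative of [q] and [G] have the same integral
     over every measurable set, so they agree almost everywhere and the change of variables can be
     written with [G]. *)
  have /(_ measurableT) := @integral_ae_eq _ _ _ P setT _
    (EFin \o G) (Radon_Nikodym_SigmaFinite.f q P).
  move=> /(_ (Radon_Nikodym_SigmaFinite.f_integrable qP)).
  move=> /(_ (measurable_int _ iG)) h.
  have {}h : ae_eq P setT (Radon_Nikodym_SigmaFinite.f q P) (EFin \o G).
    by apply: h => A _ mA; rewrite -(Radon_Nikodym_SigmaFinite.f_integral qP).
  by apply: filterS h => z /= h _; rewrite h.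
exists m; split => // [F mF F0|F mF iFG].
  rewrite (ge0_integral_pushforward mpsi)// preimage_setT ge0_density//=.
  exact: measurableT_comp.
have mFpsi : measurable_fun setT (F \o psi) by exact: measurableT_comp.
have iq : q.-integrable setT (EFin \o F \o psi).
  apply/integrableP; split; first exact/measurable_EFinP.
  rewrite ge0_density//; last first.
    by apply: measurableT_comp => //; exact/measurable_EFinP.
  have /integrableP[_] := iFG; apply: le_lt_trans.
  rewrite le_eqVlt; apply/orP; left; apply/eqP; apply: eq_integral => z _.
  by rewrite /= normrM [`|G z|]ger0_norm.
split.
  apply: (integrable_pushforward mpsi) => //.
  exact/measurable_EFinP.
rewrite /Rintegral; congr fine.
rewrite (integral_pushforward mpsi)//; last exact/measurable_EFinP.
rewrite preimage_setT [LHS]integralE [RHS]integralE.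
have mE1 := measurable_funepos (iffRL (measurable_EFinP _ _) mFpsi).
have mE2 := measurable_funeneg (iffRL (measurable_EFinP _ _) mFpsi).
rewrite !ge0_density//; congr (_ - _)%E; apply: eq_integral => z _.
  by rewrite !funeposE /= -!EFin_max -EFinM maxr_pMl// mul0r.
by rewrite !funenegE /= -!EFin_max -EFinM maxr_pMl// mul0r mulNr.
Qed.

End pushed_density.

Section signed_integral.
Import HBNNSimple.
Context d {T : measurableType d} {R : realType}.
Implicit Types (p q : set T -> \bar R) (m : {finite_measure set T -> \bar R}).

(** The set functions need not be known to be measures: the integral is a supremum of sums over
    fibres of simple functions. This is what lets [positive_variation nu] be replaced under the
    integral by a Jordan part. *)
Lemma eq_set_integral p q (f : T -> \bar R) :
  (forall A, measurable A -> p A = q A) ->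
  (\int[p]_x f x = \int[q]_x f x)%E.
Proof.
move=> pq; have pqs (h : {nnsfun T >-> R}) : sintegral p h = sintegral q h.
  by apply: eq_fsbigr => r _; rewrite pq.
rewrite /integral; congr (ereal_sup _ - ereal_sup _)%E; apply/seteqP.
  by split => _ [h hf <-]; exists h.
by split => _ [h hf <-]; exists h.
Qed.

(* No measurability is required of [f] and [g]: the integral of a function is
   in general a lower integral. *)
Lemma eq_integral_conull m (S : set T) (f g : T -> \bar R) :
  measurable S -> m (~` S) = 0%E -> {in S, f =1 g} ->
  (\int[m]_x f x = \int[m]_x g x)%E.
Proof.
move=> mS mS0.
suff le_nn (u v : T -> \bar R) : (forall x, 0 <= v x)%E -> {in S, u =1 v} ->
    (ereal_sup [set sintegral m h | h in
      [set h : {nnsfun T >-> R} | forall x, (h x)%:E <= u x]] <=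
     ereal_sup [set sintegral m h | h in
      [set h : {nnsfun T >-> R} | forall x, (h x)%:E <= v x]])%E.
  move=> fg; rewrite /integral !patch_setT.
  have fgp : {in S, f^\+ =1 g^\+}%E by move=> x xS; rewrite !funeposE fg.
  have fgn : {in S, f^\- =1 g^\-}%E by move=> x xS; rewrite !funenegE fg.
  congr (_ - _)%E; apply/eqP; rewrite eq_le; apply/andP; split; apply: le_nn => //.
  - by move=> x xS; rewrite fgp.
  - by move=> x xS; rewrite fgn.
move=> v0 uv; apply: ge_ereal_sup => _ [h /= hu <-].
(* Truncated to [S], the simple function keeps its integral and falls below [v]: on [S] because [u]
   and [v] agree there, elsewhere because [v] is non-negative. *)
have -> : sintegral m h = sintegral m (proj_nnsfun h mS).
  rewrite -!integralT_nnsfun (ge0_negligible_integral (measurableC mS))//.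
  - rewrite [RHS](ge0_negligible_integral (measurableC mS))//; first last.
    + by move=> x _; rewrite lee_fin; exact: fun_ge0.
    + by apply/measurable_EFinP; exact: measurable_funP.
    apply: eq_integral => x; rewrite setTD setCK => xS.
    by rewrite /= mindicE xS mulr1.
  - by apply/measurable_EFinP; exact: measurable_funP.
  - by move=> x _; rewrite lee_fin; exact: fun_ge0.
apply: ereal_sup_ubound; exists (proj_nnsfun h mS) => // x /=.
by rewrite mindicE; have [xS|xS] := boolP (x \in S); rewrite ?mulr1 ?mulr0// -uv.
Qed.

Lemma le_finite_measure_integrable m1 m2 (F : T -> R) :
  (forall A, measurable A -> (m1 A <= m2 A)%E) ->
  m2.-integrable setT (EFin \o F) -> m1.-integrable setT (EFin \o F).
Proof.
move=> m12 /integrableP[mF iF]; apply/integrableP; split => //.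
by apply: le_lt_trans iF; apply: ge0_le_measure_integral => //; exact: measurableT_comp.
Qed.

(** The measures [m1] and [m2] may overlap. The Jordan parts of their difference are dominated by
    them, so all integrals of [G] are finite, and [F] may be exchanged for [G] since the parts do
    not charge the complement of [S]. *)
Lemma signed_integral_diff (nu : set T -> \bar R) m1 m2 (S : set T) (F G : T -> R) :
  (forall A, measurable A -> nu A = (m1 A - m2 A)%E) ->
  measurable S -> m1 (~` S) = 0%E -> m2 (~` S) = 0%E ->
  {in S, F =1 G} ->
  m1.-integrable setT (EFin \o G) -> m2.-integrable setT (EFin \o G) ->
  signed_integral nu F = \int[m1]_x G x - \int[m2]_x G x.
Proof.
move=> nuE mS m1S m2S FG i1 i2.
pose nu' := cadd (charge_of_finite_measure m1) (cscale (-1) (charge_of_finite_measure m2)).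
have nu'E A : nu' A = (m1 A - m2 A)%E by rewrite /nu' /cadd /= /cscale mulN1e.
have [Pos [Neg PN]] := Hahn_decomposition nu'.
pose jp := jordan_pos PN; pose jn := jordan_neg PN.
have posE A : measurable A -> positive_variation nu A = jp A.
  move=> mA; rewrite /jp -(positive_variationE PN)// /positive_variation.
  congr ereal_sup; apply/seteqP.
  by split => _ [B [mB BA] <-]; exists B => //; rewrite nuE// -nu'E.
have negE A : measurable A -> negative_variation nu A = jn A.
  move=> mA; rewrite /jn -(negative_variationE PN)// /negative_variation /positive_variation.
  congr ereal_sup; apply/seteqP.
  by split => _ [B [mB BA] <-]; exists B => //; rewrite nuE// -nu'E.
have jp1 A : measurable A -> (jp A <= m1 A)%E.
  move=> mA; rewrite -posE//; apply: ge_ereal_sup => _ [B [mB BA] <-].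
  rewrite nuE// (@le_trans _ _ (m1 B))//; last by apply: le_measure => //; rewrite inE.
  by rewrite -[leRHS]adde0 leeD2l// oppe_le0.
have jn2 A : measurable A -> (jn A <= m2 A)%E.
  move=> mA; rewrite -negE//; apply: ge_ereal_sup => _ [B [mB BA] <-].
  rewrite nuE// (@le_trans _ _ (m2 B))//; last by apply: le_measure => //; rewrite inE.
  have : (0 <= m1 B)%E by [].
  rewrite -[m1 B]fineK ?fin_num_measure// -[m2 B]fineK ?fin_num_measure//.
  by rewrite -EFinB -EFinN !lee_fin; lra.
have ijp : jp.-integrable setT (EFin \o G) := le_finite_measure_integrable jp1 i1.
have ijn : jn.-integrable setT (EFin \o G) := le_finite_measure_integrable jn2 i2.
have jpS : jp (~` S) = 0%E.
  by apply/eqP; rewrite eq_le measure_ge0 andbT -m1S jp1//; exact: measurableC.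
have jnS : jn (~` S) = 0%E.
  by apply/eqP; rewrite eq_le measure_ge0 andbT -m2S jn2//; exact: measurableC.
have FGE : {in S, (fun x => (F x)%:E) =1 (fun x => (G x)%:E)} by move=> x /FG ->.
rewrite /signed_integral (eq_set_integral _ posE) (eq_set_integral _ negE).
rewrite (eq_integral_conull mS jpS FGE) (eq_integral_conull mS jnS FGE).
have mG := measurable_int _ i1.
(* The two decompositions of [nu] are compared after moving the negative terms across, so that only
   sums of positive measures are integrated. *)
have : (\int[measure_add jp m2]_x (G x)%:E = \int[measure_add m1 jn]_x (G x)%:E)%E.
  apply: eq_set_integral => A mA; rewrite /= !measure_addE; change (jp A + m2 A = m1 A + jn A)%E.
  have : (m1 A - m2 A = jp A - jn A)%E.
    by rewrite -nu'E [LHS](jordan_decomp PN mA) /cadd/= /cscale mulN1e.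
  have f1 : m1 A \is a fin_num by rewrite fin_num_measure.
  have f2 : m2 A \is a fin_num by rewrite fin_num_measure.
  have f3 : jp A \is a fin_num by rewrite fin_num_measure.
  have f4 : jn A \is a fin_num by rewrite fin_num_measure.
  rewrite -(fineK f1) -(fineK f2) -(fineK f3) -(fineK f4) -!EFinB -!EFinD => -[h].
  by congr EFin; lra.
rewrite !integral_measure_add// /Rintegral.
have f1 : (\int[m1]_x (G x)%:E)%E \is a fin_num by exact: integrable_fin_num.
have f2 : (\int[m2]_x (G x)%:E)%E \is a fin_num by exact: integrable_fin_num.
have f3 : (\int[jp]_x (G x)%:E)%E \is a fin_num by exact: integrable_fin_num.
have f4 : (\int[jn]_x (G x)%:E)%E \is a fin_num by exact: integrable_fin_num.
rewrite -(fineK f1) -(fineK f2) -(fineK f3) -(fineK f4) -!EFinD => -[h] /=.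
by lra.
Qed.

End signed_integral.

Section pushed_charge.
Context d d' {Z : measurableType d} {T : measurableType d'} {R : realType}.
Variable P : {finite_measure set Z -> \bar R}.

(** The positive and negative parts of [H] are pushed forward separately. Their images need not be
    mutually singular when [psi] is not injective, hence the recourse to an arbitrary difference of
    measures. *)
Lemma signed_integral_pushed (nu : set T -> \bar R) (H : Z -> R) (psi : Z -> T)
    (S : set T) (F G : T -> R) :
  P.-integrable setT (EFin \o H) -> measurable_fun setT psi ->
  (forall A, measurable A -> nu A = (\int[P]_(z in psi @^-1` A) (H z)%:E)%E) ->
  measurable S -> (forall z, ~ S (psi z) -> H z = 0) ->
  measurable_fun setT G -> {in S, F =1 G} ->
  P.-integrable setT (fun z => (G (psi z) * H z)%:E) ->
  signed_integral nu F = \int[P]_z (G (psi z) * H z).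
Proof.
move=> iH mpsi nuE mS HS mG FG iGH.
have mH : measurable_fun setT H by exact/measurable_EFinP/(measurable_int _ iH).
have mGpsi : measurable_fun setT (G \o psi) by exact: measurableT_comp.
have ip : P.-integrable setT (EFin \o H^\+).
  by apply: integrable_funrpos.
have in_ : P.-integrable setT (EFin \o H^\-).
  by apply: integrable_funrneg.
have [m1 [m1E _ m1I]] := pushed_density ip (fun z => funrpos_ge0 H z) mpsi.
have [m2 [m2E _ m2I]] := pushed_density in_ (fun z => funrneg_ge0 H z) mpsi.
have mpre A : measurable A -> measurable (psi @^-1` A).
  by move=> mA; rewrite -[X in measurable X]setTI; exact: mpsi.
have iGp : P.-integrable setT (fun z => (G (psi z) * H^\+ z)%:E).
  apply: le_integrable iGH => //.
    by apply/measurable_EFinP/measurable_funM => //; exact: measurable_funrpos.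
  move=> z _; rewrite /= lee_fin !normrM ler_wpM2l// /funrpos.
  by rewrite ger0_norm ?le_max ?lexx ?orbT// ge_max ler_norm normr_ge0.
have iGn : P.-integrable setT (fun z => (G (psi z) * H^\- z)%:E).
  apply: le_integrable iGH => //.
    by apply/measurable_EFinP/measurable_funM => //; exact: measurable_funrneg.
  move=> z _; rewrite /= lee_fin !normrM ler_wpM2l// /funrneg.
  by rewrite ger0_norm ?le_max ?lexx ?orbT// ge_max normr_ge0 andbT -normrN ler_norm.
have [i1 e1] := m1I _ mG iGp; have [i2 e2] := m2I _ mG iGn.
rewrite (signed_integral_diff (m1 := m1) (m2 := m2) (S := S) (G := G))//.
- rewrite e1 e2 -RintegralB//; apply: eq_Rintegral => z _.
  by rewrite -mulrBr -[in RHS](funrposBneg H).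
- move=> A mA; rewrite nuE// m1E// m2E// -integralB//; last 3 first.
  + exact: mpre.
  + by apply: integrableS ip => //; exact: mpre.
  + by apply: integrableS in_ => //; exact: mpre.
  by apply: eq_integral => z _; rewrite /= -EFinB -[in LHS](funrposBneg H).
- rewrite m1E; last exact: measurableC.
  by apply: integral0_eq => z /= /HS; rewrite /funrpos => ->; rewrite maxxx.
- rewrite m2E; last exact: measurableC.
  by apply: integral0_eq => z /= /HS; rewrite /funrneg => ->; rewrite oppr0 maxxx.
Qed.

End pushed_charge.

Section pushed_complex_measure.
Context d d' {Z : measurableType d} {T : measurableType d'} {R : realType}.
Variable P : {finite_measure set Z -> \bar R}.
Variables (H : Z -> R[i]) (psi : Z -> T).
Hypotheses (iH : cintegrable P H) (mpsi : measurable_fun setT psi).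

Let pushed (lam : set T -> R[i]) := forall A, measurable A ->
  lam A = cint P (fun z => H z * (\1_A (psi z))%:C%C).

Let mpre A : measurable A -> measurable (psi @^-1` A).
Proof. by move=> mA; rewrite -[X in measurable X]setTI; exact: mpsi. Qed.

Let Re_pushed lam A : pushed lam -> measurable A ->
  (complex.Re (lam A))%:E = (\int[P]_(z in psi @^-1` A) (complex.Re (H z))%:E)%E.
Proof.
move=> lamE mA; rewrite lamE//.
rewrite (eq_cint P (K := fun z => H z * (\1_(psi @^-1` A) z)%:C%C))//.
rewrite Re_cint_indic /Rintegral fineK//; apply: integrable_fin_num; first exact: mpre.
by apply: integrableS iH.1 => //; exact: mpre.
Qed.

Let Im_pushed lam A : pushed lam -> measurable A ->
  (complex.Im (lam A))%:E = (\int[P]_(z in psi @^-1` A) (complex.Im (H z))%:E)%E.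
Proof.
move=> lamE mA; rewrite lamE//.
rewrite (eq_cint P (K := fun z => H z * (\1_(psi @^-1` A) z)%:C%C))//.
rewrite Im_cint_indic /Rintegral fineK//; apply: integrable_fin_num; first exact: mpre.
by apply: integrableS iH.2 => //; exact: mpre.
Qed.

Lemma complex_measure_pushed (lam : set T -> R[i]) : pushed lam ->
  (forall A, ~ measurable A -> lam A = 0) -> complex_measure lam.
Proof.
move=> lamE lam0; split => // F mF tF mUF.
  rewrite Re_pushed//; under eq_fun do under eq_bigr do rewrite Re_pushed//.
  rewrite preimage_bigcup.
  have := @charge_semi_sigma_additive _ _ _ (induced_charge iH.1) (fun i => psi @^-1` F i).
  apply; [by move=> i; exact: mpre| |].
    by move=> i j _ _ [z [/= zi zj]]; apply: (tF i j) => //; exists (psi z).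
  by rewrite -preimage_bigcup; exact: mpre.
rewrite Im_pushed//; under eq_fun do under eq_bigr do rewrite Im_pushed//.
rewrite preimage_bigcup.
have := @charge_semi_sigma_additive _ _ _ (induced_charge iH.2) (fun i => psi @^-1` F i).
apply; [by move=> i; exact: mpre| |].
  by move=> i j _ _ [z [/= zi zj]]; apply: (tF i j) => //; exists (psi z).
by rewrite -preimage_bigcup; exact: mpre.
Qed.

(** The integrand [F] matters only on [S], off which the density vanishes. It will be an inner
    integral that is known only for arguments in a countable span, and [G] a measurable function
    that extends it. *)
Lemma cintegral_pushed (lam : set T -> R[i]) (S : set T) (F G : T -> R[i]) :
  pushed lam -> measurable S -> (forall z, ~ S (psi z) -> H z = 0) ->
  cmeasurable G -> {in S, F =1 G} ->
  P.-integrable setT (fun z => (cnorm1 (G (psi z)) * cnorm1 (H z))%:E) ->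
  cintegral lam F = cint P (fun z => G (psi z) * H z).
Proof.
move=> lamE mS HS [mGr mGi] FG iGH.
have [mHr mHi] := cintegrable_measurable iH.
have mcomp (g : T -> R) : measurable_fun setT g -> measurable_fun setT (g \o psi).
  by move=> mg; exact: measurableT_comp.
have bound (a b : R) (z w : R[i]) :
    `|a| <= cnorm1 z -> `|b| <= cnorm1 w -> `|a * b| <= cnorm1 z * cnorm1 w.
  by move=> *; rewrite normrM ler_pM.
have Re_le (z : R[i]) : `|complex.Re z| <= cnorm1 z by rewrite lerDl.
have Im_le (z : R[i]) : `|complex.Im z| <= cnorm1 z by rewrite lerDr.
have int_ (g : T -> R) (h : Z -> R) : measurable_fun setT g -> measurable_fun setT h ->
    (forall x, `|g x| <= cnorm1 (G x)) -> (forall z, `|h z| <= cnorm1 (H z)) ->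
    P.-integrable setT (fun z => (g (psi z) * h z)%:E).
  move=> mg mh gG hH; apply: le_integrable iGH => //.
    by apply/measurable_EFinP/measurable_funM => //; exact: mcomp.
  move=> z _; rewrite /= lee_fin (le_trans (bound _ _ _ _ (gG _) (hH z)))//.
  exact: ler_norm.
have HrS z : ~ S (psi z) -> complex.Re (H z) = 0 by move=> /HS ->.
have HiS z : ~ S (psi z) -> complex.Im (H z) = 0 by move=> /HS ->.
have FGr : {in S, (fun x => complex.Re (F x)) =1 (fun x => complex.Re (G x))}.
  by move=> x /FG ->.
have FGi : {in S, (fun x => complex.Im (F x)) =1 (fun x => complex.Im (G x))}.
  by move=> x /FG ->.
have irr := int_ _ _ mGr mHr (fun x => Re_le _) (fun x => Re_le _).
have iri := int_ _ _ mGr mHi (fun x => Re_le _) (fun x => Im_le _).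
have iir := int_ _ _ mGi mHr (fun x => Im_le _) (fun x => Re_le _).
have iii := int_ _ _ mGi mHi (fun x => Im_le _) (fun x => Im_le _).
have eR A : measurable A -> (complex.Re (lam A))%:E =
  (\int[P]_(z in psi @^-1` A) (complex.Re (H z))%:E)%E by exact: Re_pushed.
have eI A : measurable A -> (complex.Im (lam A))%:E =
  (\int[P]_(z in psi @^-1` A) (complex.Im (H z))%:E)%E by exact: Im_pushed.
rewrite /cintegral.
rewrite (signed_integral_pushed iH.1 mpsi eR mS HrS mGr FGr irr).
rewrite (signed_integral_pushed iH.2 mpsi eI mS HiS mGi FGi iii).
rewrite (signed_integral_pushed iH.1 mpsi eR mS HrS mGi FGi iir).
rewrite (signed_integral_pushed iH.2 mpsi eI mS HiS mGr FGr iri).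
apply: complex_eqP => /=.
  by rewrite -RintegralB//; apply: eq_Rintegral => z _; rewrite ReM.
by rewrite -RintegralD//; apply: eq_Rintegral => z _; rewrite ImM addrC.
Qed.

Lemma cnorm1_pushed (lam : set T -> R[i]) A : pushed lam -> measurable A ->
  cnorm1 (lam A) <= \int[P]_z cnorm1 (H z).
Proof.
move=> lamE mA; rewrite lamE//.
have i1 : cintegrable P (fun z => H z * (\1_A (psi z))%:C%C).
  apply: (cintegrable_le (g := fun z => cnorm1 (H z))).
  - apply: cmeasurableM; first exact: (cintegrable_measurable iH).
    exact: (cmeasurable_comp mpsi (cmeasurable_indic mA)).
  - exact: integrable_cnorm1.
  - move=> z; rewrite (le_trans (cnorm1M _ _))// cnorm1_real.
    by rewrite ler_piMr ?cnorm1_ge0// indicE; case: (_ \in _); rewrite ?normr1 ?normr0 ?ler01.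
apply: (le_trans (cnorm1_cint i1)); apply: le_Rintegral => //.
- exact: integrable_cnorm1.
- exact: integrable_cnorm1.
- move=> z _; rewrite (le_trans (cnorm1M _ _))// cnorm1_real.
  by rewrite ler_piMr ?cnorm1_ge0// indicE; case: (_ \in _); rewrite ?normr1 ?normr0 ?ler01.
Qed.

End pushed_complex_measure.

Section complex_density.
Context d {T : measurableType d} {R : realType}.
Implicit Types (mu nu lam : set T -> R[i]).

(** Equivalent to a bound on the total variation, up to a constant, but free of partitions and
    extended reals, and stable under setwise limits. *)
Definition measure_bound mu (M : R) :=
  forall A, measurable A -> cnorm1 (mu A) <= M.

Lemma complex_measure_ext mu nu : complex_measure mu -> complex_measure nu ->
  (forall A, measurable A -> mu A = nu A) -> mu = nu.
Proof.
move=> [mu0 _ _] [nu0 _ _] munu; apply/funext => A.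
by have [/munu//|mA] := pselect (measurable A); rewrite mu0// nu0.
Qed.

(** Along the constant sequence of empty sets the partial sums converge to [f set0]; shifting the
    index by one shows that the limit is also twice that value. *)
Lemma sigma_additive_eq0 (f : set T -> R) :
  semi_sigma_additive (fun A => (f A)%:E) -> f set0 = 0.
Proof.
move=> /(_ (fun=> set0) (fun=> measurable0) (@trivIset_set0 _ _ _)).
rewrite bigcup0// => /(_ measurable0) h.
have h' : (\sum_(0 <= i < n) (f set0)%:E + (f set0)%:E)%E @[n --> \oo] -->
    (f set0)%:E.
  by move: h; rewrite -cvg_shiftS; under eq_fun do rewrite big_nat_recr//.
have e : ((f set0 + f set0)%:E = (f set0)%:E :> \bar R)%E -> f set0 = 0.
  by move=> -[] /esym/eqP; rewrite -subr_eq subrr => /eqP.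
apply: e; rewrite EFinD.
have h2 : (\sum_(0 <= i < n) (f set0)%:E + (f set0)%:E)%E @[n --> \oo] -->
    ((f set0)%:E + (f set0)%:E)%E by apply: cvgeD => //; exact: cvg_cst.
exact: (cvg_unique (@ereal_hausdorff R) h2 h').
Qed.

Lemma real_charge (f : set T -> R) : semi_sigma_additive (fun A => (f A)%:E) ->
  exists nu : {charge set T -> \bar R}, forall A, nu A = (f A)%:E.
Proof.
move=> fs; have f0 : (f set0)%:E = 0%E by rewrite sigma_additive_eq0.
have ffin A : measurable A -> (f A)%:E \is a fin_num by [].
pose nu : {charge set T -> \bar R} := HB.pack (fun A => (f A)%:E)
  (isCharge.Build _ _ _ (fun A => (f A)%:E) f0 ffin fs).
by exists nu.
Qed.

Lemma charge_density (nu : {charge set T -> \bar R})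
    (m : {finite_measure set T -> \bar R}) : nu `<< m ->
  exists h : T -> R, m.-integrable setT (EFin \o h) /\
    forall A, measurable A -> nu A = (\int[m]_(x in A) (h x)%:E)%E.
Proof.
move=> num; exists (fine \o Radon_Nikodym nu m).
have e : EFin \o (fine \o Radon_Nikodym nu m) = Radon_Nikodym nu m.
  by apply/funext => x /=; rewrite fineK//; exact: Radon_Nikodym_fin_num.
split; first by rewrite e; exact: Radon_Nikodym_integrable.
move=> A mA; rewrite (Radon_Nikodym_integral num)//; apply: eq_integral => x _.
by rewrite -{1}e.
Qed.

Lemma Rintegral_norm_split (m : {finite_measure set T -> \bar R}) (h : T -> R) A :
  m.-integrable setT (EFin \o h) -> measurable A ->
  exists B1 B2, [/\ measurable B1, measurable B2, B1 `<=` A, B2 `<=` A &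
    \int[m]_(x in A) `|h x| = \int[m]_(x in B1) h x - \int[m]_(x in B2) h x].
Proof.
move=> ih mA; have mh : measurable_fun setT h.
  exact/measurable_EFinP/(measurable_int _ ih).
have mp : measurable [set x | 0 <= h x].
  rewrite -[X in measurable X]setTI.
  rewrite (_ : [set x | _] = h @^-1` `[0, +oo[%classic); first exact: mh.
  by apply/seteqP; split => x /=; rewrite in_itv/= andbT.
exists (A `&` [set x | 0 <= h x]), (A `\` [set x | 0 <= h x]); split => //.
- exact: measurableI.
- exact: measurableD.
have mAp : measurable (A `&` [set x | 0 <= h x]) by exact: measurableI.
have mAn : measurable (A `\` [set x | 0 <= h x]) by exact: measurableD.
rewrite -[in LHS](setUIDK A [set x | 0 <= h x]) Rintegral_setU//.
- congr (_ + _).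
    by apply: eq_Rintegral => x /set_mem[_ /= hx]; rewrite ger0_norm.
  rewrite -mulN1r -RintegralZl//; last exact: integrableS ih.
  apply: eq_Rintegral => x /set_mem[_ /= /negP]; rewrite -ltNge => hx.
  by rewrite ltr0_norm// mulN1r.
- by apply: integrableS (integrable_norm ih) => //; exact: measurableU.
- by apply/disj_setPS => x [[_ ?] [_ ?]].
Qed.

(** Cutting [A] at the signs of the real and imaginary parts of [h] expresses the integrated norm by
    four values of the measure. Bounds on the values of [lam] thereby control its density. *)
Lemma density_variation (m : {finite_measure set T -> \bar R}) (h : T -> R[i]) lam A :
  cintegrable m h ->
  (forall A, measurable A -> lam A = cint m (fun x => h x * (\1_A x)%:C%C)) ->
  measurable A -> exists B1 B2 B3 B4,
    [/\ [/\ measurable B1, measurable B2, measurable B3 & measurable B4],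
        [/\ B1 `<=` A, B2 `<=` A, B3 `<=` A & B4 `<=` A] &
    \int[m]_(x in A) cnorm1 (h x) = complex.Re (lam B1) - complex.Re (lam B2) +
      (complex.Im (lam B3) - complex.Im (lam B4))].
Proof.
move=> [ihr ihi] lamE mA.
have [B1 [B2 [m1 m2 B1A B2A e12]]] := Rintegral_norm_split ihr mA.
have [B3 [B4 [m3 m4 B3A B4A e34]]] := Rintegral_norm_split ihi mA.
exists B1, B2, B3, B4; split => //.
rewrite !lamE// !Re_cint_indic !Im_cint_indic -e12 -e34 -RintegralD//.
  by apply: integrableS (integrable_norm ihr).
by apply: integrableS (integrable_norm ihi).
Qed.

Lemma charge_dominated (nu : {charge set T -> \bar R}) (P N : set T)
    (nuPN : hahn_decomposition nu P N) (m : {finite_measure set T -> \bar R}) :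
  (forall A, (charge_variation nuPN A <= m A)%E) -> nu `<< m.
Proof.
move=> num; apply/null_content_dominatesP => A mA mA0.
apply/eqP; rewrite -abse_eq0 eq_le abse_ge0 andbT -[leRHS]mA0.
exact: le_trans (abse_charge_variation nuPN mA) (num A).
Qed.

(** All four charges are dominated by the sum of their variations. Two measures are treated at once
    so that their linear combinations have densities with respect to the same measure. *)
Lemma complex_measure_density2 mu nu : complex_measure mu -> complex_measure nu ->
  exists (m : {finite_measure set T -> \bar R}) (h k : T -> R[i]),
  [/\ cintegrable m h, cintegrable m k,
      forall A, measurable A -> mu A = cint m (fun x => h x * (\1_A x)%:C%C) &
      forall A, measurable A -> nu A = cint m (fun x => k x * (\1_A x)%:C%C)].
Proof.
move=> [_ /real_charge[n1 n1E] /real_charge[n2 n2E]].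
move=> [_ /real_charge[n3 n3E] /real_charge[n4 n4E]].
have [P1 [N1 PN1]] := Hahn_decomposition n1.
have [P2 [N2 PN2]] := Hahn_decomposition n2.
have [P3 [N3 PN3]] := Hahn_decomposition n3.
have [P4 [N4 PN4]] := Hahn_decomposition n4.
pose v1 : {measure set T -> \bar R} := charge_variation PN1.
pose v2 : {measure set T -> \bar R} := charge_variation PN2.
pose v3 : {measure set T -> \bar R} := charge_variation PN3.
pose v4 : {measure set T -> \bar R} := charge_variation PN4.
pose m0 : {measure set T -> \bar R} :=
  measure_add (measure_add v1 v2) (measure_add v3 v4).
have m0E A : m0 A = (charge_variation PN1 A + charge_variation PN2 A +
    (charge_variation PN3 A + charge_variation PN4 A))%E.
  by rewrite [LHS]measure_addE; congr (_ + _)%E; exact: measure_addE.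
have vfin (n : {charge set T -> \bar R}) P N (PN : hahn_decomposition n P N) A :
    measurable A -> charge_variation PN A \is a fin_num.
  by move=> mA; rewrite /charge_variation /= fin_numD !fin_num_measure.
have m0fin : fin_num_fun m0.
  move=> A mA; rewrite m0E fin_numD; apply/andP; split; rewrite fin_numD;
  by apply/andP; split; exact: vfin.
pose m : {finite_measure set T -> \bar R} :=
  HB.pack (Measure.sort m0) (Measure_isFinite.Build _ _ _ (m0 : set T -> \bar R) m0fin).
have v_ge0 (n : {charge set T -> \bar R}) P N (PN : hahn_decomposition n P N) A :
    (0 <= charge_variation PN A)%E by rewrite adde_ge0.
have d1 : n1 `<< m.
  apply: (charge_dominated (nuPN := PN1)) => A; rewrite [leRHS]m0E.
  by rewrite -addeA leeDl// !adde_ge0.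
have d2 : n2 `<< m.
  apply: (charge_dominated (nuPN := PN2)) => A; rewrite [leRHS]m0E.
  by rewrite -addeA addeCA leeDl// !adde_ge0.
have d3 : n3 `<< m.
  apply: (charge_dominated (nuPN := PN3)) => A; rewrite [leRHS]m0E.
  by rewrite addeCA leeDl// !adde_ge0.
have d4 : n4 `<< m.
  apply: (charge_dominated (nuPN := PN4)) => A; rewrite [leRHS]m0E.
  by rewrite addeA leeDr// !adde_ge0.
have [h1 [ih1 h1E]] := charge_density d1.
have [h2 [ih2 h2E]] := charge_density d2.
have [h3 [ih3 h3E]] := charge_density d3.
have [h4 [ih4 h4E]] := charge_density d4.
exists m, (fun x => Complex (h1 x) (h2 x)), (fun x => Complex (h3 x) (h4 x)).
split => // A mA; apply: complex_eqP;
  rewrite ?Re_cint_indic ?Im_cint_indic /Rintegral /=.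
- by rewrite -h1E// n1E.
- by rewrite -h2E// n2E.
- by rewrite -h3E// n3E.
- by rewrite -h4E// n4E.
Qed.

(** Test the supremum on the partition of [A] into [B], its complement in [A] and empty sets; the
    factor 2 is the price of [cnorm1] against the modulus. *)
Lemma cnorm1_le_total_variation mu A B :
  measurable A -> measurable B -> B `<=` A ->
  ((cnorm1 (mu B))%:E <= 2%:E * Defs.total_variation mu A)%E.
Proof.
move=> mA mB BA.
apply: (@le_trans _ _ (2 * cabs (mu B))%:E); first by rewrite lee_fin cnorm1_le_cabs.
rewrite EFinM lee_pmul2l//.
apply: le_trans (ereal_sup_ubound _); last first.
  exists (fun i => if i == 0%N then B else if i == 1%N then A `\` B else set0) => //.
  split.
  - move=> i; case: ifP => // _; case: ifP => // _; exact: measurableD.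
  - move=> [|[|i]] [|[|j]] _ _ //= [x [xB xAB]] //; first by case: xAB.
    by case: xB.
  - apply/seteqP; split => [x [[|[|i]] _ //=]|x Ax]; first exact: BA.
      by case.
    have [Bx|nBx] := pselect (B x); first by exists 0%N.
    by exists 1%N.
rewrite (nneseries_recl (P := predT))//=.
  by rewrite leeDl// nneseries_ge0// => i _ _; rewrite lee_fin /cabs normc_def /= sqrtr_ge0.
by move=> k _; rewrite lee_fin /cabs normc_def /= sqrtr_ge0.
Qed.

End complex_density.

Section total_variation_bounds.
Context d d' {Z : measurableType d} {T : measurableType d'} {R : realType}.
Variable P : {finite_measure set Z -> \bar R}.

Lemma total_variation_pushed (H : Z -> R[i]) (psi : Z -> T) (lam : set T -> R[i]) :
  cintegrable P H -> measurable_fun setT psi ->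
  (forall A, measurable A -> lam A = cint P (fun z => H z * (\1_A (psi z))%:C%C)) ->
  (Defs.total_variation lam setT <= (\int[P]_z cnorm1 (H z))%:E)%E.
Proof.
move=> iH mpsi lamE; have iN := integrable_cnorm1 iH.
have mpre A : measurable A -> measurable (psi @^-1` A).
  by move=> mA; rewrite -[X in measurable X]setTI; exact: mpsi.
apply: ge_ereal_sup => _ [F [mF tF UF] <-].
rewrite /Rintegral fineK; last exact: integrable_fin_num.
have tpF : trivIset setT (fun i => psi @^-1` F i).
  by move=> i j _ _ [z [/= zi zj]]; apply: (tF i j) => //; exists (psi z).
rewrite -[X in integral _ X _](preimage_setT psi) -UF preimage_bigcup.
rewrite ge0_integral_bigcup//; last 3 first.
- by move=> i; exact: mpre.
- by apply: measurable_funTS; exact: measurable_int iN.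
- by move=> z _; rewrite lee_fin cnorm1_ge0.
apply: lee_nneseries => [i _ _|i _].
  by rewrite lee_fin /cabs normc_def /= sqrtr_ge0.
have iNF : P.-integrable (psi @^-1` F i) (fun z => (cnorm1 (H z))%:E).
  by apply: integrableS iN => //; exact: mpre.
rewrite -[leRHS]fineK; last by apply: integrable_fin_num => //; exact: mpre.
rewrite lee_fin (le_trans (cabs_le_cnorm1 _))// lamE//.
pose K z := H z * (\1_(psi @^-1` F i) z)%:C%C.
have KN z : cnorm1 (K z) = ((fun z => cnorm1 (H z)) \_ (psi @^-1` F i)) z.
  rewrite /K patchE indicE; case: (_ \in _); last by rewrite mulr0 cnorm10.
  by rewrite mulr1.
have iK : cintegrable P K.
  apply: (cintegrable_le (g := fun z => cnorm1 (H z))) => //.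
    apply: cmeasurableM; first exact: (cintegrable_measurable iH).
    by apply: cmeasurable_indic; exact: mpre.
  by move=> z; rewrite KN patchE; case: ifP => // _; exact: cnorm1_ge0.
rewrite (le_trans (cnorm1_cint iK))// -/(Rintegral _ _ _) [leRHS]Rintegral_mkcond.
rewrite le_eqVlt; apply/orP; left; apply/eqP; apply: eq_Rintegral => z _.
exact: KN.
Qed.

End total_variation_bounds.

Section density_bounds.
Context d {T : measurableType d} {R : realType}.
Variables (m : {finite_measure set T -> \bar R}) (h : T -> R[i]) (lam : set T -> R[i]).
Hypothesis ih : cintegrable m h.
Hypothesis lamE :
  forall A, measurable A -> lam A = cint m (fun x => h x * (\1_A x)%:C%C).

Lemma cintegrable_indic (A : set T) : measurable A ->
  cintegrable m (fun x => h x * (\1_A x)%:C%C).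
Proof.
move=> mA; apply: (cintegrable_le (g := fun z => cnorm1 (h z))).
- by apply: cmeasurableM; [exact: (cintegrable_measurable ih)|exact: cmeasurable_indic].
- exact: integrable_cnorm1.
- move=> z; rewrite (le_trans (cnorm1M _ _))// cnorm1_real.
  by rewrite ler_piMr ?cnorm1_ge0// indicE; case: (_ \in _); rewrite ?normr1 ?normr0 ?ler01.
Qed.

Lemma cint_indicU (A B : set T) : measurable A -> measurable B ->
  cint m (fun x => h x * (\1_A x)%:C%C) =
  cint m (fun x => h x * (\1_(A `&` B) x)%:C%C) +
  cint m (fun x => h x * (\1_(A `\` B) x)%:C%C).
Proof.
move=> mA mB.
rewrite -cintD; [|by apply: cintegrable_indic; exact: measurableI|
  by apply: cintegrable_indic; exact: measurableD].
apply: eq_cint => x; rewrite -mulrDr -rmorphD/= !indicE in_setI in_setD.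
by case: (_ \in A); case: (_ \in B); rewrite /= ?addr0 ?add0r.
Qed.

Lemma density_bound M : measure_bound lam M -> \int[m]_x cnorm1 (h x) <= 4 * M.
Proof.
move=> lamM.
have [B1 [B2 [B3 [B4 [[m1 m2 m3 m4] _ ->]]]]] :=
  density_variation ih lamE measurableT.
have Re_le (z : R[i]) : `|complex.Re z| <= cnorm1 z by rewrite lerDl.
have Im_le (z : R[i]) : `|complex.Im z| <= cnorm1 z by rewrite lerDr.
have := le_trans (Re_le _) (lamM _ m1); have := le_trans (Re_le _) (lamM _ m2).
have := le_trans (Im_le _) (lamM _ m3); have := le_trans (Im_le _) (lamM _ m4).
rewrite !ler_norml => /andP[? ?] /andP[? ?] /andP[? ?] /andP[? ?].
lra.
Qed.

(** Each of the four sets of [density_variation] costs a factor 2, whence 8. The estimate is local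
    in [A], as needed to transfer the moment condition from the total variation to the density. *)
Lemma density_total_variation (A : set T) : measurable A ->
  ((\int[m]_(x in A) cnorm1 (h x))%:E <= 8%:E * Defs.total_variation lam A)%E.
Proof.
move=> mA; have [B1 [B2 [B3 [B4 [[m1 m2 m3 m4] [s1 s2 s3 s4] ->]]]]] :=
  density_variation ih lamE mA.
have t1 := cnorm1_le_total_variation lam mA m1 s1.
have t2 := cnorm1_le_total_variation lam mA m2 s2.
have t3 := cnorm1_le_total_variation lam mA m3 s3.
have t4 := cnorm1_le_total_variation lam mA m4 s4.
move: t1 t2 t3 t4; case: (Defs.total_variation lam A) => [t| |].
- rewrite -!EFinM !lee_fin /cnorm1 => t1 t2 t3 t4.
  have := ler_norm (complex.Re (lam B1)); have := ler_norm (- complex.Re (lam B2)).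
  have := ler_norm (complex.Im (lam B3)); have := ler_norm (- complex.Im (lam B4)).
  have := normr_ge0 (complex.Im (lam B1)); have := normr_ge0 (complex.Im (lam B2)).
  have := normr_ge0 (complex.Re (lam B3)); have := normr_ge0 (complex.Re (lam B4)).
  by rewrite !normrN; lra.
- by move=> *; rewrite mulry gtr0_sg// mul1e leey.
- by rewrite mulrNy gtr0_sg// mul1e leeNy_eq.
Qed.

End density_bounds.

(** * Measures concentrated on a countable span *)

Section concentrated.
Context {R : realType} {E : lmodType R}.
Implicit Types (mu nu lam : set (borel E) -> R[i]) (e : nat -> E).

Definition concentrated e mu := forall A : set (borel E), measurable A ->
  A `&` countable_span e = set0 -> mu A = 0.

(** Multiplying a density by the indicator of the span does not change the measure, by
    concentration; the density then vanishes at every point off the span, not merely almost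
    everywhere. *)
Lemma concentrated_density2 e mu nu :
  complex_measure mu -> concentrated e mu -> complex_measure nu -> concentrated e nu ->
  exists (m : {finite_measure set (borel E) -> \bar R}) (h k : borel E -> R[i]),
  [/\ cintegrable m h /\ cintegrable m k,
      forall x, ~ countable_span e x -> h x = 0 /\ k x = 0,
      forall A, measurable A -> mu A = cint m (fun x => h x * (\1_A x)%:C%C) &
      forall A, measurable A -> nu A = cint m (fun x => k x * (\1_A x)%:C%C)].
Proof.
move=> cmu emu cnu enu.
have [m [h [k [ih ik muE nuE]]]] := complex_measure_density2 cmu cnu.
have mS := measurable_countable_span e.
have restrict (u : borel E -> R[i]) lam : cintegrable m u -> concentrated e lam ->
    (forall A, measurable A -> lam A = cint m (fun x => u x * (\1_A x)%:C%C)) ->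
    forall A, measurable A -> lam A = cint m (fun x => u x *
      (\1_(countable_span e : set (borel E)) x)%:C%C * (\1_A x)%:C%C).
  move=> iu elam lamE A mA; rewrite lamE// (cint_indicU iu mA mS).
  have mAS : measurable (A `\` countable_span e : set (borel E)) by exact: measurableD.
  rewrite -[X in _ + X]lamE// elam// ?addr0; last first.
    by apply/seteqP; split => // x [[_]].
  apply: eq_cint => x; rewrite -mulrA -rmorphM/= !indicE in_setI andbC.
  by rewrite -natrM mulnb.
exists m, (fun x => h x * (\1_(countable_span e : set (borel E)) x)%:C%C),
  (fun x => k x * (\1_(countable_span e : set (borel E)) x)%:C%C); split.
- by split; exact: cintegrable_indic.
- by move=> x ex; rewrite indicE memNset// !mulr0.
- exact: restrict.
- exact: restrict.
Qed.

(** Approximate [mu] by a sequence of finite dimensional measures and gather their spans into one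
    countable span. A set that misses it is null for every approximant, so its [mu]-value is below
    twice every approximation error. *)
Lemma ME_concentrated mu : ME E mu -> complex_measure mu /\ exists e, concentrated e mu.
Proof.
move=> [cmu muA]; split => //.
have /choice[nu nuP] (k : nat) : exists nu, finite_dim_measure nu /\
    (Defs.total_variation (fun A => mu A - nu A)%R setT < (k.+1%:R^-1 : R)%:E)%E.
  by have [|nu nu1 nu2] := muA k.+1%:R^-1; [rewrite invr_gt0|exists nu].
have /choice[ek ekP] (k : nat) : exists e, forall A : set (borel E), measurable A ->
    A `&` countable_span e = set0 -> nu k A = 0.
  have [[_ [n [f nu0]]] _] := nuP k.
  exists (fun i => if insub i is Some j then f j else 0) => A mA Ae; apply: nu0 => //.
  rewrite -subset0 => x [Ax fx]; rewrite -[set0]Ae; split => //; exists n => //.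
  rewrite seq_span_lin_span; case: fx => a ->; exists a.
  by apply: eq_bigr => i _; rewrite valK.
have [e eP] := countable_span_bigcup ek.
exists e => A mA Ae; apply: cnorm1_eq0; apply/ler_addgt0Pl => r r0; rewrite addr0.
have [k kr] : exists k : nat, k.+1%:R^-1 < r / 2.
  have r2 : 0 < r / 2 by rewrite divr_gt0.
  by exists (Num.truncn (r / 2)^-1); rewrite invf_plt ?posrE// truncnS_gt.
have nukA : nu k A = 0.
  apply: ekP => //; rewrite -subset0 => x [Ax fx]; rewrite -[set0]Ae; split => //.
  exact: eP fx.
have [_ tv] := nuP k.
have := cnorm1_le_total_variation (fun A => mu A - nu k A) measurableT mA (@subsetT _ A).
rewrite nukA subr0 => h.
have : ((cnorm1 (mu A))%:E <= 2%:E * (r / 2)%:E)%E.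
  apply: (le_trans h); rewrite lee_pmul2l//.
  by rewrite (le_trans (ltW tv))// lee_fin ltW.
by rewrite -EFinM lee_fin mulrC divfK.
Qed.

(** Converse of [ME_concentrated]: cut the density to [seq_span e n]. The error is at most the mass
    of the density off that span, and this tends to 0 since the complements decrease to a set where
    the density vanishes. Membership in [ME] thus becomes a matter of concentration. *)
Lemma concentrated_ME e mu : complex_measure mu -> concentrated e mu -> ME E mu.
Proof.
move=> cmu emu; split => // eps eps0.
have [m [h [h2 [[ih _] h0 muE _]]]] := concentrated_density2 cmu emu cmu emu.
have mh := cintegrable_measurable ih.
have [q [qE _ _]] := pushed_density (integrable_cnorm1 ih) (fun z => cnorm1_ge0 (h z))
  (@measurable_id _ (borel E) setT).
pose C n : set (borel E) := ~` seq_span e n.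
have mC n : measurable (C n) by apply: measurableC; exact: measurable_seq_span.
have qC : q (C n) @[n --> \oo] --> 0%E.
  rewrite (_ : 0%E = q (\bigcap_n C n)).
    apply: nonincreasing_cvg_mu => //.
    - by rewrite ltey_eq fin_num_measure.
    - exact: bigcap_measurableType.
    - move=> n k nk; apply/subsetPset => x Cx xn; apply: Cx.
      exact: seq_span_le xn.
  rewrite qE; last exact: bigcap_measurableType.
  rewrite integral0_eq// => x /= xC; rewrite (h0 x _).1 ?cnorm10// => -[n _ xn].
  exact: (xC n I xn).
have [n qn] : exists n, (q (C n) < eps%:E)%E.
  move/fine_cvgP : qC => [_ /cvgrPdist_lt/(_ _ eps0)[n _ /(_ n (leqnn n))]].
  rewrite /= sub0r normrN => qn; exists n.
  by rewrite -[q (C n)]fineK ?fin_num_measure// lte_fin (le_lt_trans (ler_norm _)).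
pose hn (D : set (borel E)) x := h x * (\1_D x)%:C%C.
have ihn D : measurable D -> cintegrable m (hn D) by exact: cintegrable_indic.
have mL := measurable_seq_span e n.
pose nu := on_measurable (fun A => cint m (fun x => hn (seq_span e n) x * (\1_A x)%:C%C)).
have nuE A : measurable A ->
    nu A = cint m (fun x => hn (seq_span e n) x * (\1_A x)%:C%C).
  by move=> mA; rewrite /nu /on_measurable asboolT.
exists nu.
  split.
    apply: (complex_measure_pushed (ihn _ mL) (@measurable_id _ _ setT)) => //.
    by move=> A mA; rewrite /nu /on_measurable asboolF.
  exists n, (fun i => e i) => A mA An; rewrite nuE//.
  rewrite (eq_cint _ (K := fun=> 0)).
    by apply: complex_eqP; rewrite /= /Rintegral integral0.
  move=> x; rewrite /hn -mulrA -rmorphM/= !indicE -natrM mulnb -in_setI setIC.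
  by rewrite seq_span_lin_span An in_set0 mulr0.
apply: (@le_lt_trans _ _ (\int[m]_z cnorm1 (hn (C n) z))%:E); last first.
  rewrite /Rintegral fineK; last first.
    by apply: integrable_fin_num => //; exact: (integrable_cnorm1 (ihn _ (mC n))).
  rewrite (_ : (\int[m]_z _)%E = q (C n))// qE//= [RHS]integral_mkcond.
  apply: eq_integral => x _; rewrite /hn patchE indicE; case: (_ \in _).
    by rewrite mulr1.
  by rewrite mulr0 cnorm10.
apply: (total_variation_pushed (ihn _ (mC n)) (@measurable_id _ _ setT)) => A mA.
rewrite muE// nuE// (cint_indicU ih mA mL).
rewrite [X in _ + _ - X](eq_cint _ (K := fun x => h x * (\1_(A `&` seq_span e n) x)%:C%C)).
  rewrite addrC addKr; apply: eq_cint => x.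
  rewrite /hn -mulrA -rmorphM/= !indicE -natrM mulnb -in_setI.
  by congr (_ * ((_ \in _)%:R)%:C%C); rewrite setIC.
move=> x; rewrite /hn -mulrA -rmorphM/= !indicE -natrM mulnb -in_setI.
by congr (_ * ((_ \in _)%:R)%:C%C); rewrite setIC.
Qed.

End concentrated.

Section sections.
Context d d' {Z : measurableType d} {Z' : measurableType d'} {R : realType}.
Variable P' : {finite_measure set Z' -> \bar R}.

Lemma measurable_Rintegral_section (u : Z * Z' -> R) : measurable_fun setT u ->
  measurable_fun setT (fun x => \int[P']_y u (x, y)).
Proof.
move=> mu; have mEu : measurable_fun setT (EFin \o u) by exact/measurable_EFinP.
rewrite /Rintegral; apply: (measurableT_comp (@fine_measurable R _ measurableT)).
under eq_fun do rewrite integralE.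
apply: emeasurable_funB.
  apply: eq_measurable_fun (measurable_fun_fubini_tonelli_F (m2 := P') _
    (measurable_funepos mEu) (fun=> funepos_ge0 _ _)) => // x _.
  by apply: eq_integral => y _; rewrite !funeposE.
apply: eq_measurable_fun (measurable_fun_fubini_tonelli_F (m2 := P') _
  (measurable_funeneg mEu) (fun=> funeneg_ge0 _ _)) => // x _.
by apply: eq_integral => y _; rewrite !funenegE.
Qed.

Lemma cmeasurable_cint_section (G : Z * Z' -> R[i]) : cmeasurable G ->
  cmeasurable (fun x => cint P' (fun y => G (x, y))).
Proof.
by move=> [mr mi]; split; [exact: (measurable_Rintegral_section mr)|
  exact: (measurable_Rintegral_section mi)].
Qed.

End sections.

Section representation_by_push_forward.
Context {R : realType} {E : lmodType R}.
Implicit Types (e : nat -> E) (mu nu : set (borel E) -> R[i]).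

(* Addition on [E] need not be measurable for the product Borel structure; the
   sum of two such [psi] is, because their values stay in a countable span. *)
Definition span_represents e d (Z : measurableType d)
    (P : {finite_measure set Z -> \bar R}) (H : Z -> R[i]) (psi : Z -> borel E) mu :=
  [/\ cintegrable P H, measurable_fun setT psi,
      forall z, countable_span e (psi z) &
      forall A, measurable A -> mu A = cint P (fun z => H z * (\1_A (psi z))%:C%C)].

(** The map is [span_proj e] and not the identity, so that its values always stay in the span; where
    the two differ, the density is 0. *)
Lemma density_represents e (m : {finite_measure set (borel E) -> \bar R})
    (h : borel E -> R[i]) mu :
  cintegrable m h -> (forall x, ~ countable_span e x -> h x = 0) ->
  (forall A, measurable A -> mu A = cint m (fun x => h x * (\1_A x)%:C%C)) ->
  span_represents e m h (span_proj e) mu.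
Proof.
move=> ih h0 muE; split => //.
- exact: measurable_span_proj.
- exact: span_projP.
move=> A mA; rewrite muE//; apply: eq_cint => x.
have [ex|/h0 ->] := pselect (countable_span e x); first by rewrite span_projE.
by rewrite !mul0r.
Qed.

Lemma represents_concentrated e d (Z : measurableType d)
    (P : {finite_measure set Z -> \bar R}) (H : Z -> R[i]) (psi : Z -> borel E) mu :
  span_represents e P H psi mu -> concentrated e mu.
Proof.
move=> [iH mpsi psie muE] A mA Ae; rewrite muE// (eq_cint _ (K := fun=> 0)).
  by apply: complex_eqP; rewrite /= /Rintegral integral0.
move=> z; rewrite indicE memNset ?mulr0// => Az.
by have : set0 (psi z) by rewrite -Ae.
Qed.

Lemma represents_ME e d (Z : measurableType d)
    (P : {finite_measure set Z -> \bar R}) (H : Z -> R[i]) (psi : Z -> borel E) mu :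
  span_represents e P H psi mu -> (forall A, ~ measurable A -> mu A = 0) -> ME E mu.
Proof.
move=> rmu mu0; have [iH mpsi psie muE] := rmu.
apply: (concentrated_ME _ (represents_concentrated rmu)).
exact: (complex_measure_pushed iH mpsi muE).
Qed.

End representation_by_push_forward.

(** * Convolution with a kernel *)

Section kernel_convolution.
Context {R : realType} {E : lmodType R} (e : nat -> E).
Variables (k : E -> E -> R[i]) (a b : E -> R).
Hypothesis mk : cmeasurable (fun z : borel E * borel E =>
  k (span_proj e z.1) (span_proj e z.2)).
Hypotheses (a0 : forall x, 0 <= a x) (b0 : forall x, 0 <= b x).
Hypothesis kab : forall x y, cnorm1 (k x y) <= a x * b y.

Lemma cmeasurable_kernel d d' (Z : measurableType d) (Z' : measurableType d')
    (psi : Z -> borel E) (psi' : Z' -> borel E) :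
  measurable_fun setT psi -> measurable_fun setT psi' ->
  (forall z, countable_span e (psi z)) -> (forall z, countable_span e (psi' z)) ->
  cmeasurable (fun z : Z * Z' => k (psi z.1) (psi' z.2)).
Proof.
move=> mpsi mpsi' psie psie'.
have := cmeasurable_comp (psi := fun z : Z * Z' => (psi z.1, psi' z.2)) _ mk.
rewrite (_ : (fun z : Z * Z' => k _ _) = (fun z : Z * Z' => k (psi z.1) (psi' z.2))).
  by apply; apply: measurable_fun_pair; exact: measurableT_comp.
by apply/funext => z /=; rewrite !span_projE.
Qed.

Context d d' (Z : measurableType d) (Z' : measurableType d').
Variables (P : {finite_measure set Z -> \bar R}) (P' : {finite_measure set Z' -> \bar R}).
Variables (H : Z -> R[i]) (H' : Z' -> R[i]) (psi : Z -> borel E) (psi' : Z' -> borel E).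
Variables (mu nu : set (borel E) -> R[i]).
Hypotheses (rmu : span_represents e P H psi mu) (rnu : span_represents e P' H' psi' nu).
Hypothesis iaH : P.-integrable setT (fun z => (a (psi z) * cnorm1 (H z))%:E).
Hypothesis ibH : P'.-integrable setT (fun z => (b (psi' z) * cnorm1 (H' z))%:E).

(** The product bound [a x * b y] on the kernel covers both uses: the phase with constants 1 and 2,
    and [sigma] with [c] times the semi-norm and the semi-norm. *)
Definition kernel_density (z : Z * Z') : R[i] :=
  H z.1 * H' z.2 * k (psi z.1) (psi' z.2).

Definition sum_map (z : Z * Z') : borel E := (psi z.1 : E) + psi' z.2.

Lemma measurable_sum_map : measurable_fun setT sum_map.
Proof.
have [_ mpsi psie _] := rmu; have [_ mpsi' psie' _] := rnu.
exact: (measurable_add_span mpsi mpsi' psie psie').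
Qed.

Lemma sum_map_span z : countable_span e (sum_map z).
Proof.
have [_ _ psie _] := rmu; have [_ _ psie' _] := rnu.
by apply: is_subspaceD; first exact: countable_span_subspace.
Qed.

Lemma cnorm1_kernel_density z : cnorm1 (kernel_density z) <=
  (a (psi z.1) * cnorm1 (H z.1)) * (b (psi' z.2) * cnorm1 (H' z.2)).
Proof.
rewrite /kernel_density (le_trans (cnorm1M _ _))//.
rewrite mulrACA mulrC; apply: ler_pM => //; rewrite ?cnorm1_ge0//.
exact: cnorm1M.
Qed.

Lemma cmeasurable_kernel_density : cmeasurable kernel_density.
Proof.
have [iH mpsi psie _] := rmu; have [iH' mpsi' psie' _] := rnu.
apply: cmeasurableM; last exact: cmeasurable_kernel.
apply: cmeasurableM.
  exact: (cmeasurable_comp (psi := fst) _ (cintegrable_measurable iH)).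
exact: (cmeasurable_comp (psi := snd) _ (cintegrable_measurable iH')).
Qed.

Lemma integrable_kernel_bound : (P \x P')%E.-integrable setT (fun z =>
  ((a (psi z.1) * cnorm1 (H z.1)) * (b (psi' z.2) * cnorm1 (H' z.2)))%:E).
Proof. exact: (integrable_prod iaH ibH). Qed.

Lemma cintegrable_kernel_density : cintegrable (P \x P')%E kernel_density.
Proof.
exact: (cintegrable_le cmeasurable_kernel_density integrable_kernel_bound
  cnorm1_kernel_density).
Qed.

Lemma Rintegral_kernel_density :
  \int[(P \x P')%E]_z cnorm1 (kernel_density z) <=
  (\int[P]_z (a (psi z) * cnorm1 (H z))) * (\int[P']_z (b (psi' z) * cnorm1 (H' z))).
Proof.
rewrite -(Rintegral_prodM iaH ibH); apply: le_Rintegral => //.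
- exact: integrable_cnorm1 cintegrable_kernel_density.
- exact: integrable_kernel_bound.
- by move=> z _; exact: cnorm1_kernel_density.
Qed.

Section bounded_factor.
Variables (F : borel E -> R[i]) (B : R).
Hypotheses (mF : cmeasurable F) (FB : forall x, cnorm1 (F x) <= B).

Let G z := kernel_density z * F (sum_map z).

Let B0 : 0 <= B. Proof. exact: le_trans (cnorm1_ge0 _) (FB 0). Qed.

Let mG : cmeasurable G.
Proof.
apply: cmeasurableM; first exact: cmeasurable_kernel_density.
by apply: cmeasurable_comp mF; exact: measurable_sum_map.
Qed.

Let GB z : cnorm1 (G z) <=
  (a (psi z.1) * cnorm1 (H z.1)) * (b (psi' z.2) * cnorm1 (H' z.2)) * B.
Proof.
rewrite (le_trans (cnorm1M _ _))//; apply: ler_pM; rewrite ?cnorm1_ge0//.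
exact: cnorm1_kernel_density.
Qed.

Lemma cintegrable_kernel : cintegrable (P \x P')%E G.
Proof.
apply: (cintegrable_le mG _ GB).
by have := integrableZr measurableT B integrable_kernel_bound; apply: eq_integrable.
Qed.

Let cmeasurable_pair1 (z : Z) : cmeasurable (fun z' => G (z, z')).
Proof. by have [mr mi] := mG; split;
  [exact: (measurable_fun_pair2 z mr)|exact: (measurable_fun_pair2 z mi)]. Qed.

Let cmeasurable_pair2 (z' : Z') : cmeasurable (fun z => G (z, z')).
Proof. by have [mr mi] := mG; split;
  [exact: (measurable_fun_pair1 z' mr)|exact: (measurable_fun_pair1 z' mi)]. Qed.

(** The bound is a product, so fixing one variable leaves an integrable function of the other at
    every point; the Fubini lemmas demand exactly this. *)
Lemma cintegrable_kernel1 z : cintegrable P' (fun z' => G (z, z')).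
Proof.
apply: (cintegrable_le (cmeasurable_pair1 z) _ (fun z' => GB (z, z'))).
have := integrableZr measurableT B (integrableZl measurableT (a (psi z) * cnorm1 (H z)) ibH).
by apply: eq_integrable.
Qed.

Lemma cintegrable_kernel2 z' : cintegrable P (fun z => G (z, z')).
Proof.
apply: (cintegrable_le (cmeasurable_pair2 z') _ (fun z => GB (z, z'))).
have := integrableZr measurableT B
  (integrableZr measurableT (b (psi' z') * cnorm1 (H' z')) iaH).
by apply: eq_integrable.
Qed.

(** The iterated integral of the definition is moved twice, first in [nu] for [f] in the span, then
    in [mu], onto the spaces carrying the densities, where Fubini applies. The test function [F]
    will be an indicator. *)
Lemma cintegral_kernel :
  cintegral mu (fun f => cintegral nu (fun g => k f g * F ((f : E) + g))) =
  cint (P \x P')%E G.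
Proof.
have [iH mpsi psie muE] := rmu; have [iH' mpsi' psie' nuE] := rnu.
have mS := measurable_countable_span e.
have mpi := @measurable_span_proj R E e; have pie := @span_projP R E e.
pose K (x : borel E) (y : borel E) := k x y * F ((x : E) + y).
have mK d1 d2 (X : measurableType d1) (Y : measurableType d2)
    (phi : X -> borel E) (phi' : Y -> borel E) :
    measurable_fun setT phi -> measurable_fun setT phi' ->
    (forall z, countable_span e (phi z)) -> (forall z, countable_span e (phi' z)) ->
    cmeasurable (fun z : X * Y => K (phi z.1) (phi' z.2)).
  move=> m1 m2 e1 e2; apply: cmeasurableM; first exact: cmeasurable_kernel.
  by apply: cmeasurable_comp mF; exact: measurable_add_span.
have KB x y : cnorm1 (K x y) <= a x * b y * B.
  by rewrite (le_trans (cnorm1M _ _))//; apply: ler_pM; rewrite ?cnorm1_ge0.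
have KHB (f : borel E) z' : cnorm1 (K (span_proj e f) (psi' z') * H' z') <=
    a (span_proj e f) * B * (b (psi' z') * cnorm1 (H' z')).
  rewrite (le_trans (cnorm1M _ _))// mulrA ler_wpM2r ?cnorm1_ge0//.
  by rewrite (le_trans (KB _ _))// mulrAC.
have iaB (f : borel E) := integrableZl measurableT (a (span_proj e f) * B) ibH.
have iKH (f : borel E) : cintegrable P' (fun z' => K (span_proj e f) (psi' z') * H' z').
  apply: (cintegrable_le _ (iaB f) (KHB f)); apply: cmeasurableM.
    have [mr mi] := mK _ _ _ _ _ _ mpi mpsi' pie psie'.
    by split; [exact: (measurable_fun_pair2 f mr)|exact: (measurable_fun_pair2 f mi)].
  exact: cintegrable_measurable iH'.
have inner (f : borel E) : countable_span e f ->
    cintegral nu (K f) = cint P' (fun z' => K (span_proj e f) (psi' z') * H' z').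
  move=> ef; rewrite (cintegral_pushed (G := fun g => K (span_proj e f) (span_proj e g))
    iH' mpsi' nuE mS)//.
  - by apply: eq_cint => z'; rewrite (span_projE (psie' z')).
  - have [mr mi] := mK _ _ _ _ _ _ mpi mpi pie pie.
    by split; [exact: (measurable_fun_pair2 f mr)|exact: (measurable_fun_pair2 f mi)].
  - by move=> g /set_mem eg; rewrite !span_projE.
  - apply: le_integrable (iaB f) => //.
      apply/measurable_EFinP; apply: measurable_funM; apply: measurable_cnorm1.
        have [mr mi] := mK _ _ _ _ _ _ mpi mpsi' pie psie'.
        under eq_fun do rewrite (span_projE (psie' _)).
        by split; [exact: (measurable_fun_pair2 f mr)|exact: (measurable_fun_pair2 f mi)].
      exact: cintegrable_measurable iH'.
    move=> z' _; rewrite /= lee_fin !ger0_norm ?mulr_ge0 ?cnorm1_ge0//.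
    rewrite (span_projE (psie' z')) mulrA ler_wpM2r ?cnorm1_ge0// (le_trans (KB _ _))//.
    by rewrite mulrAC.
(* The inner integral is identified only for [f] in the span. Composing with [span_proj] gives a
   function that is measurable on all of [E] and agrees with it there. *)
pose Go (f : borel E) := cint P' (fun z' => K (span_proj e f) (psi' z') * H' z').
have GoE z : Go (psi z) * H z = cint P' (fun z' => G (z, z')).
  rewrite /Go mulrC -cintZ.
    apply: eq_cint => z'; rewrite /G /kernel_density /sum_map /K span_projE//=.
    by ring.
  exact: iKH.
have mGo : cmeasurable Go.
  apply: (cmeasurable_cint_section P'
    (G := fun z : borel E * Z' => K (span_proj e z.1) (psi' z.2) * H' z.2)).
  apply: cmeasurableM; first exact: mK.
  exact: (cmeasurable_comp (psi := snd) _ (cintegrable_measurable iH')).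
rewrite (cintegral_pushed (G := Go) iH mpsi muE mS)//.
- rewrite cint_prod1; [|exact: cintegrable_kernel|exact: cintegrable_kernel1].
  by apply: eq_cint => z; rewrite GoE.
- by move=> f /set_mem ef; exact: inner.
- pose I' := \int[P']_z (b (psi' z) * cnorm1 (H' z)).
  have I'0 : 0 <= I' by apply: Rintegral_ge0 => z _; rewrite mulr_ge0 ?cnorm1_ge0.
  have GoB f : cnorm1 (Go f) <= a (span_proj e f) * B * I'.
    rewrite (le_trans (cnorm1_cint (iKH f)))// -RintegralZl//.
    apply: le_Rintegral => //; first exact: integrable_cnorm1 (iKH f).
    exact: iaB.
  have := integrableZl measurableT (B * I') iaH.
  apply: le_integrable => //.
    apply/measurable_EFinP; apply: measurable_funM; apply: measurable_cnorm1.
      apply: (cmeasurable_comp mpsi); exact: mGo.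
    exact: cintegrable_measurable iH.
  move=> z _; rewrite /= lee_fin !ger0_norm ?mulr_ge0 ?cnorm1_ge0//.
  rewrite mulrA ler_wpM2r ?cnorm1_ge0// (le_trans (GoB _))// span_projE//.
  by rewrite -mulrA mulrC.
Qed.

End bounded_factor.

End kernel_convolution.

Section product_finite_measure.
Context d d' {Z : measurableType d} {Z' : measurableType d'} {R : realType}.
Variables (P : {finite_measure set Z -> \bar R}) (P' : {finite_measure set Z' -> \bar R}).

Let fin_num_product : fin_num_fun (P \x P')%E.
Proof.
move=> A mA; rewrite ge0_fin_numE//.
apply: (@le_lt_trans _ _ ((P \x P')%E setT)).
  by apply: le_measure => //; rewrite inE.
rewrite -setXTT product_measure1E// lte_mul_pinfty//.
  by rewrite fin_num_measure.
by rewrite ltey_eq fin_num_measure.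
Qed.

Definition finite_prod : {finite_measure set (Z * Z')%type -> \bar R} :=
  HB.pack (Measure.sort ((P \x P')%E : {measure set (Z * Z')%type -> \bar R}))
    (Measure_isFinite.Build _ _ _ (P \x P')%E fin_num_product).

End product_finite_measure.

Section convolution_represented.
Context {R : realType} {E : lmodType R} (e : nat -> E).
Variables (k : E -> E -> R[i]) (a b : E -> R).
Hypothesis mk : cmeasurable (fun z : borel E * borel E =>
  k (span_proj e z.1) (span_proj e z.2)).
Hypotheses (a0 : forall x, 0 <= a x) (b0 : forall x, 0 <= b x).
Hypothesis kab : forall x y, cnorm1 (k x y) <= a x * b y.
Context d d' (Z : measurableType d) (Z' : measurableType d').
Variables (P : {finite_measure set Z -> \bar R}) (P' : {finite_measure set Z' -> \bar R}).
Variables (H : Z -> R[i]) (H' : Z' -> R[i]) (psi : Z -> borel E) (psi' : Z' -> borel E).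
Variables (mu nu : set (borel E) -> R[i]).
Hypotheses (rmu : span_represents e P H psi mu) (rnu : span_represents e P' H' psi' nu).
Hypothesis iaH : P.-integrable setT (fun z => (a (psi z) * cnorm1 (H z))%:E).
Hypothesis ibH : P'.-integrable setT (fun z => (b (psi' z) * cnorm1 (H' z))%:E).

Definition kernel_conv : set (borel E) -> R[i] :=
  on_measurable (fun A : set (borel E) => cintegral mu (fun f => cintegral nu (fun g =>
    k f g * (\1_(A : set E) ((f : E) + g))%:C%C))).

Lemma kernel_conv_represents : span_represents e (finite_prod P P')
  (kernel_density k H H' psi psi') (sum_map psi psi') kernel_conv.
Proof.
split.
- exact: (cintegrable_kernel_density mk kab rmu rnu iaH ibH).
- exact: (measurable_sum_map rmu rnu).
- exact: (sum_map_span rmu rnu).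
- move=> A mA; rewrite /kernel_conv /on_measurable asboolT//.
  apply: (cintegral_kernel mk a0 b0 kab rmu rnu iaH ibH
    (F := fun x : borel E => (\1_A x)%:C%C) (B := 1)).
    exact: cmeasurable_indic.
  by move=> x; rewrite cnorm1_real indicE; case: (_ \in _); rewrite ?normr1 ?normr0 ?ler01.
Qed.

Lemma kernel_conv_bound : measure_bound kernel_conv
  ((\int[P]_z (a (psi z) * cnorm1 (H z))) * (\int[P']_z (b (psi' z) * cnorm1 (H' z)))).
Proof.
move=> A mA; have [i1 m1 _ eA] := kernel_conv_represents.
apply: (le_trans (cnorm1_pushed i1 m1 eA mA)).
exact: (Rintegral_kernel_density mk kab rmu rnu iaH ibH).
Qed.

End convolution_represented.

Section kernel_swap.
Context {R : realType} {E : lmodType R} (e : nat -> E).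
Variables (k : E -> E -> R[i]) (a b : E -> R).
Hypothesis mk : cmeasurable (fun z : borel E * borel E =>
  k (span_proj e z.1) (span_proj e z.2)).
Hypothesis kab : forall x y, cnorm1 (k x y) <= a x * b y.
Context d d' (Z : measurableType d) (Z' : measurableType d').
Variables (P : {finite_measure set Z -> \bar R}) (P' : {finite_measure set Z' -> \bar R}).
Variables (H : Z -> R[i]) (H' : Z' -> R[i]) (psi : Z -> borel E) (psi' : Z' -> borel E).
Variables (mu nu : set (borel E) -> R[i]).
Hypotheses (rmu : span_represents e P H psi mu) (rnu : span_represents e P' H' psi' nu).
Hypothesis iaH : P.-integrable setT (fun z => (a (psi z) * cnorm1 (H z))%:E).
Hypothesis ibH : P'.-integrable setT (fun z => (b (psi' z) * cnorm1 (H' z))%:E).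

(** Fubini in opposite orders turns both sides into the same iterated integral. This brings products
    taken in opposite orders to one and the same product space, for the involution and for the
    commutator. *)
Lemma cint_kernel_swap (F : borel E -> R[i]) (B : R) :
  cmeasurable F -> (forall x, cnorm1 (F x) <= B) ->
  cint (P \x P')%E
    (fun z => kernel_density k H H' psi psi' z * F (sum_map psi psi' z)) =
  cint (P' \x P)%E (fun z => kernel_density (fun x y => k y x) H' H psi' psi z *
    F (sum_map psi' psi z)).
Proof.
move=> mF FB.
have mk' : cmeasurable (fun z : borel E * borel E =>
    k (span_proj e z.2) (span_proj e z.1)).
  have := cmeasurable_comp (psi := fun z : borel E * borel E => (z.2, z.1)) _ mk.
  by apply; apply: measurable_fun_pair.
have kba x y : cnorm1 (k y x) <= b x * a y by rewrite mulrC.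
have E1 z z' : kernel_density (fun x y => k y x) H' H psi' psi (z', z) *
    F (sum_map psi' psi (z', z)) =
    kernel_density k H H' psi psi' (z, z') * F (sum_map psi psi' (z, z')).
  by rewrite /kernel_density /sum_map /= [in LHS]addrC (mulrC (H' _)).
rewrite (cint_prod1 (cintegrable_kernel mk kab rmu rnu iaH ibH mF FB)); last first.
  exact: (cintegrable_kernel1 mk kab rmu rnu ibH mF FB).
rewrite (cint_prod2 (cintegrable_kernel
  (mk' : cmeasurable (fun z : borel E * borel E =>
    (fun x y => k y x) (span_proj e z.1) (span_proj e z.2)))
  kba rnu rmu ibH iaH mF FB)); last first.
  exact: (cintegrable_kernel2 (mk' : cmeasurable (fun z : borel E * borel E =>
    (fun x y => k y x) (span_proj e z.1) (span_proj e z.2))) kba rnu rmu ibH mF FB).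
by apply: eq_cint => z; apply: eq_cint => z'; rewrite E1.
Qed.

End kernel_swap.

(** * Common representations, linear combinations and the involution *)

Section spans_of_measures.
Context {R : realType} {E : lmodType R}.
Implicit Types (mu nu : set (borel E) -> R[i]) (e : nat -> E).

Lemma concentratedS e e' mu : countable_span e `<=` countable_span e' ->
  concentrated e mu -> concentrated e' mu.
Proof.
move=> ee' emu A mA Ae'; apply: emu => //; rewrite -subset0 -Ae' => x [Ax ex].
by split => //; exact: ee'.
Qed.

Lemma ME_seq_concentrated (mu_ : nat -> set (borel E) -> R[i]) :
  (forall n, ME E (mu_ n)) -> exists e, forall n, concentrated e (mu_ n).
Proof.
move=> muM; have /choice[ek ekP] n := (ME_concentrated (muM n)).2.
have [e eP] := countable_span_bigcup ek.
by exists e => n; exact: concentratedS (eP n) (ekP n).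
Qed.

(** The first two measures share a base measure, so that they can be combined linearly; the third
    has its own and serves as the other factor of a product. All three share the countable span. *)
Lemma ME_represented3 mu1 mu2 nu : ME E mu1 -> ME E mu2 -> ME E nu ->
  exists e (m m' : {finite_measure set (borel E) -> \bar R}) (h1 h2 h' : borel E -> R[i]),
  [/\ span_represents e m h1 (span_proj e) mu1,
      span_represents e m h2 (span_proj e) mu2,
      span_represents e m' h' (span_proj e) nu &
      [/\ forall M, measure_bound mu1 M -> \int[m]_x cnorm1 (h1 x) <= 4 * M,
          forall A, measurable A ->
            ((\int[m]_(x in A) cnorm1 (h1 x))%:E <= 8%:E * Defs.total_variation mu1 A)%E,
          forall M, measure_bound nu M -> \int[m']_x cnorm1 (h' x) <= 4 * M &
          forall A, measurable A ->
            ((\int[m']_(x in A) cnorm1 (h' x))%:E <= 8%:E * Defs.total_variation nu A)%E]].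
Proof.
move=> M1 M2 M3.
(* The default value of [nth] is [nu], which therefore sits at index 2 and at all later ones. *)
have M_ n : ME E (nth nu [:: mu1; mu2] n) by case: n => [|[|n]]//=; rewrite nth_nil.
have [e eP] := ME_seq_concentrated M_.
have [c1 c2 c3] := And3 (ME_concentrated M1).1 (ME_concentrated M2).1 (ME_concentrated M3).1.
have [m [h1 [h2 [[i1 i2] h0 e1 e2]]]] :=
  concentrated_density2 c1 (eP 0%N) c2 (eP 1%N).
have [m' [h' [h'' [[i' i''] h0' e' e'']]]] :=
  concentrated_density2 c3 (eP 2%N) c3 (eP 2%N).
exists e, m, m', h1, h2, h'; split.
- by apply: density_represents => // x /h0[].
- by apply: density_represents => // x /h0[].
- by apply: density_represents => // x /h0'[].
- split.
  + by move=> M; exact: density_bound.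
  + by move=> A; exact: density_total_variation.
  + by move=> M; exact: density_bound.
  + by move=> A; exact: density_total_variation.
Qed.

Lemma represents_linear e d (Z : measurableType d) (P : {finite_measure set Z -> \bar R})
    (H1 H2 : Z -> R[i]) psi (a : R[i]) mu1 mu2 :
  span_represents e P H1 psi mu1 -> span_represents e P H2 psi mu2 ->
  span_represents e P (fun z => a * H1 z + H2 z) psi (fun A => a * mu1 A + mu2 A).
Proof.
move=> [i1 mpsi psie e1] [i2 _ _ e2]; split => //.
  by apply: cintegrableD => //; exact: cintegrableZ.
move=> A mA; rewrite e1// e2//.
have iI (H : Z -> R[i]) : cintegrable P H ->
    cintegrable P (fun z => H z * (\1_A (psi z))%:C%C).
  move=> iH.
  have mpre : measurable (psi @^-1` A).
    by rewrite -[X in measurable X]setTI; exact: (mpsi measurableT _ mA).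
  exact: (cintegrable_indic iH mpre).
rewrite -cintZ; last exact: iI.
rewrite -cintD; [|by apply: cintegrableZ; exact: iI|exact: iI].
by apply: eq_cint => z; rewrite mulrDl mulrA.
Qed.

Lemma ME_linear (a : R[i]) mu1 mu2 : ME E mu1 -> ME E mu2 ->
  ME E (fun A => a * mu1 A + mu2 A).
Proof.
move=> M1 M2; have [e [m [m' [h1 [h2 [h' [r1 r2 _ _]]]]]]] := ME_represented3 M1 M2 M2.
apply: (represents_ME (represents_linear a r1 r2)) => A mA.
have [[[z1 _ _] _] [[z2 _ _] _]] := (M1, M2).
by rewrite z1// z2// mulr0 addr0.
Qed.

Lemma measurable_opp_preimage (A : set (borel E)) : measurable A ->
  measurable ([set x | A (- (x : E))] : set (borel E)).
Proof.
move=> mA; rewrite -[X in measurable X]setTI.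
exact: (@measurable_oppE R E measurableT _ mA).
Qed.

Lemma represents_star e d (Z : measurableType d) (P : {finite_measure set Z -> \bar R})
    (H : Z -> R[i]) psi mu : span_represents e P H psi mu ->
  span_represents e P (fun z => Num.conj (H z)) (fun z => - (psi z : E) : borel E) (star mu).
Proof.
move=> [iH mpsi psie muE]; split.
- exact: cintegrable_conj.
- exact: (measurableT_comp (@measurable_oppE R E) mpsi).
- move=> z; rewrite -scaleN1r; apply: is_subspaceZ => //.
  exact: countable_span_subspace.
- move=> A mA; rewrite /star muE; last exact: measurable_opp_preimage.
  rewrite -cint_conj.
    apply: eq_cint => z; rewrite rmorphM/=; congr (_ * _).
    by apply: complex_eqP; rewrite ?Re_conj ?Im_conj /= ?oppr0// !indicE.
  have mpre : measurable (psi @^-1` [set x | A (- (x : E))]).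
    rewrite -[X in measurable X]setTI.
    by apply: (mpsi measurableT); exact: measurable_opp_preimage.
  exact: (cintegrable_indic iH mpre).
Qed.

Lemma star_star mu : star (star mu) = mu.
Proof.
apply/funext => A; rewrite /star /=.
rewrite (_ : [set x | [set x0 | A (- x0)] (- x)] = A).
  by apply: complex_eqP; rewrite !(Re_conj, Im_conj) ?opprK.
by apply/seteqP; split => x /=; rewrite opprK.
Qed.

Lemma star_ME mu : ME E mu -> ME E (star mu).
Proof.
move=> M; have [e [m [m' [h1 [h2 [h' [r1 _ _ _]]]]]]] := ME_represented3 M M M.
apply: (represents_ME (represents_star r1)) => A mA.
have [[z _ _] _] := M; rewrite /star z ?conjC0//.
move=> mA'; apply: mA.
have e0 : [set x : borel E | [set y : borel E | A (- (y : E))] (- (x : E))] = A.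
  by apply/seteqP; split => x /=; rewrite opprK.
by move: (measurable_opp_preimage mA'); rewrite e0.
Qed.

Lemma star_bound mu M : measure_bound mu M -> measure_bound (star mu) M.
Proof.
by move=> muM A mA; rewrite /star cnorm1_conj muM//; exact: measurable_opp_preimage.
Qed.

End spans_of_measures.

(** * The twisted product: bounds, bilinearity and involution *)

Section twisted_convolution.
Context {R : realType} {E : lmodType R} (sigma : E -> E -> R).
Hypotheses (sl : forall y, scalar (sigma^~ y)) (sr : forall x, scalar (sigma x)).
Hypothesis sigma_antisym : forall f g, sigma f g = - sigma g f.
Implicit Types (mu nu : set (borel E) -> R[i]) (hbar : R) (e : nat -> E).

Definition phase hbar (f g : E) : R[i] := expi (- (hbar * sigma f g / 2)).

Lemma measurable_sigma_span e : measurable_fun setT (fun z : borel E * borel E =>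
  sigma (span_proj e z.1) (span_proj e z.2)).
Proof.
by apply: (measurable_bilinear_span _ _ (@span_projP R E e) (@span_projP R E e) sl sr);
  exact: measurable_span_proj.
Qed.

Lemma cmeasurable_phase hbar e : cmeasurable (fun z : borel E * borel E =>
  phase hbar (span_proj e z.1) (span_proj e z.2)).
Proof.
apply: cmeasurable_expi; apply: measurableT_comp => //; apply: measurable_funM => //.
by apply: measurable_funM => //; exact: measurable_sigma_span.
Qed.

Lemma cnorm1_expi (t : R) : cnorm1 (expi t) <= 2.
Proof.
rewrite /cnorm1 /= (natrD R 1 1) lerD// ler_norml.
  by rewrite cos_geN1 cos_le1.
by rewrite sin_geN1 sin_le1.
Qed.

Lemma phase_le hbar (f g : E) : cnorm1 (phase hbar f g) <= 1 * 2.
Proof. by rewrite mul1r; exact: cnorm1_expi. Qed.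

Lemma integrable_scale d (Z : measurableType d) (P : {finite_measure set Z -> \bar R})
    (H : Z -> R[i]) (a : R) : cintegrable P H ->
  P.-integrable setT (fun z => (a * cnorm1 (H z))%:E).
Proof.
by move=> iH; have := integrableZl measurableT a (integrable_cnorm1 iH); apply: eq_integrable.
Qed.

Section represented.
Variables (hbar : R) (e : nat -> E).
Context d d' (Z : measurableType d) (Z' : measurableType d').
Variables (P : {finite_measure set Z -> \bar R}) (P' : {finite_measure set Z' -> \bar R}).
Variables (H : Z -> R[i]) (H' : Z' -> R[i]) (psi : Z -> borel E) (psi' : Z' -> borel E).
Variables (mu nu : set (borel E) -> R[i]).
Hypotheses (rmu : span_represents e P H psi mu) (rnu : span_represents e P' H' psi' nu).

Let iH : P.-integrable setT (fun z => (1 * cnorm1 (H z))%:E).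
Proof. by apply: integrable_scale; case: rmu. Qed.

Let iH' : P'.-integrable setT (fun z => (2 * cnorm1 (H' z))%:E).
Proof. by apply: integrable_scale; case: rnu. Qed.

Lemma twisted_conv_represents : span_represents e (finite_prod P P')
  (kernel_density (phase hbar) H H' psi psi') (sum_map psi psi')
  (twisted_conv sigma hbar mu nu).
Proof.
exact: (kernel_conv_represents (a := fun=> 1) (b := fun=> 2) (cmeasurable_phase hbar e)
  (fun=> ler01) (fun=> ler0n _ 2) (phase_le hbar) rmu rnu iH iH').
Qed.

Lemma twisted_conv_bound_density : measure_bound (twisted_conv sigma hbar mu nu)
  ((\int[P]_z cnorm1 (H z)) * (2 * \int[P']_z cnorm1 (H' z))).
Proof.
have := kernel_conv_bound (a := fun=> 1) (b := fun=> 2) (cmeasurable_phase hbar e)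
  (fun=> ler01) (fun=> ler0n _ 2) (phase_le hbar) rmu rnu iH iH'.
have [i1 _ _ _] := rmu; have [i2 _ _ _] := rnu.
rewrite RintegralZl//; last exact: integrable_cnorm1.
by rewrite RintegralZl ?mul1r//; exact: integrable_cnorm1.
Qed.

Lemma cint_phase_swap (F : borel E -> R[i]) (B : R) :
  cmeasurable F -> (forall x, cnorm1 (F x) <= B) ->
  cint (P \x P')%E
    (fun z => kernel_density (phase hbar) H H' psi psi' z * F (sum_map psi psi' z)) =
  cint (P' \x P)%E (fun z => kernel_density (fun x y => phase hbar y x) H' H psi' psi z *
    F (sum_map psi' psi z)).
Proof.
exact: (cint_kernel_swap (a := fun=> 1) (b := fun=> 2) (cmeasurable_phase hbar e)
  (phase_le hbar) rmu rnu iH iH').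
Qed.

End represented.

Lemma cnorm1_indic (A : set (borel E)) x : cnorm1 (\1_A x)%:C%C <= 1 :> R.
Proof. by rewrite cnorm1_real indicE; case: (_ \in _); rewrite ?normr1 ?normr0 ?ler01. Qed.

Lemma twisted_conv_nonmeasurable hbar mu nu A : ~ measurable A ->
  twisted_conv sigma hbar mu nu A = 0.
Proof. by move=> mA; rewrite /twisted_conv /on_measurable asboolF. Qed.

Lemma twisted_conv_ME hbar mu nu : ME E mu -> ME E nu ->
  ME E (twisted_conv sigma hbar mu nu).
Proof.
move=> M N; have [e [m [m' [h1 [h2 [h' [r1 _ r' _]]]]]]] := ME_represented3 M M N.
apply: (represents_ME (twisted_conv_represents hbar r1 r')).
exact: twisted_conv_nonmeasurable.
Qed.

(** The constant is 4 for each density, by [density_bound], times 2 for the phase. It does not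
    involve [hbar], and the uniformity of all operator bounds rests on that. *)
Lemma twisted_conv_bound hbar mu nu M M' : ME E mu -> ME E nu ->
  measure_bound mu M -> measure_bound nu M' ->
  measure_bound (twisted_conv sigma hbar mu nu) (32 * M * M').
Proof.
move=> ME1 ME2 muM nuM A mA.
have [e [m [m' [h1 [h2 [h' [r1 _ r' [b1 _ b' _]]]]]]]] := ME_represented3 ME1 ME1 ME2.
apply: (le_trans (twisted_conv_bound_density hbar r1 r' mA)).
have := b1 _ muM; have := b' _ nuM.
have i1 : 0 <= \int[m]_x cnorm1 (h1 x).
  by apply: Rintegral_ge0 => x _; exact: cnorm1_ge0.
have i' : 0 <= \int[m']_x cnorm1 (h' x).
  by apply: Rintegral_ge0 => x _; exact: cnorm1_ge0.
move=> l' l1; rewrite (_ : 32 * M * M' = (4 * M) * (2 * (4 * M'))); last by ring.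
by apply: ler_pM => //; [rewrite mulr_ge0|rewrite ler_pM2l].
Qed.

Lemma twisted_conv_linear_l hbar (a : R[i]) mu1 mu2 nu : ME E mu1 -> ME E mu2 -> ME E nu ->
  twisted_conv sigma hbar (fun A => a * mu1 A + mu2 A) nu =
  (fun A => a * twisted_conv sigma hbar mu1 nu A + twisted_conv sigma hbar mu2 nu A).
Proof.
move=> M1 M2 N; apply/funext => A.
have [mA|mA] := pselect (measurable A); last first.
  by rewrite !twisted_conv_nonmeasurable// mulr0 addr0.
have [e [m [m' [h1 [h2 [h' [r1 r2 r' _]]]]]]] := ME_represented3 M1 M2 N.
have [i1 mp _ e1] := twisted_conv_represents hbar r1 r'.
have [i2 _ _ e2] := twisted_conv_represents hbar r2 r'.
have [i3 _ _ e3] := twisted_conv_represents hbar (represents_linear a r1 r2) r'.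
rewrite e1// e2// e3//.
have mpre : measurable (sum_map (span_proj e) (span_proj e) @^-1` A).
  by rewrite -[X in measurable X]setTI; exact: (mp measurableT _ mA).
rewrite -cintZ; last exact: (cintegrable_indic i1 mpre).
rewrite -cintD; [|by apply: cintegrableZ; exact: (cintegrable_indic i1 mpre)|
  exact: (cintegrable_indic i2 mpre)].
by apply: eq_cint => z; rewrite /kernel_density; ring.
Qed.

Lemma twisted_conv_linear_r hbar (a : R[i]) mu nu1 nu2 : ME E mu -> ME E nu1 -> ME E nu2 ->
  twisted_conv sigma hbar mu (fun A => a * nu1 A + nu2 A) =
  (fun A => a * twisted_conv sigma hbar mu nu1 A + twisted_conv sigma hbar mu nu2 A).
Proof.
move=> M N1 N2; apply/funext => A.
have [mA|mA] := pselect (measurable A); last first.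
  by rewrite !twisted_conv_nonmeasurable// mulr0 addr0.
have [e [m [m' [h1 [h2 [h' [r1 r2 r' _]]]]]]] := ME_represented3 N1 N2 M.
have [i1 mp _ e1] := twisted_conv_represents hbar r' r1.
have [i2 _ _ e2] := twisted_conv_represents hbar r' r2.
have [i3 _ _ e3] := twisted_conv_represents hbar r' (represents_linear a r1 r2).
rewrite e1// e2// e3//.
have mpre : measurable (sum_map (span_proj e) (span_proj e) @^-1` A).
  by rewrite -[X in measurable X]setTI; exact: (mp measurableT _ mA).
rewrite -cintZ; last exact: (cintegrable_indic i1 mpre).
rewrite -cintD; [|by apply: cintegrableZ; exact: (cintegrable_indic i1 mpre)|
  exact: (cintegrable_indic i2 mpre)].
by apply: eq_cint => z; rewrite /kernel_density; ring.
Qed.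

Lemma phase_conj hbar (x y : E) : Num.conj (phase hbar x y) = phase hbar y x.
Proof.
apply: complex_eqP; rewrite ?Re_conj ?Im_conj /phase /=.
  by rewrite sigma_antisym mulrN mulNr opprK cosN.
by rewrite sigma_antisym mulrN mulNr opprK sinN.
Qed.

Lemma phaseNN hbar (x y : E) : phase hbar (- x) (- y) = phase hbar x y.
Proof.
have lN z : sigma (- x) z = - sigma x z.
  by have := sl z (-1) x 0; rewrite (scalar_eq0 (sl z)) !addr0 scaleN1r mulN1r.
have rN z : sigma z (- y) = - sigma z y.
  by have := sr z (-1) y 0; rewrite (scalar_eq0 (sr z)) !addr0 scaleN1r mulN1r.
by rewrite /phase lN rN opprK.
Qed.

(** Conjugating the phase exchanges its arguments, by antisymmetry of [sigma], and changing both
    signs leaves it invariant, by bilinearity. What remains is an exchange of the order of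
    integration. *)
Lemma star_twisted_conv hbar mu nu : ME E mu -> ME E nu ->
  star (twisted_conv sigma hbar mu nu) = twisted_conv sigma hbar (star nu) (star mu).
Proof.
move=> M N.
have [c1 _] := ME_concentrated (star_ME (twisted_conv_ME hbar M N)).
have [c2 _] := ME_concentrated (twisted_conv_ME hbar (star_ME N) (star_ME M)).
apply: (complex_measure_ext c1 c2) => A mA.
have [e [m [m' [h1 [h2 [h' [r1 _ r' _]]]]]]] := ME_represented3 M M N.
have [_ _ _ ->//] := represents_star (twisted_conv_represents hbar r1 r').
have [_ _ _ ->//] :=
  twisted_conv_represents hbar (represents_star r') (represents_star r1).
have := cint_phase_swap hbar (represents_star r') (represents_star r1)
  (cmeasurable_indic mA) (cnorm1_indic A).
move=> h; rewrite [RHS]h; apply: eq_cint => z.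
rewrite /kernel_density /sum_map /= phaseNN !rmorphM/= phase_conj.
by rewrite opprD.
Qed.

End twisted_convolution.

(** * Square roots and boundedness of representations *)

Section uniform_limits.
Context {R : realType}.

(** The intervals of centre [u n] and radius [2 * d / 2 ^+ n], the tail of the geometric series, are
    nested; [L] is the supremum of their left ends. *)
Lemma geometric_limit (u : nat -> R) (d : R) :
  (forall n, `|u n.+1 - u n| <= d / 2 ^+ n) ->
  exists L, forall n, `|L - u n| <= 2 * d / 2 ^+ n.
Proof.
move=> ud.
have d0 : 0 <= d by rewrite (le_trans _ (le_trans (ud 0%N) _))// expr0 divr1.
pose r n := 2 * d / 2 ^+ n.
have rS n : r n - r n.+1 = d / 2 ^+ n.
  rewrite /r exprS; have : (2 ^+ n : R) != 0 by rewrite expf_neq0.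
  by move=> h; field.
pose w n := u n - r n; pose v n := u n + r n.
have wS n : w n <= w n.+1.
  have := ud n; rewrite -rS ler_norml => /andP[h1 h2]; rewrite /w; lra.
have vS n : v n.+1 <= v n.
  have := ud n; rewrite -rS ler_norml => /andP[h1 h2]; rewrite /v; lra.
have r0 n : 0 <= r n by rewrite /r divr_ge0 ?mulr_ge0 ?exprn_ge0.
have wm m n : (m <= n)%N -> w m <= w n.
  by move=> /subnK <-; elim: (n - m)%N => // k; move/le_trans; apply; exact: wS.
have vm m n : (m <= n)%N -> v n <= v m.
  by move=> /subnK <-; elim: (n - m)%N => // k; apply: le_trans; exact: vS.
have wv m n : w m <= v n.
  apply: (le_trans (wm _ _ (leq_maxl m n))); apply: le_trans (vm _ _ (leq_maxr m n)).
  by rewrite /w /v; have := r0 (maxn m n); lra.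
have hw : has_sup (range w).
  split; first by exists (w 0%N), 0%N.
  by exists (v 0%N) => _ [n _ <-].
exists (sup (range w)) => n; rewrite -/(r n) ler_norml.
have h1 : w n <= sup (range w) by apply: ub_le_sup; [exact: hw.2|exists n].
have h2 : sup (range w) <= v n by apply: ge_sup; [exact: hw.1|move=> _ [m _ <-]].
by rewrite /w /v in h1 h2; apply/andP; split; lra.
Qed.

Lemma small_geometric (C eps : R) : 0 <= C -> 0 < eps -> exists n, C / 2 ^+ n < eps.
Proof.
move=> C0 eps0; exists (Num.truncn (C / eps)).
rewrite ltr_pdivrMr ?exprn_gt0// mulrC -ltr_pdivrMr//.
have h : C / eps < (Num.truncn (C / eps)).+1%:R by exact: truncnS_gt.
apply: (lt_le_trans h); rewrite -natrX ler_nat.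
exact: ltn_expl.
Qed.

Lemma le0_geometric (x C : R) : 0 <= C -> (forall n, x <= C / 2 ^+ n) -> x <= 0.
Proof.
move=> C0 xC; apply/ler_addgt0Pl => eps eps0; rewrite addr0.
by have [n nC] := small_geometric C0 eps0; exact: le_trans (xC n) (ltW nC).
Qed.

(** Finite additivity passes to the limit, and then an argument with three thirds of [eps] exchanges
    the two limits, the approximation being uniform over measurable sets. *)
Lemma uniform_limit_sigma_additive d (T : measurableType d) (f_ : nat -> set T -> R)
    (f : set T -> R) (C : R) :
  (forall n, semi_sigma_additive (fun A => (f_ n A)%:E)) ->
  (forall n A, measurable A -> `|f A - f_ n A| <= C / 2 ^+ n) ->
  semi_sigma_additive (fun A => (f A)%:E).
Proof.
move=> f_s fC F mF tF mUF.
have C0 : 0 <= C.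
  by have := fC 0%N set0 measurable0; rewrite expr0 divr1; exact: le_trans.
have additive n N : f_ n (\big[setU/set0]_(i < N) F i) = \sum_(i < N) f_ n (F i).
  have [nu nuE] := real_charge (f_s n).
  apply: EFin_inj; rewrite -nuE -sumEFin.
  rewrite [RHS](eq_bigr (fun i : 'I_N => nu (F i))) => [|i _]; last by rewrite nuE.
  by apply: charge_semi_additive => //; exact: bigsetU_measurable.
have mU N : measurable (\big[setU/set0]_(i < N) F i) by exact: bigsetU_measurable.
have additive_lim N : f (\big[setU/set0]_(i < N) F i) = \sum_(i < N) f (F i).
  apply/eqP; rewrite -subr_eq0 -normr_le0.
  (* One error for the union and one for each of the [N] terms. *)
  apply: (@le0_geometric _ (C *+ N.+1)); first by rewrite mulrn_wge0.
  move=> n; rewrite -(subrK (f_ n (\big[setU/set0]_(i < N) F i)) (f _)) -addrA.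
  rewrite [X in _ + (X - _)]additive -sumrB (le_trans (ler_normD _ _))//.
  rewrite mulrS mulrDl lerD ?fC//.
  rewrite (le_trans (ler_norm_sum _ _ _))//.
  have -> : C *+ N / 2 ^+ n = \sum_(i < N) C / 2 ^+ n.
    by rewrite sumr_const card_ord mulrnAl.
  apply: ler_sum => i _.
  by rewrite distrC fC.
apply/fine_cvgP; split; first by near=> n; rewrite sumEFin.
apply/cvgrPdist_lt => eps eps0.
have [n nC] := @small_geometric C (eps / 3) C0 (divr_gt0 eps0 (ltr0n _ 3)).
have := f_s n F mF tF mUF; move/fine_cvgP => [_ /cvgrPdist_lt].
move=> /(_ (eps / 3) (divr_gt0 eps0 (ltr0n _ 3))) [N _ NP].
exists N => // M /= NM; have := NP M NM; rewrite /= !sumEFin /= !big_mkord.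
rewrite -additive -additive_lim => h.
have h1 := fC n _ mUF; have h2 := fC n _ (mU M).
rewrite (_ : _ - _ = (f (\bigcup_i F i) - f_ n (\bigcup_i F i)) +
   (f_ n (\bigcup_i F i) - f_ n (\big[setU/set0]_(i < M) F i)) -
   (f (\big[setU/set0]_(i < M) F i) - f_ n (\big[setU/set0]_(i < M) F i))); last by ring.
rewrite (le_lt_trans (ler_normB _ _))// (le_lt_trans (lerD (ler_normD _ _) (lexx _)))//.
by lra.
Unshelve. all: by end_near. Qed.

End uniform_limits.

Section completeness.
Context {R : realType} {E : lmodType R}.
Implicit Types (mu nu c : set (borel E) -> R[i]).

(** The limit is taken set by set. All terms are concentrated on one countable span, hence so is the
    limit, and [concentrated_ME] gives membership. The constant 4 is twice the 2 of
    [geometric_limit], for the real and imaginary parts. *)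
Lemma ME_complete (c_ : nat -> set (borel E) -> R[i]) (d : R) :
  (forall n, ME E (c_ n)) ->
  (forall n, measure_bound (fun A => c_ n.+1 A - c_ n A) (d / 2 ^+ n)) ->
  exists c, ME E c /\ forall n, measure_bound (fun A => c A - c_ n A) (4 * d / 2 ^+ n).
Proof.
move=> cM cd.
have Re_le (z : R[i]) : `|complex.Re z| <= cnorm1 z by rewrite lerDl.
have Im_le (z : R[i]) : `|complex.Im z| <= cnorm1 z by rewrite lerDr.
have d0 : 0 <= d.
  have := cd 0%N set0 measurable0; rewrite expr0 divr1; apply: le_trans.
  exact: cnorm1_ge0.
have /choice[L LP] (A : set (borel E)) : exists z : R[i],
    (measurable A -> forall n, `|complex.Re z - complex.Re (c_ n A)| <= 2 * d / 2 ^+ n /\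
    `|complex.Im z - complex.Im (c_ n A)| <= 2 * d / 2 ^+ n) /\ (~ measurable A -> z = 0).
  have [mA|mA] := pselect (measurable A); last by exists 0.
  have [Lr LrP] : exists L, forall n, `|L - complex.Re (c_ n A)| <= 2 * d / 2 ^+ n.
    apply: geometric_limit => n; rewrite -ReN -ReD.
    exact: le_trans (Re_le _) (cd n A mA).
  have [Li LiP] : exists L, forall n, `|L - complex.Im (c_ n A)| <= 2 * d / 2 ^+ n.
    apply: geometric_limit => n; rewrite -ImN -ImD.
    exact: le_trans (Im_le _) (cd n A mA).
  by exists (Complex Lr Li).
have cL n : measure_bound (fun A => L A - c_ n A) (4 * d / 2 ^+ n).
  move=> A mA; have [/(_ mA n)[h1 h2] _] := LP A.
  rewrite /cnorm1 ReD ImD ReN ImN (le_trans (lerD h1 h2))//.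
  by rewrite -!mulrDl -natrD.
exists L; split => //.
have [e eP] := ME_seq_concentrated cM.
apply: (@concentrated_ME _ _ e).
  split; first by move=> A; have [] := LP A.
    apply: (@uniform_limit_sigma_additive _ _ _ (fun n A => complex.Re (c_ n A)) _ (2 * d)).
      by move=> n; have [[]] := cM n.
    by move=> n A mA; have [/(_ mA n)[]] := LP A.
  apply: (@uniform_limit_sigma_additive _ _ _ (fun n A => complex.Im (c_ n A)) _ (2 * d)).
    by move=> n; have [[]] := cM n.
  by move=> n A mA; have [/(_ mA n)[]] := LP A.
move=> A mA Ae; apply: cnorm1_eq0; apply: (@le0_geometric _ _ (4 * d)).
  by rewrite mulr_ge0.
by move=> n; have := cL n A mA; rewrite (eP n)// subr0.
Qed.

End completeness.

Section square_root.
Context {R : realType} {E : lmodType R} (sigma : E -> E -> R) (hbar : R).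
Hypotheses (sl : forall y, scalar (sigma^~ y)) (sr : forall x, scalar (sigma x)).
Hypothesis sigma_antisym : forall f g, sigma f g = - sigma g f.
Implicit Types (b c : set (borel E) -> R[i]).

Local Notation "mu ** nu" := (twisted_conv sigma hbar mu nu) (at level 40).
Let half : R[i] := (2^-1 : R)%:C%C.

Let half2 : half + half = 1.
Proof. by apply: complex_eqP; rewrite ?(ReD, ImD)/= ?addr0//; lra. Qed.

(** The term [- half * b A + b A] is [half * b A], put in the shape [a * mu + nu] that [ME_linear]
    handles. *)
Definition sqrt_step b c : set (borel E) -> R[i] :=
  fun A => half * (c ** c) A + (- half * b A + b A).

Lemma sqrt_step_ME b c : ME E b -> ME E c -> ME E (sqrt_step b c).
Proof.
by move=> bM cM; apply: ME_linear; [exact: twisted_conv_ME|exact: ME_linear].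
Qed.

Let halfN (z : R[i]) : - half * z + z = half * z.
Proof. by rewrite -[X in _ + X]mul1r -half2; ring. Qed.

Let cnorm1_half (z : R[i]) : cnorm1 (half * z) <= 2^-1 * cnorm1 z.
Proof. by rewrite (le_trans (cnorm1M _ _))// cnorm1_real ger0_norm. Qed.

(** Half the sum of [32 / 64 ^ 2] and [1 / 64] is [3 / 256], below [1 / 64]. *)
Lemma sqrt_step_bound b c : ME E c -> measure_bound b (64^-1) ->
  measure_bound c (64^-1) -> measure_bound (sqrt_step b c) (64^-1).
Proof.
move=> cM bb cb A mA; rewrite /sqrt_step halfN.
have h1 := twisted_conv_bound sl sr hbar cM cM cb cb mA; have h2 := bb A mA.
apply: (le_trans (cnorm1D _ _)).
have := cnorm1_half ((c ** c) A); have := cnorm1_half (b A).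
lra.
Qed.

Lemma sqrt_step_lipschitz b c c' M d : ME E c -> ME E c' ->
  measure_bound c M -> measure_bound c' M ->
  measure_bound (fun A => c A - c' A) d ->
  measure_bound (fun A => sqrt_step b c A - sqrt_step b c' A) (32 * M * d).
Proof.
move=> cM cM' cb cb' cd A mA.
have dE : (fun A => c A - c' A) = (fun A => -1 * c' A + c A).
  by apply/funext => S; rewrite mulN1r addrC.
have dM : ME E (fun A => c A - c' A) by rewrite dE; exact: ME_linear.
have e1 : (fun A => c A - c' A) ** c = (fun A => -1 * (c' ** c) A + (c ** c) A).
  by rewrite dE twisted_conv_linear_l.
have e2 : c' ** (fun A => c A - c' A) = (fun A => -1 * (c' ** c') A + (c' ** c) A).
  by rewrite dE twisted_conv_linear_r.
have h1 := twisted_conv_bound sl sr hbar dM cM cd cb mA.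
have h2 := twisted_conv_bound sl sr hbar cM' dM cb' cd mA.
(* The difference of squares is telescoped with the factors kept in order, the product being
   non-commutative. Each half contributes [16 * M * d], so the step contracts by 1/2 when [M] is
   1/64. *)
rewrite (_ : _ - _ = half * (((fun A => c A - c' A) ** c) A +
    (c' ** (fun A => c A - c' A)) A)); last first.
  rewrite e1 e2 /sqrt_step.
  move: ((c ** c) A) ((c' ** c) A) ((c' ** c') A) (- half * b A + b A) (half : R[i]).
  by move=> u v w t h; ring.
apply: (le_trans (cnorm1_half _)).
have := cnorm1D (((fun A => c A - c' A) ** c) A) ((c' ** (fun A => c A - c' A)) A).
by lra.
Qed.

Lemma star_sqrt_step b c : ME E b -> ME E c -> star b = b -> star c = c ->
  star (sqrt_step b c) = sqrt_step b c.
Proof.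
move=> bM cM bs cs.
have ccs : star (c ** c) = c ** c by rewrite star_twisted_conv// cs.
have half_conj : Num.conj half = half.
  by apply: complex_eqP; rewrite ?Re_conj ?Im_conj /= ?oppr0.
apply/funext => A; rewrite {1}/star /sqrt_step !halfN rmorphD !rmorphM/= half_conj.
have := congr1 (fun f => f A) ccs; have := congr1 (fun f => f A) bs.
by rewrite /star /= => -> ->.
Qed.

(* The iteration [c := (b + c ** c) / 2] converges to a self-adjoint [c] with
   [1 - b = (1 - c) ** (1 - c)] in the unitization, that is [b = 2 c - c ** c],
   written below in the shape [a * mu + nu] for which representations are linear.
   By [twisted_conv_bound] the step preserves the ball of radius [1 / 64]. *)
Lemma selfadjoint_sqrt b : ME E b -> star b = b -> measure_bound b (64^-1) ->
  exists c, [/\ ME E c, star c = c & b = (fun A => 1 * c A + (-1 * (c ** c) A + c A))].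
Proof.
move=> bM bs bb; pose c_ n := iter n (sqrt_step b) b.
have cM n : ME E (c_ n) by elim: n => // n ih; exact: sqrt_step_ME.
have cb n : measure_bound (c_ n) (64^-1).
  by elim: n => // n ih; exact: sqrt_step_bound.
have cs n : star (c_ n) = c_ n by elim: n => // n ih; exact: star_sqrt_step.
(* The initial distance [1 / 32] comes from two terms in the ball of radius [1 / 64]. *)
have cd n : measure_bound (fun A => c_ n.+1 A - c_ n A) (32^-1 / 2 ^+ n).
  elim: n => [|n ih] A mA.
    rewrite expr0 divr1 (le_trans (cnorm1D _ _))// cnorm1N.
    by have := cb 1%N A mA; have := cb 0%N A mA; lra.
  have := sqrt_step_lipschitz b (cM n.+1) (cM n) (cb n.+1) (cb n) ih mA.
  move/le_trans; apply; rewrite le_eqVlt; apply/orP; left; apply/eqP.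
  rewrite exprS; have : (2 ^+ n : R) != 0 by rewrite expf_neq0.
  by move=> h; field.
have [c [ccM cL]] := ME_complete cM cd.
have half_neq0 : half != 0.
  by apply: contra_eq_neq half2 => ->; rewrite addr0 eq_sym oner_eq0.
(* The available estimate places the limit within 1/8 of the ball of radius 1/64. The crude radius 1
   is enough for the step to be Lipschitz, and this is all that identifying the fixed point
   requires. *)
have ccb : measure_bound c 1.
  move=> A mA; rewrite -(subrK (c_ 0%N A) (c A)) (le_trans (cnorm1D _ _))//.
  by have := cL 0%N A mA; have := cb 0%N A mA; rewrite expr0 divr1; lra.
have cb1 n : measure_bound (c_ n) 1.
  by move=> A mA; rewrite (le_trans (cb n A mA))//; lra.
have fixc : c = sqrt_step b c.
  apply: complex_measure_ext; [exact: (ME_concentrated ccM).1| |].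
    exact: (ME_concentrated (sqrt_step_ME bM ccM)).1.
  move=> A mA; apply/eqP; rewrite -subr_eq0; apply/eqP; apply: cnorm1_eq0.
  (* The two errors are [1 / 16] and 4, in units of [1 / 2 ^+ n]. *)
  apply: (@le0_geometric _ _ 5) => // n.
  have h1 := cL n.+1 A mA.
  have h2 := sqrt_step_lipschitz b ccM (cM n) ccb (cb1 n) (cL n) mA.
  have q0 : 0 < 2 ^+ n :> R by rewrite exprn_gt0.
  rewrite -(subrK (c_ n.+1 A) (c A)) -addrA (le_trans (cnorm1D _ _))//.
  rewrite -cnorm1N opprB in h2; apply: (le_trans (lerD h1 h2)).
  rewrite exprS; set q : R := 2 ^+ n in q0 *.
  rewrite (_ : _ + _ = (16^-1 + 4) / q); last by field; rewrite gt_eqF.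
  by rewrite ler_pM2r ?invr_gt0//; lra.
have starc : star c = c.
  apply: complex_measure_ext; [exact: (ME_concentrated (star_ME ccM)).1|
    exact: (ME_concentrated ccM).1|].
  move=> A mA; apply/eqP; rewrite -subr_eq0; apply/eqP; apply: cnorm1_eq0.
  apply: (@le0_geometric _ _ 1) => // n.
  have h1 := cL n A mA; have h2 := star_bound (cL n) mA.
  rewrite -(subrK (c_ n A) (star c A)) -addrA (le_trans (cnorm1D _ _))//.
  have e : star c A - c_ n A = star (fun A => c A - c_ n A) A.
    by rewrite -[X in _ - X]/(c_ n A) -[in LHS](cs n) /star rmorphB.
  rewrite -cnorm1N opprB in h1; rewrite e (le_trans (lerD h2 h1))//.
  have q0 : 0 < 2 ^+ n :> R by rewrite exprn_gt0.
  by rewrite -mulrDl ler_pM2r ?invr_gt0//; lra.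
exists c; split => //; apply/funext => A.
have : c A = sqrt_step b c A by rewrite -fixc.
rewrite /sqrt_step halfN => h; apply: (mulfI half_neq0).
rewrite mul1r mulN1r.
have -> : half * (c A + (- (c ** c) A + c A)) = (half + half) * c A - half * (c ** c) A.
  by ring.
by rewrite half2 mul1r {1}h; ring.
Qed.

End square_root.

Section contraction.
Context {R : realType} {E : lmodType R} (sigma : E -> E -> R) (hbar : R).
Hypotheses (sl : forall y, scalar (sigma^~ y)) (sr : forall x, scalar (sigma x)).
Hypothesis sigma_antisym : forall f g, sigma f g = - sigma g f.
Context {H : hilbertType R} (Pi : (set (borel E) -> R[i]) -> H -> H).
Hypothesis Pi_rep : representation sigma hbar Pi.

Lemma representation_contraction mu (x : H) : ME E mu -> measure_bound mu (64^-1) ->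
  `|Pi mu x| <= `|x|.
Proof.
have [Pi_bd Pi_lin Pi_mul Pi_star] := Pi_rep => muM mub.
pose b := twisted_conv sigma hbar (star mu) mu.
have smuM := star_ME muM.
have bM : ME E b by exact: twisted_conv_ME.
have bs : star b = b.
  by rewrite /b (star_twisted_conv sl sr sigma_antisym hbar smuM muM) star_star.
have bb : measure_bound b (64^-1).
  move=> A mA.
  have := twisted_conv_bound sl sr hbar smuM muM (star_bound mub) mub mA; lra.
have [c [cM cs bE]] := selfadjoint_sqrt hbar sl sr sigma_antisym bM bs bb.
have ccM : ME E (twisted_conv sigma hbar c c) by exact: twisted_conv_ME.
have Pib : Pi b x = Pi c x + (- Pi c (Pi c x) + Pi c x).
  rewrite bE Pi_lin//; last exact: ME_linear.
  by rewrite Pi_lin// Pi_mul//= scale1r scaleN1r.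
rewrite -(ler_pXn2r (ltn0Sn 1)) ?nnegrE//.
rewrite !hilbert_normE Pi_star//.
rewrite -[Pi (star mu) (Pi mu x)]/((Pi (star mu) \o Pi mu) x) -Pi_mul// -/b Pib.
rewrite !linearDr linearNr/=.
have -> : inner H x (Pi c (Pi c x)) = inner H (Pi c x) (Pi c x).
  by rewrite Pi_star// cs.
have e : inner H x (Pi c x) = inner H (Pi c x) x by rewrite Pi_star// cs.
(* This square is exactly the inner product of [x] with itself minus that of [x] with [Pi b x]. It
   is expanded in the Hilbert space, where the identity is at hand even if [Pi] is not unital. *)
have : 0 <= `|x - Pi c x| ^+ 2 by rewrite exprn_ge0.
rewrite hilbert_normE linearBl !linearBr /= e => h; rewrite -subr_ge0; move: h.
move: (inner H x x) (inner H (Pi c x) x) (inner H (Pi c x) (Pi c x)) => u v w.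
by congr (0 <= _); ring.
Qed.

Lemma opnorm_representation mu (M : R) : ME E mu -> 0 < M -> measure_bound mu M ->
  (opnorm (Pi mu) <= (64 * M)%:E)%E.
Proof.
have [Pi_bd Pi_lin _ _] := Pi_rep => muM M0 mub.
pose t : R := (64 * M)^-1; have t0 : 0 < t by rewrite invr_gt0 mulr_gt0.
(* The rescaled measure [t * mu], written as [(t - 1) * mu + mu] since linearity of [Pi] is stated
   in that shape. *)
pose nu : set (borel E) -> R[i] := fun A => (t - 1)%:C%C * mu A + mu A.
have nuE A : nu A = t%:C%C * mu A by rewrite /nu rmorphB rmorph1 mulrBl mul1r subrK.
have nuM : ME E nu by exact: ME_linear.
have nub : measure_bound nu (64^-1).
  move=> A mA; rewrite nuE (le_trans (cnorm1M _ _))// cnorm1_real gtr0_norm//.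
  rewrite mulrC ler_pdivrMr ?mulr_gt0// mulrA mulVf ?mul1r ?mub//.
apply: ge_ereal_sup => _ [x /= x1 <-]; rewrite lee_fin.
have := le_trans (representation_contraction x nuM nub) x1.
have -> : Pi nu x = t%:C%C *: Pi mu x.
  by rewrite Pi_lin//= rmorphB rmorph1 scalerBl scale1r subrK.
rewrite normrZ normc_def /= expr0n addr0 sqrtr_sqr gtr0_norm//.
case: (`|Pi mu x|) => p q; rewrite lecE /= => /andP[_].
rewrite mul0r subr0 => tp.
by rewrite -[leRHS]mulr1 -ler_pdivrMl ?mulr_gt0.
Qed.

End contraction.

(** * Integration against the total variation *)

Section integral_against_total_variation.
Context d {T : measurableType d} {R : realType}.
Import HBNNSimple.

(** Applied with the total variation as [t], for which only values on sets are compared and no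
    additivity is at hand. The inequality is transferred from sets to simple functions and then to
    suprema. *)
Lemma integral_dominated_lty (m : {measure set T -> \bar R}) (t : set T -> \bar R)
    (C : R) (f : T -> \bar R) :
  0 <= C -> t set0 = 0%E -> (forall A, measurable A -> (0 <= t A)%E) ->
  (forall A, measurable A -> (m A <= C%:E * t A)%E) -> (forall x, (0 <= f x)%E) ->
  (\int[t]_x f x < +oo)%E -> (\int[m]_x f x < +oo)%E.
Proof.
move=> C0 t0 t_ge0 mt f0.
(* Values outside the range have empty fibres and contribute nothing; this is where [t set0 = 0]
   enters. *)
have st_range (h : {nnsfun T >-> R}) :
    sintegral t h = (\sum_(x \in range h) x%:E * t (h @^-1` [set x]))%E.
  rewrite /sintegral (fsbig_widen (range h) setT)//= => x [_ Nhx] /=.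
  by rewrite preimage10// t0 mule0.
have fp : (f^\+)%E = f by apply/funext => x; rewrite funeposE; apply/max_idPl.
have fn : (f^\-)%E = cst 0%E.
  by apply/funext => x; rewrite funenegE; apply/max_idPr; rewrite oppe_le0.
rewrite ge0_integralTE// /integral !patch_setT fp fn.
(* The negative part of the integral vanishes: a non-negative simple function below 0 is identically
   0. *)
have -> : ereal_sup [set sintegral t h | h in
    [set h : {nnsfun T >-> R} | forall x, (h x)%:E <= cst 0 x]]%E = 0%E.
  have s0 (h : {nnsfun T >-> R}) : (forall x, (h x)%:E <= cst 0 x)%E -> sintegral t h = 0%E.
    move=> h0; rewrite st_range fsbig1// => r [x _ <-].
    have -> : h x = 0 by apply/eqP; rewrite eq_le fun_ge0 andbT -lee_fin.
    by rewrite mul0e.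
  apply/eqP; rewrite eq_le; apply/andP; split.
    by apply: ge_ereal_sup => _ [h h0 <-]; rewrite s0.
  by apply: ereal_sup_ubound; exists nnsfun0 => //; exact: s0.
rewrite sube0 => tf.
apply: (@le_lt_trans _ _ (C%:E * ereal_sup [set sintegral t h | h in
    [set h : {nnsfun T >-> R} | forall x, (h x)%:E <= f x]])%E); last first.
  apply: lte_mul_pinfty => //.
apply: ge_ereal_sup => _ [h /= hf <-].
apply: (@le_trans _ _ (C%:E * sintegral t h)%E); last first.
  by rewrite lee_wpmul2l// ?lee_fin//; apply: ereal_sup_ubound; exists h.
rewrite sintegralE st_range ge0_mule_fsumr; last first.
  move=> r; have [r0|r0] := leP 0 r; first by rewrite mule_ge0// t_ge0.
  by rewrite preimage_nnfun0// t0 mule0.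
apply: lee_fsum => // r [x _ <-].
by rewrite muleCA lee_wpmul2l ?lee_fin// mt.
Qed.

End integral_against_total_variation.

(** * Semiclassical limits *)

Section trigonometric_bounds.
Context {R : realType}.
Implicit Types t s : R.

Lemma sinE_cos_mean t : 0 <= t -> exists2 c, 0 <= c <= t & sin t = cos c * t.
Proof.
move=> t0; have [c|c] := @MVT_segment R sin cos 0 t t0 (fun x _ => is_derive_sin x).
  by apply: continuous_subspaceT => x; exact: continuous_sin.
by rewrite in_itv /= => ct; rewrite sin0 !subr0 => ->; exists c.
Qed.

Lemma normr_sin_le t : `|sin t| <= `|t|.
Proof.
wlog t0 : t / 0 <= t.
  move=> h; have [/h//|t0] := leP 0 t.
  by rewrite -normrN -sinN -[leRHS]normrN h// oppr_ge0 ltW.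
have [c _ ->] := sinE_cos_mean t0.
by rewrite normrM ler_piMl// ler_norml cos_geN1 cos_le1.
Qed.

Lemma normr_cosB1_le t : `|cos t - 1| <= `|t|.
Proof.
wlog t0 : t / 0 <= t.
  move=> h; have [/h//|t0] := leP 0 t.
  by rewrite -cosN -[leRHS]normrN h// oppr_ge0 ltW.
have [c|c] := @MVT_segment R cos (fun x => - sin x) 0 t t0 (fun x _ => is_derive_cos x).
  by apply: continuous_subspaceT => x; exact: continuous_cos.
rewrite cos0 subr0 => _ ->.
by rewrite normrM normrN ler_piMl// ler_norml sin_geN1 sin_le1.
Qed.

(** By the mean value theorem [sin t - t] is [(cos c - 1) * t] with [c] between 0 and [t]. A
    quadratic bound is enough: after division by [t] one power is left to tend to 0. *)
Lemma normr_sinB_le t : `|sin t - t| <= t ^+ 2.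
Proof.
wlog t0 : t / 0 <= t.
  move=> h; have [/h//|t0] := leP 0 t.
  have := h (- t); rewrite oppr_ge0 sinN sqrrN => /(_ (ltW t0)).
  by rewrite -opprD normrN.
have [c /andP[c0 ct] ->] := sinE_cos_mean t0.
rewrite -[X in _ - X]mul1r -mulrBl normrM expr2 (ger0_norm t0) ler_wpM2r//.
by rewrite (le_trans (normr_cosB1_le _))// ger0_norm.
Qed.

Lemma expiD s t : expi (s + t) = expi s * expi t.
Proof. by apply: complex_eqP; rewrite ?ReM ?ImM /= ?cosD ?sinD// addrC. Qed.

Lemma expi0 : expi 0 = 1 :> R[i].
Proof. by rewrite /expi cos0 sin0. Qed.

Lemma cnorm1_expiB1 t : cnorm1 (expi t - 1) <= 2 * `|t|.
Proof.
rewrite /cnorm1 /= subr0 mulr_natl mulr2n lerD//; first exact: normr_cosB1_le.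
exact: normr_sin_le.
Qed.

End trigonometric_bounds.

Section small_parameter.
Context d {Z : measurableType d} {R : realType}.
Variable P : {finite_measure set Z -> \bar R}.

(** Dominated convergence along sequences that avoid 0. The two bounds have separate roles: [G] is
    integrable and dominates, while [w] gives only pointwise convergence and may have infinite
    integral. *)
Lemma Rintegral_dnbhs0 (g : R -> Z -> R) (G w : Z -> R) :
  (forall t, t != 0 -> measurable_fun setT (g t)) ->
  P.-integrable setT (EFin \o G) ->
  (forall t z, t != 0 -> 0 <= g t z <= G z) ->
  (forall t z, t != 0 -> g t z <= `|t| * w z) ->
  (fun t => \int[P]_z g t z) @ (0 : R)^' --> (0 : R).
Proof.
move=> mg iG gG gw; apply/cvgr_dnbhsP => u [u0 ucvg].
have := dominated_cvg (mu := P) measurableT (f_ := fun n z => (g (u n) z)%:E)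
  (f := cst 0%E) (g := EFin \o G).
move=> /(_ (fun n => iffRL (measurable_EFinP _ _) (mg _ (u0 n)))) h.
have {}h : (\int[P]_z (g (u n) z)%:E)%E @[n --> \oo] --> (\int[P]_z (cst 0 z))%E.
  apply: h => //.
    move=> z _; apply: cvg_EFin; first exact: nearW.
    apply: (@squeeze_cvgr _ _ _ _ (cst 0) (fun n => `|u n| * w z)).
    - apply: nearW => n; have /andP[-> _] := gG (u n) z (u0 n).
      by rewrite gw.
    - exact: cvg_cst.
    - rewrite -[X in _ --> X](mul0r (w z)) -(normr0 R).
      by apply: cvgM; [exact: cvg_norm|exact: cvg_cst].
  move=> n z _; have /andP[g0 gGz] := gG (u n) z (u0 n).
  by rewrite /= lee_fin ger0_norm.
rewrite integral0 in h.
by move/fine_cvgP : h => [_ h].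
Qed.

End small_parameter.

Section fourier_transform.
Context {R : realType} {E : tvsType R} (sigma : E -> E -> R).
Hypotheses (sl : forall y, scalar (sigma^~ y)) (sr : forall x, scalar (sigma x)).
Implicit Types (mu nu : set (borel E) -> R[i]).

Lemma cintegral_represents e d (Z : measurableType d)
    (P : {finite_measure set Z -> \bar R}) (H : Z -> R[i]) psi mu (F : borel E -> R[i]) (B : R) :
  span_represents e P H psi mu -> cmeasurable F -> (forall x, cnorm1 (F x) <= B) ->
  cintegral mu F = cint P (fun z => F (psi z) * H z).
Proof.
move=> [iH mpsi psie muE] mF FB.
apply: (cintegral_pushed iH mpsi muE (measurable_countable_span e)) => //.
apply: le_integrable (integrable_scale B iH) => //.
  apply/measurable_EFinP; apply: measurable_funM; apply: measurable_cnorm1.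
    exact: cmeasurable_comp mF.
  exact: cintegrable_measurable iH.
have B0 : 0 <= B by exact: le_trans (cnorm1_ge0 _) (FB 0).
move=> z _; rewrite /= lee_fin !ger0_norm ?mulr_ge0 ?cnorm1_ge0//.
by rewrite ler_wpM2r ?cnorm1_ge0.
Qed.

Lemma cintegrableM_bounded d (Z : measurableType d)
    (P : {finite_measure set Z -> \bar R}) (H K : Z -> R[i]) (B : R) :
  cintegrable P H -> cmeasurable K -> (forall z, cnorm1 (K z) <= B) ->
  cintegrable P (fun z => K z * H z).
Proof.
move=> iH mK KB; apply: (cintegrable_le _ (integrable_scale B iH)).
  by apply: cmeasurableM => //; exact: cintegrable_measurable iH.
by move=> z; rewrite (le_trans (cnorm1M _ _))// ler_wpM2r ?cnorm1_ge0.
Qed.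

Lemma cint_prodM d d' (Z : measurableType d) (Z' : measurableType d')
    (P : {finite_measure set Z -> \bar R}) (P' : {finite_measure set Z' -> \bar R})
    (u : Z -> R[i]) (v : Z' -> R[i]) : cintegrable P u -> cintegrable P' v ->
  cint (P \x P')%E (fun z => u z.1 * v z.2) = cint P u * cint P' v.
Proof.
move=> iu iv.
have mu := cintegrable_measurable iu; have mv := cintegrable_measurable iv.
rewrite cint_prod1.
- rewrite (eq_cint _ (K := fun x => cint P' v * u x)) ?cintZ 1?mulrC// => x.
  by rewrite -[LHS]/(cint P' (fun y => u x * v y)) cintZ// mulrC.
- apply: (cintegrable_le _ (integrable_prod (integrable_cnorm1 iu) (integrable_cnorm1 iv))).
    apply: cmeasurableM; first exact: (cmeasurable_comp (psi := fst) _ mu).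
    exact: (cmeasurable_comp (psi := snd) _ mv).
  by move=> z; exact: cnorm1M.
- by move=> x /=; exact: cintegrableZ.
Qed.

(** For [hbar = 0] the phase is 1 and the character of a sum factors, so the product integral
    splits. The pointwise product is thereby a Fourier transform, to which the definition of the
    quantization applies. *)
Lemma fourier_twisted_conv0 mu nu : ME E mu -> ME E nu ->
  fourier (twisted_conv sigma 0 mu nu) = fourier mu \* fourier nu :> (dual E -> R[i]).
Proof.
move=> M N; apply/funext => F /=; rewrite /fourier.
have [e [m [m' [h1 [h2 [h' [r1 _ r' _]]]]]]] := ME_represented3 M M N.
have Fs : scalar (sval F : E -> R) by move=> a x y; rewrite linearP.
have mF : cmeasurable (fun f : borel E => expi (sval F f : R)).
  by apply: cmeasurable_expi; exact: measurable_scalar.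
have FB (f : borel E) : cnorm1 (expi (sval F f : R)) <= 2 by exact: cnorm1_expi.
rewrite (cintegral_represents r1 mF FB) (cintegral_represents r' mF FB).
rewrite (cintegral_represents (twisted_conv_represents sl sr 0 r1 r') mF FB).
have [i1 mp _ _] := r1; have [i' _ _ _] := r'.
rewrite -cint_prodM.
- apply: eq_cint => z; rewrite /sum_map /kernel_density /phase.
  rewrite mul0r mul0r oppr0 expi0 mulr1 linearD expiD; ring.
- by apply: (cintegrableM_bounded i1 _ (fun=> FB _)); exact: cmeasurable_comp mF.
- by apply: (cintegrableM_bounded i' _ (fun=> FB _)); exact: cmeasurable_comp mF.
Qed.

End fourier_transform.

Section first_moment.
Context {R : realType} {E : lmodType R}.

Lemma total_variation_set0 d (T : measurableType d) (mu : set T -> R[i]) :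
  mu set0 = 0 -> Defs.total_variation mu set0 = 0%E.
Proof.
move=> mu0; rewrite /Defs.total_variation.
rewrite (_ : [set _ | _ in _] = [set 0%E]) ?ereal_sup1//.
apply/seteqP; split => [_ [F [mF tF F0] <-]|_ ->] /=.
  have FE i : F i = set0 by apply/seteqP; split => // x Fx; rewrite -F0; exists i.
  apply: eseries0 => i _ _; rewrite FE mu0 /cabs normc_def /= !expr0n/= addr0 sqrtr0.
  by [].
exists (fun=> set0); last first.
  by apply: eseries0 => i _ _; rewrite mu0 /cabs normc_def /= !expr0n/= addr0 sqrtr0.
split => //; first exact: trivIset_set0.
by apply/seteqP; split => // x [].
Qed.

(** The measure with density [cnorm1 (h x)] is at most 8 times the total variation on every
    measurable set, so finiteness of the moment passes from the latter to the former. *)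
Lemma ME1_integrable (vs : E -> R) mu e (m : {finite_measure set (borel E) -> \bar R})
    (h : borel E -> R[i]) :
  is_seminorm vs -> ME1 vs mu -> span_represents e m h (span_proj e) mu ->
  (forall A, measurable A ->
    ((\int[m]_(x in A) cnorm1 (h x))%:E <= 8%:E * Defs.total_variation mu A)%E) ->
  m.-integrable setT (fun x => (vs (span_proj e x) * cnorm1 (h x))%:E).
Proof.
move=> svs [muM muvs] [ih _ _ _] hB; have mvs := measurable_seminorm svs.
have mh := measurable_cnorm1 (cintegrable_measurable ih).
have [q [qE q_ge0 _]] := pushed_density (integrable_cnorm1 ih) (fun z => cnorm1_ge0 (h z))
  (@measurable_id _ (borel E) setT).
have [[_ reS imS] _] := muM.
have mu0 : mu set0 = 0.
  by apply: complex_eqP; [exact: (sigma_additive_eq0 reS)|exact: (sigma_additive_eq0 imS)].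
have qvs : (\int[q]_x (vs x)%:E < +oo)%E.
  apply: (@integral_dominated_lty _ _ _ q (Defs.total_variation mu) 8) => //.
  - exact: total_variation_set0.
  - move=> A mA; have := cnorm1_le_total_variation mu mA mA (@subset_refl _ A).
    by move/(le_trans (cnorm1_ge0 _ : (0%:E <= (cnorm1 _)%:E)%E)); rewrite pmule_rge0.
  - move=> A mA; rewrite -[leLHS]/(q A) qE// preimage_id.
    rewrite -[leLHS]fineK ?hB//; apply: integrable_fin_num => //.
    by apply: integrableS (integrable_cnorm1 ih).
  - by move=> x; rewrite lee_fin seminorm_ge0.
have ivs : m.-integrable setT (fun x => (vs x * cnorm1 (h x))%:E).
  apply/integrableP; split; first exact/measurable_EFinP/measurable_funM.
  rewrite q_ge0 in qvs; [|exact/measurable_EFinP|by move=> x; rewrite lee_fin seminorm_ge0].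
  apply: le_lt_trans qvs; rewrite le_eqVlt; apply/orP; left; apply/eqP.
  apply: eq_integral => x _.
  by rewrite /= ger0_norm ?EFinM// mulr_ge0 ?cnorm1_ge0 ?seminorm_ge0.
apply: le_integrable ivs => //.
  apply/measurable_EFinP/measurable_funM => //.
  exact: (measurableT_comp mvs (@measurable_span_proj R E e)).
move=> x _; rewrite /= lee_fin !ger0_norm ?mulr_ge0 ?cnorm1_ge0 ?seminorm_ge0//.
rewrite ler_wpM2r ?cnorm1_ge0// /span_proj; case: ifP => // _.
by rewrite seminorm0// seminorm_ge0.
Qed.

End first_moment.

(** * From densities to operator norms *)

Section limits_of_operators.
Context {R : realType}.

(** The Hilbert space varies with [t], so only the norms can converge. The summand with the absolute
    value of [t] keeps the bound positive, as the rescaling in [opnorm_representation] requires. *)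
Lemma opnorm_cvg0 (H : R -> hilbertType R) (A : forall t, H t -> H t) (eps : R -> R) :
  eps @ (0 : R)^' --> (0 : R) ->
  (forall t, t != 0 -> (opnorm (A t) <= (64 * (eps t + `|t|))%:E)%E) ->
  (fun t => opnorm (A t)) @ (0 : R)^' --> (0 : \bar R).
Proof.
move=> eps0 Aeps.
apply: (squeeze_cvge (f := cst 0%E) (h := fun t => (64 * (eps t + `|t|))%:E)).
- near=> t; rewrite Aeps ?andbT; last by near: t; exact: nbhs_dnbhs_neq.
  apply: le_trans (ereal_sup_ubound _); last first.
    by exists 0 => //=; rewrite normr0.
  by rewrite lee_fin; have := normr_ge0 (A t 0); rewrite lecE => /andP[].
- exact: cvg_cst.
- apply: cvg_EFin; first exact: nearW.
  have tn : (fun t : R => `|t|) @ (0 : R)^' --> (0 : R).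
    rewrite -[X in _ --> X](normr0 R); apply: cvg_norm; exact: nbhs_dnbhs.
  have : (fun t => 64 * (eps t + `|t|)) @ (0 : R)^' --> (64 * (0 + 0) : R).
    by apply: cvgM; [exact: cvg_cst|exact: cvgD].
  by rewrite addr0 mulr0.
Unshelve. all: by end_near. Qed.

Lemma opnorm_density_le {E : lmodType R} (sigma : E -> E -> R) (t : R)
    (H : hilbertType R) (Pi : (set (borel E) -> R[i]) -> H -> H) e d
    (Z : measurableType d) (P : {finite_measure set Z -> \bar R}) (D : Z -> R[i]) psi lam :
  (forall y, scalar (sigma^~ y)) -> (forall x, scalar (sigma x)) ->
  (forall f g, sigma f g = - sigma g f) ->
  representation sigma t Pi -> ME E lam -> span_represents e P D psi lam -> t != 0 ->
  (opnorm (Pi lam) <= (64 * (\int[P]_z cnorm1 (D z) + `|t|))%:E)%E.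
Proof.
move=> sl sr sa Pi_rep lamM [iD mpsi _ lamE] t0.
have D0 : 0 <= \int[P]_z cnorm1 (D z).
  by apply: Rintegral_ge0 => z _; exact: cnorm1_ge0.
apply: (opnorm_representation sl sr sa Pi_rep) => //.
  by rewrite ltr_wpDl// normr_gt0.
move=> A mA; apply: (le_trans (cnorm1_pushed iD mpsi lamE mA)).
by rewrite lerDl.
Qed.

End limits_of_operators.

Section semiclassical_limits.
Context {R : realType} {E : lmodType R} (sigma : E -> E -> R).
Hypotheses (sl : forall y, scalar (sigma^~ y)) (sr : forall x, scalar (sigma x)).
Hypothesis sigma_antisym : forall f g, sigma f g = - sigma g f.
Variables (H : R -> hilbertType R).
Variable Pi : forall t : R, (set (borel E) -> R[i]) -> H t -> H t.
Hypothesis Pi_rep : forall t : R, t != 0 -> representation sigma t (@Pi t).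
Implicit Types (mu nu : set (borel E) -> R[i]).

Lemma von_Neumann_limit mu nu : ME E mu -> ME E nu ->
  (fun t => opnorm ((@Pi t mu \o @Pi t nu) \- @Pi t (twisted_conv sigma 0 mu nu)))
    @ (0 : R)^' --> (0 : \bar R).
Proof.
move=> M N; have [e [m [m' [h1 [h2 [h' [r1 _ r' _]]]]]]] := ME_represented3 M M N.
pose lam t : set (borel E) -> R[i] := fun A =>
  -1 * twisted_conv sigma 0 mu nu A + twisted_conv sigma t mu nu A.
pose D t (z : borel E * borel E) :=
  -1 * kernel_density (phase sigma 0) h1 h' (span_proj e) (span_proj e) z +
  kernel_density (phase sigma t) h1 h' (span_proj e) (span_proj e) z.
have rlam t : span_represents e (finite_prod m m') (D t)
    (sum_map (span_proj e) (span_proj e)) (lam t).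
  exact: represents_linear (twisted_conv_represents sl sr 0 r1 r')
    (twisted_conv_represents sl sr t r1 r').
have lamM t : ME E (lam t) by apply: ME_linear; exact: twisted_conv_ME.
have DE t z : D t z = h1 z.1 * h' z.2 *
    (expi (- (t * sigma (span_proj e z.1) (span_proj e z.2) / 2)) - 1).
  by rewrite /D /kernel_density /phase !mul0r oppr0 expi0; ring.
have [i1 _ _ _] := r1; have [i' _ _ _] := r'.
apply: (@opnorm_cvg0 _ _ _ (fun t => \int[finite_prod m m']_z cnorm1 (D t z))).
  (* The phase minus 1 has [cnorm1] at most 2 + 1, so the factor 4 dominates. The second function
     contains [sigma], which need not be integrable here: [mu] and [nu] satisfy no moment
     condition. *)
  apply: (@Rintegral_dnbhs0 _ _ _ _ _ (fun z => 4 * (cnorm1 (h1 z.1) * cnorm1 (h' z.2)))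
    (fun z => cnorm1 (h1 z.1) * cnorm1 (h' z.2) *
      `|sigma (span_proj e z.1) (span_proj e z.2)|)).
  - by move=> t _; apply: measurable_cnorm1; case: (rlam t) => /cintegrable_measurable.
  - have := integrableZl measurableT 4
      (integrable_prod (integrable_cnorm1 i1) (integrable_cnorm1 i')).
    by apply: eq_integrable.
  - move=> t z _; rewrite cnorm1_ge0 /= DE mulrC (le_trans (cnorm1M _ _))// ler_pM ?cnorm1_ge0//.
      rewrite (le_trans (cnorm1D _ _))// cnorm1N.
      have := cnorm1_expi (- (t * sigma (span_proj e z.1) (span_proj e z.2) / 2)).
      have -> : cnorm1 (1 : R[i]) = 1 by rewrite /cnorm1 /= normr1 normr0 addr0.
      lra.
    exact: cnorm1M.
  - move=> t z _; rewrite DE (le_trans (cnorm1M _ _))// mulrCA ler_pM ?cnorm1_ge0//.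
      exact: cnorm1M.
    rewrite (le_trans (cnorm1_expiB1 _))// normrN !normrM.
    by rewrite [`|2^-1|]ger0_norm// mulrC divfK.
move=> t t0.
have [_ Pi_lin Pi_mul _] := Pi_rep t0.
have M0 := twisted_conv_ME sl sr 0 M N; have Mt := twisted_conv_ME sl sr t M N.
(* Linearity and multiplicativity of [Pi] collapse the operator into [Pi] of the single measure
   [lam t], to which the norm bound applies. *)
have lam_op (W0 Wt L B : H t -> H t) :
    L = (-1 \*: W0) \+ Wt -> Wt = B -> B \- W0 = L.
  by move=> -> ->; apply/funext => x /=; rewrite scaleN1r addrC.
rewrite (lam_op _ _ _ _ (Pi_lin _ _ _ M0 Mt) (Pi_mul _ _ M N)).
exact: (opnorm_density_le sl sr sigma_antisym (Pi_rep t0) (lamM t) (rlam t) t0).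
Qed.

Variables (vs : E -> R) (c : R).
Hypotheses (vs_seminorm : is_seminorm vs) (c_gt0 : 0 < c).
Hypothesis sigma_le : forall f g : E, `|sigma f g| <= c * vs f * vs g.

Let svs (x : E) : R := c * vs x.

Let svs_ge0 x : 0 <= svs x.
Proof. by rewrite mulr_ge0 ?seminorm_ge0 ?ltW. Qed.

Let sigma_kernel_le (x y : E) : cnorm1 (sigma x y)%:C%C <= svs x * vs y.
Proof. by rewrite cnorm1_real. Qed.

Let cmeasurable_sigma_kernel e : cmeasurable (fun z : borel E * borel E =>
  (sigma (span_proj e z.1) (span_proj e z.2))%:C%C).
Proof. by apply: cmeasurable_real; exact: measurable_sigma_span. Qed.

Let integrable_svs e (m : {finite_measure set (borel E) -> \bar R}) (h : borel E -> R[i]) :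
  m.-integrable setT (fun x => (vs (span_proj e x) * cnorm1 (h x))%:E) ->
  m.-integrable setT (fun x => (svs (span_proj e x) * cnorm1 (h x))%:E).
Proof.
move=> ih; have := integrableZl measurableT c ih; apply: eq_integrable => // x _.
by rewrite /svs -EFinM mulrA.
Qed.

Lemma bracket0_kernel_conv mu nu :
  bracket0 sigma mu nu = kernel_conv (fun x y => (sigma x y)%:C%C) mu nu.
Proof.
apply: (congr1 on_measurable); apply/funext => A.
apply: (congr1 (cintegral mu)); apply/funext => f.
apply: (congr1 (cintegral nu)); apply/funext => g.
by rewrite rmorphM.
Qed.

(** Membership of the bracket in [ME] is part of the conclusion because the quantization of its
    Fourier transform is prescribed only for elements of [ME]. *)
Lemma Dirac_limit mu nu : ME1 vs mu -> ME1 vs nu ->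
  ME E (bracket0 sigma mu nu) /\
  (fun t => opnorm (scaled_commutator t (@Pi t mu) (@Pi t nu) \-
    @Pi t (bracket0 sigma mu nu))) @ (0 : R)^' --> (0 : \bar R).
Proof.
move=> M1 N1; have [M _] := M1; have [N _] := N1.
have [e [m [m' [h1 [h2 [h' [r1 _ r' [_ tv1 _ tv']]]]]]]] := ME_represented3 M M N.
have i1 := ME1_integrable vs_seminorm M1 r1 tv1.
have i' := ME1_integrable vs_seminorm N1 r' tv'.
have vs0 x : 0 <= vs x by exact: seminorm_ge0.
have rb : span_represents e (finite_prod m m')
    (kernel_density (fun x y => (sigma x y)%:C%C) h1 h' (span_proj e) (span_proj e))
    (sum_map (span_proj e) (span_proj e)) (bracket0 sigma mu nu).
  rewrite bracket0_kernel_conv.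
  exact: (kernel_conv_represents (cmeasurable_sigma_kernel e) svs_ge0 vs0
    sigma_kernel_le r1 r' (integrable_svs i1) i').
have bM : ME E (bracket0 sigma mu nu).
  by apply: (represents_ME rb) => A mA; rewrite /bracket0 /on_measurable asboolF.
split => //.
pose com t : set (borel E) -> R[i] := fun A =>
  -1 * twisted_conv sigma t nu mu A + twisted_conv sigma t mu nu A.
(* [- bracket0], in the shape [a * mu + nu] for which [Pi] is linear *)
pose opp_b : set (borel E) -> R[i] := fun A =>
  -2 * bracket0 sigma mu nu A + bracket0 sigma mu nu A.
pose lam t : set (borel E) -> R[i] := fun A => ('i / t%:C)%C * com t A + opp_b A.
have comM t : ME E (com t) by apply: ME_linear; exact: twisted_conv_ME.
have oppM : ME E opp_b by exact: ME_linear.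
have lamM t : ME E (lam t) by exact: (ME_linear _ (comM t) oppM).
pose D t (z : borel E * borel E) := ('i / t%:C)%C *
   (-1 * kernel_density (fun x y => phase sigma t y x) h1 h' (span_proj e) (span_proj e) z +
   kernel_density (phase sigma t) h1 h' (span_proj e) (span_proj e) z) +
   (-2 * kernel_density (fun x y => (sigma x y)%:C%C) h1 h' (span_proj e) (span_proj e) z +
   kernel_density (fun x y => (sigma x y)%:C%C) h1 h' (span_proj e) (span_proj e) z).
(* The product in the opposite order is brought to the product space of [mu] and [nu], with the
   arguments of the phase exchanged, so that the commutator has one density there. *)
have rswap t : span_represents e (finite_prod m m')
    (kernel_density (fun x y => phase sigma t y x) h1 h' (span_proj e) (span_proj e))
    (sum_map (span_proj e) (span_proj e)) (twisted_conv sigma t nu mu).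
  have [_ _ _ eA] := twisted_conv_represents sl sr t r' r1.
  have mk : cmeasurable (fun z : borel E * borel E =>
      (fun x y => phase sigma t y x) (span_proj e z.1) (span_proj e z.2)).
    have := cmeasurable_comp (psi := fun z : borel E * borel E => (z.2, z.1)) _
      (cmeasurable_phase sl sr t e).
    by apply; apply: measurable_fun_pair.
  have kb x y : cnorm1 (phase sigma t y x) <= 1 * 2 by exact: phase_le.
  have [ih1 _ _ _] := r1; have [ih' _ _ _] := r'.
  split.
  - exact: (cintegrable_kernel_density (a := fun=> 1) (b := fun=> 2) mk kb r1 r'
      (integrable_scale 1 ih1) (integrable_scale 2 ih')).
  - exact: (measurable_sum_map r1 r').
  - exact: (sum_map_span r1 r').
  - move=> A mA; rewrite eA//.
    exact: (cint_phase_swap sl sr t r' r1 (cmeasurable_indic mA) (cnorm1_indic A)).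
have rlam t : span_represents e (finite_prod m m') (D t)
    (sum_map (span_proj e) (span_proj e)) (lam t).
  apply: represents_linear; last exact: represents_linear.
  by apply: represents_linear; last exact: twisted_conv_represents.
(* [(i / t) (e^{-i t s / 2} - e^{i t s / 2}) = (2 / t) sin (t s / 2)] *)
have DE t z : t != 0 -> D t z = h1 z.1 * h' z.2 *
    (2 / t * sin (t * sigma (span_proj e z.1) (span_proj e z.2) / 2) -
     sigma (span_proj e z.1) (span_proj e z.2))%:C%C.
  move=> t0; rewrite /D /kernel_density.
  set s := sigma (span_proj e z.1) _.
  have ph : ('i / t%:C)%C * (phase sigma t (span_proj e z.1) (span_proj e z.2) -
      phase sigma t (span_proj e z.2) (span_proj e z.1)) =
      (2 / t * sin (t * s / 2))%:C%C.
    rewrite /phase [sigma (span_proj e z.2) _]sigma_antisym -/s mulrN mulNr opprK.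
    rewrite -fmorphV; apply: complex_eqP; rewrite ?ReM ?ImM ?ReD ?ImD ?ReN ?ImN /=.
      by rewrite sinN cosN; field.
    by rewrite sinN cosN; field.
  rewrite rmorphB/= -ph.
  move: (h1 z.1) (h' z.2) ('i / t%:C)%C (phase sigma t _ _) (phase sigma t _ _) (s%:C)%C.
  by move=> *; ring.
have sv_le (x y : E) : `|sigma x y| <= svs x * vs y by [].
apply: (@opnorm_cvg0 _ _ _ (fun t => \int[finite_prod m m']_z cnorm1 (D t z))).
  apply: (@Rintegral_dnbhs0 _ _ _ _ _ (fun z => 2 *
    ((svs (span_proj e z.1) * cnorm1 (h1 z.1)) * (vs (span_proj e z.2) * cnorm1 (h' z.2))))
    (fun z => cnorm1 (h1 z.1) * cnorm1 (h' z.2) *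
      sigma (span_proj e z.1) (span_proj e z.2) ^+ 2)).
  - by move=> t _; apply: measurable_cnorm1; case: (rlam t) => /cintegrable_measurable.
  - have := integrableZl measurableT 2 (integrable_prod (integrable_svs i1) i').
    by apply: eq_integrable.
  - move=> t z t0; rewrite cnorm1_ge0 /= DE// (le_trans (cnorm1M _ _))// cnorm1_real.
    set s := sigma (span_proj e z.1) _.
    (* From the sine being at most its argument in absolute value: the factor [t] cancels, leaving
       twice the absolute value of [s] uniformly in [t]. This linear bound is what the first moments
       make integrable. *)
    have hs : `|2 / t * sin (t * s / 2) - s| <= 2 * `|s|.
      have -> : 2 * `|s| = `|s| + `|s| by ring.
      rewrite (le_trans (ler_normB _ _))// lerD2r normrM.
      have := normr_sin_le (t * s / 2); rewrite !normrM !normfV (ger0_norm (ler0n _ 2)).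
      have t_gt0 : 0 < `|t| by rewrite normr_gt0.
      move=> hh; apply: (le_trans (ler_wpM2l _ hh)); first by rewrite mulr_ge0.
      rewrite le_eqVlt; apply/orP; left; apply/eqP; field.
      by rewrite normr_eq0.
    apply: (@le_trans _ _ (cnorm1 (h1 z.1) * cnorm1 (h' z.2) *
        (2 * (svs (span_proj e z.1) * vs (span_proj e z.2))))).
      apply: ler_pM => //; [exact: cnorm1_ge0|exact: cnorm1M|].
      by rewrite (le_trans hs)// ler_pM2l// sv_le.
    by rewrite le_eqVlt; apply/orP; left; apply/eqP; ring.
  - move=> t z t0; rewrite DE// (le_trans (cnorm1M _ _))// cnorm1_real.
    rewrite mulrCA; apply: ler_pM => //; [exact: cnorm1_ge0|exact: cnorm1M|].
    set s := sigma (span_proj e z.1) _.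
    (* With [2 / t] factored out, the quadratic bound on [sin u - u] at [u = t * s / 2] gives half
       the absolute value of [t] times [s ^+ 2]. *)
    have -> : 2 / t * sin (t * s / 2) - s = 2 / t * (sin (t * s / 2) - t * s / 2).
      by field.
    have t_gt0 : 0 < `|t| by rewrite normr_gt0.
    rewrite normrM (le_trans (ler_wpM2l _ (normr_sinB_le _)))//.
    rewrite normrM normfV (ger0_norm (ler0n _ 2)).
    have -> : (t * s / 2) ^+ 2 = `|t| ^+ 2 * s ^+ 2 / 4.
      by rewrite real_normK ?num_real//; field.
    have -> : 2 / `|t| * (`|t| ^+ 2 * s ^+ 2 / 4) = `|t| * s ^+ 2 / 2.
      by field; rewrite normr_eq0.
    have : 0 <= `|t| * s ^+ 2 by rewrite mulr_ge0 ?sqr_ge0.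
    by lra.
move=> t t0.
have [_ Pi_lin Pi_mul _] := Pi_rep t0.
have MN := twisted_conv_ME sl sr t M N; have NM := twisted_conv_ME sl sr t N M.
have lam_op (L C O A B AB BA S : H t -> H t) :
    L = (('i / t%:C)%C \*: C) \+ O -> C = (-1 \*: BA) \+ AB -> O = (-2 \*: S) \+ S ->
    BA = B \o A -> AB = A \o B -> scaled_commutator t A B \- S = L.
  move=> -> -> -> -> ->; apply/funext => x; rewrite /scaled_commutator /=.
  rewrite scaleN1r [- _ + _ in RHS]addrC; congr (_ + _).
  by rewrite scaleNr scaler_nat mulr2n opprD subrK.
rewrite (lam_op _ _ _ _ _ _ _ _ (Pi_lin _ _ _ (comM t) oppM) (Pi_lin _ _ _ NM MN)
  (Pi_lin _ _ _ bM bM) (Pi_mul _ _ N M) (Pi_mul _ _ M N)).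
exact: (opnorm_density_le sl sr sigma_antisym (Pi_rep t0) (lamM t) (rlam t) t0).
Qed.

End semiclassical_limits.

Theorem theorem6 (R : realType)
  (* [E] carries the auxiliary topology used for the Fourier transform *)
  (E : tvsType R) (E_hausdorff : hausdorff_space E)
  (E_infinite : infinite_dimensional E)
  (sigma : {biscalar E})
  (sigma_antisym : forall f g : E, sigma f g = - sigma g f)
  (sigma_neq0 : exists f g : E, sigma f g != 0)
  (H : R -> hilbertType R)
  (Pi : forall hbar : R, (set (borel E) -> R[i]) -> H hbar -> H hbar)
  (Pi_rep : forall hbar : R, hbar != 0 -> representation sigma hbar (Pi hbar))
  (Q : forall hbar : R, (dual E -> R[i]) -> H hbar -> H hbar)
  (Q_def : forall hbar : R, hbar != 0 -> forall mu, ME E mu ->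
    Q hbar (fourier mu) = Pi hbar mu)
  (vs : E -> R) (vs_seminorm : is_seminorm vs)
  (c : R) (c_gt0 : 0 < c)
  (sigma_le : forall f g : E, `|sigma f g| <= c * vs f * vs g) :
  (forall mu nu, ME1 vs mu -> ME1 vs nu ->
    (fun hbar : R => opnorm (
       scaled_commutator hbar (Q hbar (fourier mu)) (Q hbar (fourier nu))
       \- Q hbar (fourier (bracket0 sigma mu nu)))) @ (0 : R)^' --> (0 : \bar R))
  /\
  (forall mu nu, ME E mu -> ME E nu ->
    (fun hbar : R => opnorm (
       (Q hbar (fourier mu) \o Q hbar (fourier nu))
       \- Q hbar (fourier mu \* fourier nu))) @ (0 : R)^' --> (0 : \bar R)).
Proof.
have sl (y : E) : scalar (sigma^~ y) by move=> a u v; rewrite linearDl linearZl_LR.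
have sr (x : E) : scalar (sigma x) by move=> a u v; rewrite linearDr linearZr.
(* The hypotheses on [Q] and [Pi] concern [hbar != 0]; the limit is over punctured neighbourhoods of
   0, so agreement there is enough. *)
have near_eq (f g : R -> \bar R) : (forall t, t != 0 -> f t = g t) ->
    f @ (0 : R)^' --> (0 : \bar R) -> g @ (0 : R)^' --> (0 : \bar R).
  move=> fg; apply: cvg_trans; apply: near_eq_cvg.
  by near=> t; apply: fg; near: t; exact: nbhs_dnbhs_neq.
split=> mu nu M N.
- have [bM] := Dirac_limit sl sr sigma_antisym Pi_rep vs_seminorm c_gt0 sigma_le M N.
  apply: near_eq => t t0; rewrite !Q_def//; [by case: N|by case: M].
- have := von_Neumann_limit sl sr sigma_antisym Pi_rep M N.
  apply: near_eq => t t0; rewrite !Q_def//.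
  by rewrite -(fourier_twisted_conv0 sl sr M N) Q_def//; exact: twisted_conv_ME.
Unshelve. all: by end_near. Qed.
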